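(* Let $\mathcal{A}=\mathcal{A}(B_\circ,\mathbf{p}_\circ)$ be a cluster algebra of finite type, where $B_\circ=(b_{ij})$ is a sign-skew-symmetric integer matrix whose Cartan counterpart is a Cartan matrix of finite type and which satisfies $b_{ij}b_{ik}\ge0$ for all $i,j,k$, and $\mathbf{p}_\circ$ is a tuple of elements of a semifield $\mathbb{P}$ satisfying the normalization conditions. Every seed $(\mathbf{x},\mathbf{p},B)$ in $\mathcal{A}$ is uniquely determined by its cluster $\mathbf{x}$. For any cluster $\mathbf{x}$ and any $x\in\mathbf{x}$, there is a unique cluster $\mathbf{x}'$ with $\mathbf{x}\cap\mathbf{x}'=\mathbf{x}-\{x\}$.
   Context: Semifields. A semifield $(\mathbb{P},\oplus,\cdot)$ is an abelian multiplicative group with a commutative, associative operation $\oplus$ over which multiplication distributes. Its multiplicative group is torsion-free, so the group ring $\mathbb{Z}\mathbb{P}$ is a domain. Seeds. Fix $\mathbb{P}$ and a rank $n$. The ambient field $\mathcal{F}$ is isomorphic to the field of rational functions in $n$ independent variables with coefficients in $\mathbb{Z}\mathbb{P}$. A seed in $\mathcal{F}$ is a triple $\Sigma=(\mathbf{x},\mathbf{p},B)$ where: $\mathbf{x}\subset\mathcal{F}$ is an $n$-element transcendence basis over the fraction field of $\mathbb{Z}\mathbb{P}$; $\mathbf{p}=(p_x^{\pm})_{x\in\mathbf{x}}$ is a $2n$-tuple of elements of $\mathbb{P}$ satisfying the normalization condition $p_x^+\oplus p_x^-=1$ for all $x$; $B=(b_{xy})_{x,y\in\mathbf{x}}$ is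 an integer matrix that is sign-skew-symmetric, i.e. for all $x,y$ either $b_{xy}=b_{yx}=0$ or $b_{xy}b_{yx}<0$. Mutations. The matrix mutation in direction $k$ sends $B=(b_{ij})$ to $B'=(b'_{ij})$ with $b'_{ij}=-b_{ij}$ if $i=k$ or $j=k$, and $b'_{ij}=b_{ij}+\frac{|b_{ik}|b_{kj}+b_{ik}|b_{kj}|}{2}$ otherwise. For a seed $\Sigma$ and $z\in\mathbf{x}$ define $\overline\Sigma=(\overline{\mathbf{x}},\overline{\mathbf{p}},\overline B)$: $\overline{\mathbf{x}}=\mathbf{x}-\{z\}\cup\{\overline z\}$ with $\overline z$ given by the exchange relation $z\overline z=p_z^+\prod_{b_{xz}>0}x^{b_{xz}}+p_z^-\prod_{b_{xz}<0}x^{-b_{xz}}$; $\overline{\mathbf{p}}$ is determined by normalization $\overline p_x^+\oplus\overline p_x^-=1$ and $\overline p_x^+/\overline p_x^-=p_z^-/p_z^+$ if $x=\overline z$, $=(p_z^+)^{b_{zx}}p_x^+/p_x^-$ if $b_{zx}\ge0$, $=(p_z^-)^{b_{zx}}p_x^+/p_x^-$ if $b_{zx}\le0$; $\overline B$ is the matrix mutation of $B$ in direction $z$, with the index $z$ relabeled $\overline z$. If $\overline\Sigma$ is a seed, $\Sigma$ admits a mutation in direction $z$. Cluster algebras. Let $\mathcal{S}$ be a set of seeds in $\mathcal{F}$ such that each seed in $\mathcal S$ admits mutations in all $n$ directions, with results in $\mathcal{S}$, and any two seeds in $\mathcal{S}$ are related by a sequence of mutations. The sets $\mathbf{x}$ are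 clusters, their elements cluster variables; $\mathcal{X}$ is the set of all cluster variables and $\mathcal{P}$ the set of all $p_x^\pm$ over all seeds in $\mathcal{S}$. The cluster algebra $\mathcal{A}(\mathcal{S})$ is the $\mathbb{Z}[\mathcal{P}]$-subalgebra of $\mathcal{F}$ generated by $\mathcal{X}$; its seeds are the elements of $\mathcal{S}$. It is of finite type if $\mathcal{S}$ is finite. $\mathcal{A}(B,\mathbf{p})$ denotes the cluster algebra having a seed with matrix $B$ and coefficient tuple $\mathbf{p}$ (it is well defined for the matrices $B_\circ$ in the claim, which are skew-symmetrizable). Cartan counterpart. For an integer square matrix $B=(b_{ij})$, $A(B)=(a_{ij})$ is given by $a_{ii}=2$ and $a_{ij}=-|b_{ij}|$ for $i\ne j$. Cartan matrices of finite type need not be indecomposable. *)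

(* Defs.v *)
From HB Require Import structures.
From mathcomp Require Import all_boot all_order all_algebra finmap.
From mathcomp.multinomials Require Import mpoly.
From Stdlib Require Import Relation_Operators.

Set Implicit Arguments.
Unset Strict Implicit.
Unset Printing Implicit Defensive.

Import Order.TTheory GRing.Theory Num.Theory.
Local Open Scope fset_scope.
Local Open Scope ring_scope.

HB.mixin Record Group_isSemifield P of Group P := {
  oplus : P -> P -> P;
  semifield_mulC : forall x y : P, (x * y = y * x)%g;
  oplusA : associative oplus;
  oplusC : commutative oplus;
  semifield_mulDr : forall x y z : P,
    (x * oplus y z)%g = oplus (x * y)%g (x * z)%g
}.

#[short(type="semifieldType")]
HB.structure Definition Semifield := { P of Group_isSemifield P & Group P }.

Definition expgz (P : groupType) (g : P) (m : int) : P :=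
  match m with
  | Posz k => (g ^+ k)%g
  | Negz k => (g ^- k.+1)%g
  end.

(* The elements of the group ring ZP are the finitely supported functions
   P -> int; a map u : P -> K extends to them Z-linearly. *)
Definition group_ring_eval (P : groupType) (K : fieldType) (u : P -> K)
    (c : {fsfun P -> int with 0}) : K :=
  \sum_(g <- finsupp c) (c g)%:~R * u g.

(* K is the fraction field of ZP: the Z-linear extension of u is an injective
   ring morphism ZP -> K, and every element of K is a quotient of two elements
   of its image. *)
Record is_group_ring_fractions (P : groupType) (K : fieldType) (u : P -> K) :
    Prop := {
  group_ring_one : u 1%g = 1;
  group_ring_mul : forall g h, u (g * h)%g = u g * u h;
  group_ring_inj : injective (group_ring_eval u);
  group_ring_frac : forall a : K, exists c d : {fsfun P -> int with 0},
    group_ring_eval u d != 0 /\ a = group_ring_eval u c / group_ring_eval u d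
}.

Record ambientField (P : semifieldType) (n : nat) := AmbientField {
  fracZP : fieldType;
  fracZP_coef : P -> fracZP;
  fracZP_coefP : is_group_ring_fractions fracZP_coef;
  ambient :> fieldType;
  ambient_iso : {rmorphism {fraction {mpoly fracZP[n]}} -> ambient};
  ambient_iso_bij : bijective ambient_iso
}.

Definition of_fracZP (P : semifieldType) (n : nat) (F : ambientField P n)
    (a : fracZP F) : F := ambient_iso F (tofrac (a%:MP)).

Definition of_semifield (P : semifieldType) (n : nat) (F : ambientField P n)
    (g : P) : F := of_fracZP (fracZP_coef F g).

Definition in_adjoin (K F : fieldType) (j : K -> F) (n : nat) (t : 'I_n -> F)
    (a : F) : Prop :=
  exists q r : {mpoly K[n]}, mmap j t r != 0 /\ a = mmap j t q / mmap j t r.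

Definition transcendence_basis (K F : fieldType) (j : K -> F) (n : nat)
    (t : 'I_n -> F) : Prop :=
  (forall q : {mpoly K[n]}, mmap j t q = 0 -> q = 0) /\
  (forall a : F, exists p : {poly F},
     [/\ p != 0, forall i, in_adjoin j t p`_i & root p a]).

Definition sign_skew_symmetric (I : Type) (b : I -> I -> int) : Prop :=
  forall x y, (b x y = 0 /\ b y x = 0) \/ b x y * b y x < 0.

(* The sum that is halved is always even, so the division is exact. *)
Definition matrix_mutation (I : eqType) (k : I) (b : I -> I -> int) (i j : I) :
    int :=
  if (i == k) || (j == k) then - b i j
  else b i j + ((`|b i k| * b k j + b i k * `|b k j|) %/ 2)%Z.

Section Seeds.

Variables (P : semifieldType) (n : nat) (F : ambientField P n).

(* coef x is the pair (p_x^+, p_x^-). *)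
Record triple := Triple {
  cluster : {fset F};
  coef : {ffun cluster -> P * P};
  exch : {ffun cluster * cluster -> int}
}.

Definition pplus (s : triple) (x : cluster s) : P := (coef s x).1.
Definition pminus (s : triple) (x : cluster s) : P := (coef s x).2.
Definition bmat (s : triple) (x y : cluster s) : int := exch s (x, y).

Record is_seed (s : triple) : Prop := {
  seed_transcendence_basis : exists2 t : 'I_n -> cluster s, bijective t &
    transcendence_basis (@of_fracZP P n F) (fun i => val (t i));
  seed_normalized : forall x : cluster s, oplus (pplus x) (pminus x) = 1%g;
  seed_sign_skew_symmetric : sign_skew_symmetric (@bmat s)
}.

Definition exchange_rhs (s : triple) (z : cluster s) : F :=
  of_semifield F (pplus z) *
    \prod_(x : cluster s | 0 < bmat x z) val x ^+ `|bmat x z|%N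
  + of_semifield F (pminus z) *
    \prod_(x : cluster s | bmat x z < 0) val x ^+ `|bmat x z|%N.

Definition relabel (s : triple) (z : cluster s) (zbar : F) (x : cluster s) : F :=
  if x == z then zbar else val x.

Record is_mutation_with (s : triple) (z : cluster s) (zbar : F) (s' : triple) :
    Prop := {
  mutation_exchange : val z * zbar = exchange_rhs z;
  mutation_cluster : cluster s' = zbar |` (cluster s `\ val z);
  mutation_normalized : forall y : cluster s',
    oplus (pplus y) (pminus y) = 1%g;
  mutation_coef_new : forall y : cluster s', val y = zbar ->
    (pplus y / pminus y = pminus z / pplus z)%g;
  mutation_coef_pos : forall (x : cluster s) (y : cluster s'),
    x != z -> val y = val x -> 0 <= bmat z x ->
    (pplus y / pminus y = expgz (pplus z) (bmat z x) * (pplus x / pminus x))%g;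
  mutation_coef_neg : forall (x : cluster s) (y : cluster s'),
    x != z -> val y = val x -> bmat z x <= 0 ->
    (pplus y / pminus y = expgz (pminus z) (bmat z x) * (pplus x / pminus x))%g;
  mutation_matrix : forall (x1 x2 : cluster s) (y1 y2 : cluster s'),
    val y1 = relabel z zbar x1 -> val y2 = relabel z zbar x2 ->
    bmat y1 y2 = matrix_mutation z (@bmat s) x1 x2
}.

Definition is_mutation (s : triple) (z : cluster s) (s' : triple) : Prop :=
  is_seed s' /\ exists zbar : F, is_mutation_with z zbar s'.

(* A cluster algebra is given together with its set of seeds. *)
Record clusterAlgebra := ClusterAlgebra {
  seeds : triple -> Prop;
  seeds_are_seeds : forall s, seeds s -> is_seed s;
  seeds_mutation : forall s, seeds s -> forall z : cluster s,
    exists2 s', is_mutation z s' & seeds s';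
  seeds_connected : forall s s', seeds s -> seeds s' ->
    clos_refl_trans triple (fun s1 s2 => exists z : cluster s1, is_mutation z s2)
      s s'
}.

(* The underlying ring: the Z[PP]-subalgebra of F generated by the cluster
   variables, where PP is the set of all coefficients of seeds. *)
Inductive in_cluster_algebra (A : clusterAlgebra) : F -> Prop :=
| cluster_algebra_var s (x : cluster s) :
    seeds A s -> in_cluster_algebra A (val x)
| cluster_algebra_pplus s (x : cluster s) :
    seeds A s -> in_cluster_algebra A (of_semifield F (pplus x))
| cluster_algebra_pminus s (x : cluster s) :
    seeds A s -> in_cluster_algebra A (of_semifield F (pminus x))
| cluster_algebra1 : in_cluster_algebra A 1
| cluster_algebraB a b : in_cluster_algebra A a -> in_cluster_algebra A b ->
    in_cluster_algebra A (a - b)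
| cluster_algebraM a b : in_cluster_algebra A a -> in_cluster_algebra A b ->
    in_cluster_algebra A (a * b).

Definition is_cluster (A : clusterAlgebra) (X : {fset F}) : Prop :=
  exists2 s, seeds A s & cluster s = X.

Definition finite_type (A : clusterAlgebra) : Prop :=
  exists (m : nat) (f : 'I_m -> triple),
    forall s, seeds A s -> exists i, f i = s.

Definition has_initial_seed (A : clusterAlgebra) (B0 : 'M[int]_n)
    (p0 : 'I_n -> P * P) : Prop :=
  exists2 s, seeds A s & exists e : 'I_n -> cluster s,
    [/\ bijective e,
        forall i, coef s (e i) = p0 i &
        forall i j, bmat (e i) (e j) = B0 i j].

End Seeds.

Definition cartan_counterpart (n : nat) (B : 'M[int]_n) : 'M[int]_n :=
  \matrix_(i, j) (if i == j then 2 else - `|B i j|).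

(* Positive definiteness on rational vectors is equivalent to positive
   definiteness on real ones, since the form has rational coefficients. *)
Definition cartan_finite_type (n : nat) (A : 'M[int]_n) : Prop :=
  [/\ forall i, A i i = 2,
      forall i j, i != j -> A i j <= 0,
      forall i j, A i j = 0 -> A j i = 0 &
      exists2 d : 'rV[rat]_n, forall i, 0 < d 0 i &
        let S := diag_mx d *m map_mx intr A in
        S^T = S /\ forall v : 'rV[rat]_n, v != 0 -> 0 < (v *m S *m v^T) 0 0].

(* Main.v *)
Require Import Defs.
From HB Require Import structures.
From mathcomp Require Import all_boot all_order all_algebra finmap.
From mathcomp.multinomials Require Import mpoly.
From mathcomp Require Import ring lra zify.
From Stdlib Require Import Relation_Operators.

Set Implicit Arguments.
Unset Strict Implicit.
Unset Printing Implicit Defensive.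

Import Order.TTheory GRing.Theory Num.Theory.
Local Open Scope ring_scope.

(** Let K be the fraction field of ZP. The proof rests on the idea of Gekhtman,
    Shapiro and Vainshtein that the Laurent phenomenon makes the exchange
    polynomials invariants of the clusters.

    By the Laurent phenomenon [Laurent_phenomenon], every cluster variable is a
    Laurent polynomial over K in every cluster. Suppose that two seeds have the
    same cluster, and let M and N be their exchange polynomials for a variable
    x of it. Then N / x is a Laurent polynomial in the cluster that contains
    M / x instead of x, so M divides N in the Laurent ring of the variables
    other than x, and conversely. As M and N are binomials that are not
    divisible by any variable, the two columns agree up to a sign, and the two
    pairs of coefficients are proportional, possibly after a swap
    [compare_columns]. The normalization forces the factor of proportionality
    to be 1. The sign is detected by the 2-form
    sum b_il f_l dlog x_i /\ dlog x_l, which is the same for all seeds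
    [log_form_path] and whose coefficients in a cluster are the entries of the
    matrix. A zero column has no sign to detect; there the coefficients are
    followed along the mutations, where the vertex stays isolated
    [ppath_isolated].

    Now let two clusters differ in one variable only, x in the first and z in
    the second. The product of z and the variable exchanged with it is an
    exchange polynomial, hence free of x; both factors are Laurent polynomials
    in x, so z = d x^m, and m = 1 or m = -1 by symmetry. If m = -1, the first
    seed is replaced with its mutation at x. In the case m = 1 the factor d is
    a unit. It does not involve any other variable, because the exchange
    polynomials are not units [exchange_factor_degree_ge0], and comparing
    the columns of a direction connected to x shows that a power of d is an
    element of P. The subtraction-free elements of the field are mapped to P by
    setting the variables of a cluster to 1 and replacing + with oplus; the
    normalization p+ (+) p- = 1 says precisely that every cluster variable is
    mapped to 1 [ppath_tropicalizes]. Therefore that power of d is 1, and so is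
    d [subtraction_free_root], which leaves z = x [exchange_factor_trivial].
    Applied to the mutation at x, this is the uniqueness of the adjacent
    cluster [adjacent_cluster_unique].

    The Laurent phenomenon is proved with the upper bounds of Berenstein, Fomin
    and Zelevinsky. The intersection of the Laurent ring of a cluster with
    those of the neighbouring clusters does not change under mutation if the
    exchange polynomials of unconnected directions are coprime
    [upper_mutation], which holds when the exchange matrix is invertible
    [exchange_coprime]. Any seed is reduced to this case by attaching a new
    vertex to each vertex, and the new variables are set to 1 at the end. *)

(** * Laurent polynomials in one variable over a subring of a field *)

Record is_subring (F : fieldType) (D : F -> Prop) : Prop := IsSubring {
  subring1 : D 1;
  subringB : forall a b, D a -> D b -> D (a - b);
  subringM : forall a b, D a -> D b -> D (a * b)
}.

Section RingPredicates.
Variables (F : fieldType) (D : F -> Prop).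
Hypothesis rD : is_subring D.

Lemma subring0 : D 0.
Proof. by rewrite -(subrr 1); apply: subringB rD _ _ (subring1 rD) (subring1 rD). Qed.

Lemma subringN a : D a -> D (- a).
Proof. by move=> Da; rewrite -(add0r (- a)); apply: subringB rD _ _ subring0 Da. Qed.

Lemma subringD a b : D a -> D b -> D (a + b).
Proof.
by move=> Da Db; rewrite -(opprK b); apply: subringB rD _ _ Da (subringN Db).
Qed.

Lemma subringX a n : D a -> D (a ^+ n).
Proof.
move=> Da; elim: n => [|n IHn]; first by rewrite expr0; apply: subring1 rD.
by rewrite exprS; apply: subringM rD _ _ Da IHn.
Qed.

Lemma subring_sum (I : Type) (r : seq I) (P : pred I) (f : I -> F) :
  (forall i, P i -> D (f i)) -> D (\sum_(i <- r | P i) f i).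
Proof. by move=> Df; apply: big_ind => //; [apply: subring0|exact: subringD]. Qed.

Lemma subring_prod (I : Type) (r : seq I) (P : pred I) (f : I -> F) :
  (forall i, P i -> D (f i)) -> D (\prod_(i <- r | P i) f i).
Proof. by move=> Df; apply: big_ind => //; [apply: subring1 rD|apply: subringM rD]. Qed.

Lemma subringXz a (m : int) : D a -> D a^-1 -> D (a ^ m).
Proof. by move=> Da Dv; case: m => m; [|rewrite NegzE -exprz_inv]; apply: subringX. Qed.

Lemma subring_signz (m : int) : D ((-1) ^ m).
Proof.
by apply: subringXz; rewrite ?invrN1; apply: subringN; apply: subring1 rD.
Qed.

End RingPredicates.

Definition coefs_in (F : fieldType) (D : F -> Prop) (p : {poly F}) : Prop :=
  forall i, D p`_i.

Section CoefsIn.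
Variables (F : fieldType) (D : F -> Prop).
Hypothesis rD : is_subring D.

Lemma coefs_in1 : coefs_in D 1.
Proof. by move=> i; rewrite coef1; case: (_ == _); [apply: subring1 rD|apply: subring0 rD]. Qed.

Lemma coefs_inC c : D c -> coefs_in D c%:P.
Proof. by move=> Dc i; rewrite coefC; case: (_ == _) => //; apply: subring0 rD. Qed.

Lemma coefs_inXn n : coefs_in D 'X^n.
Proof. by move=> i; rewrite coefXn; case: (_ == _); [apply: subring1 rD|apply: subring0 rD]. Qed.

Lemma coefs_inB p q : coefs_in D p -> coefs_in D q -> coefs_in D (p - q).
Proof. by move=> Dp Dq i; rewrite coefB; apply: subringB rD _ _ (Dp i) (Dq i). Qed.

Lemma coefs_inM p q : coefs_in D p -> coefs_in D q -> coefs_in D (p * q).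
Proof.
move=> Dp Dq i; rewrite coefM; apply: (subring_sum rD) => k _.
by apply: subringM rD _ _ (Dp _) (Dq _).
Qed.

Lemma coefs_inZ c p : D c -> coefs_in D p -> coefs_in D (c *: p).
Proof. by move=> Dc Dp i; rewrite coefZ; apply: subringM rD _ _ Dc (Dp _). Qed.

Lemma coefs_inMXn p m : coefs_in D p -> coefs_in D (p * 'X^m).
Proof. by move=> Dp; apply: coefs_inM => //; apply: coefs_inXn. Qed.

Lemma coefs_inZXn c m : D c -> coefs_in D (c *: 'X^m).
Proof. by move=> Dc; apply: coefs_inZ => //; apply: coefs_inXn. Qed.

Lemma coefs_in_poly n (E : nat -> F) :
  (forall i, D (E i)) -> coefs_in D (\poly_(i < n) E i).
Proof. by move=> DE i; rewrite coef_poly; case: ifP => // _; apply: subring0 rD. Qed.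

Lemma coefs_in_horner p a : coefs_in D p -> D a -> D p.[a].
Proof.
move=> Dp Da; rewrite horner_coef; apply: (subring_sum rD) => i _.
by apply: subringM rD _ _ (Dp _) (subringX rD _ Da).
Qed.

End CoefsIn.

Lemma coefs_inS (F : fieldType) (D E : F -> Prop) p :
  (forall a, D a -> E a) -> coefs_in D p -> coefs_in E p.
Proof. by move=> DE Dp i; apply/DE/Dp. Qed.

Definition transcendental (F : fieldType) (D : F -> Prop) (x : F) : Prop :=
  forall p, coefs_in D p -> p.[x] = 0 -> p = 0.

Lemma transcendental_eq (F : fieldType) (D : F -> Prop) (x : F) p q :
  is_subring D -> transcendental D x -> coefs_in D p -> coefs_in D q ->
  p.[x] = q.[x] -> p = q.
Proof.
move=> rD tx Dp Dq E; apply/eqP; rewrite -subr_eq0; apply/eqP; apply: tx.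
  exact: coefs_inB.
by rewrite hornerD hornerN E subrr.
Qed.

Definition laurent (F : fieldType) (D : F -> Prop) (x a : F) : Prop :=
  exists (p : {poly F}) n, coefs_in D p /\ a * x ^+ n = p.[x].

Section OneVariable.
Variables (F : fieldType) (D : F -> Prop).
Hypothesis rD : is_subring D.

Lemma laurent_in x a : D a -> laurent D x a.
Proof.
by exists a%:P, 0%N; split; [apply: coefs_inC|rewrite hornerC mulr1].
Qed.

Lemma laurent_var x : laurent D x x.
Proof.
by exists 'X^1, 0%N; split; [apply: coefs_inXn|rewrite hornerXn mulr1].
Qed.

Lemma laurent_varV x : x != 0 -> laurent D x x^-1.
Proof.
move=> x0; exists 1, 1%N; split; first exact: coefs_in1.
by rewrite hornerC expr1 mulVf.
Qed.

Lemma laurent_subring x : x != 0 -> is_subring (laurent D x).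
Proof.
move=> x0; split; first by apply: laurent_in (subring1 rD).
  move=> a b [p [n [Dp ap]]] [q [m [Dq bq]]].
  exists (p * 'X^m - q * 'X^n), (n + m)%N; split.
    by apply: coefs_inB => //; apply: coefs_inMXn.
  by rewrite hornerD hornerN !hornerM !hornerXn -ap -bq exprD; ring.
move=> a b [p [n [Dp ap]]] [q [m [Dq bq]]]; exists (p * q), (n + m)%N.
by split; [apply: coefs_inM|rewrite hornerM -ap -bq exprD; ring].
Qed.

(** In terms of x = M / x', a term c x'^s becomes c M^s x^-s; as x is
    transcendental, the coefficients of any expansion of a have this form. *)
Lemma pole_coef_divisible (x x' M a : F) p n :
  transcendental D x -> x != 0 -> M != 0 -> D M -> x * x' = M ->
  coefs_in D p -> a * x ^+ n = p.[x] -> laurent D x' a ->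
  forall i, (i < n)%N -> exists2 h, D h & p`_i = M ^+ (n - i) * h.
Proof.
move=> tx x0 M0 DM xx' Dp ap [q [m [Dq aq]]] i lt_in.
(* qs is x ^+ s * q.[x'] as a polynomial in x *)
pose s := (size q + m + n)%N.
pose qs := \poly_(t < s.+1) (q`_(s - t) * M ^+ (s - t)).
have Dqs : coefs_in D qs.
  by apply: coefs_in_poly => // t; apply: subringM rD _ _ (Dq _) (subringX rD _ DM).
have qsx : qs.[x] = x ^+ s * q.[x'].
  rewrite [q.[x']](@horner_coef_wide _ s.+1); last by rewrite /s; lia.
  rewrite horner_poly mulr_sumr (reindex_inj rev_ord_inj) /=.
  apply: eq_bigr => [[t /= lt_ts]] _; rewrite subSS subKn //.
  have -> : x ^+ s = x ^+ (s - t) * x ^+ t by rewrite -exprD subnK.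
  by rewrite -xx' exprMn; ring.
have E : (M ^+ m) *: (p * 'X^s) = qs * 'X^(m + n).
  apply: (transcendental_eq rD tx); last 1 first.
  - by rewrite hornerZ !hornerM !hornerXn qsx -ap -aq -xx' exprMn exprD; ring.
  - by apply: coefs_inZ (subringX rD _ DM) _ => //; apply: coefs_inMXn.
  - exact: coefs_inMXn.
have := congr1 (fun r : {poly F} => r`_(s + i)) E.
rewrite coefZ !coefMXn coef_poly.
have -> : (s + i < s)%N = false by lia.
have -> : (s + i < m + n)%N = false by rewrite /s; lia.
rewrite addKn; have -> : (s + i - (m + n) < s.+1)%N by lia.
have -> : (s - (s + i - (m + n)) = m + (n - i))%N by rewrite /s; lia.
move=> Ei; exists q`_(m + (n - i)); first exact: Dq.
apply: (mulfI (expf_neq0 m M0)); rewrite Ei exprD; ring.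
Qed.

(** The divisibility by powers of M turns each negative power of x into a
    power of x' = M / x. *)
Lemma laurent_in_subring (Q : F -> Prop) (x x' M a : F) p n :
  is_subring Q -> x != 0 -> Q x -> Q x' -> x * x' = M ->
  a * x ^+ n = p.[x] -> (forall i, (n <= i)%N -> Q p`_i) ->
  (forall i, (i < n)%N -> exists2 h, Q h & p`_i = M ^+ (n - i) * h) ->
  Q a.
Proof.
move=> rQ x0 Qx Qx' xx' ap Qp Qh.
have T i : exists2 t, Q t & p`_i * x ^+ i = t * x ^+ n.
  case: (leqP n i) => [le_ni|lt_in].
    exists (p`_i * x ^+ (i - n)).
      by apply: (subringM rQ); [apply: Qp|apply: (subringX rQ)].
    by rewrite -mulrA -exprD subnK.
  have [h Qh1 ->] := Qh i lt_in; exists (x' ^+ (n - i) * h).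
    by apply: (subringM rQ) => //; apply: (subringX rQ).
  have -> : x ^+ n = x ^+ (n - i) * x ^+ i by rewrite -exprD subnK // ltnW.
  by rewrite -xx' exprMn; ring.
have [t Qt Et] : exists2 t, Q t & \sum_(i < size p) p`_i * x ^+ i = t * x ^+ n.
  elim: (size p) => [|k [t Qt IHk]].
    by exists 0; [apply: subring0 rQ|rewrite big_ord0 mul0r].
  have [u Qu Eu] := T k; exists (t + u); first exact: (subringD rQ).
  by rewrite big_ord_recr /= IHk Eu mulrDl.
suff -> : a = t by [].
by apply: (mulIf (expf_neq0 n x0)); rewrite ap horner_coef.
Qed.

Lemma laurent_inter (Q : F -> Prop) (x x' M a : F) :
  is_subring Q -> (forall d, D d -> Q d) -> Q x -> Q x' ->
  transcendental D x -> x != 0 -> M != 0 -> D M -> x * x' = M ->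
  laurent D x a -> laurent D x' a -> Q a.
Proof.
move=> rQ DQ Qx Qx' tx x0 M0 DM xx' [p [n [Dp ap]]] La.
apply: (laurent_in_subring rQ x0 Qx Qx' xx' ap) => [i _|i lt_in].
  exact/DQ/Dp.
have [h Dh ->] := pole_coef_divisible tx x0 M0 DM xx' Dp ap La lt_in.
by exists h => //; apply: DQ.
Qed.

End OneVariable.

Lemma transcendentalS (F : fieldType) (D E : F -> Prop) x :
  (forall a, D a -> E a) -> transcendental E x -> transcendental D x.
Proof. by move=> DE tx p Dp; apply: tx; apply: coefs_inS Dp. Qed.

(** * Descent of Laurent expansions through one mutation *)

Section TwoVariables.
Variables (F : fieldType).
Implicit Types D Q R E : F -> Prop.

(** Since v is a unit modulo w, the powers of v and w generate the unit ideal. *)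
Lemma unimodular_descent Q (u v w h b : F) m n :
  is_subring Q -> u != 0 -> Q u^-1 -> Q v -> Q w -> Q h -> v = u + w * h ->
  Q (v ^+ m * b) -> Q (w ^+ n * b) -> Q b.
Proof.
move=> rQ u0 Qu Qv Qw Qh Ev; elim: {m n}(m + n)%N {-2}m {-2}n (leqnn (m + n)) b.
  by move=> [|m] [|n] //= _ b; rewrite expr0 mul1r.
move=> N IHN [|m] n lemn b; first by rewrite expr0 mul1r.
case: n lemn => [|n] lemn; first by rewrite expr0 mul1r.
move=> Qvb Qwb.
have Qv1 : Q (v * b).
  apply: (IHN m n.+1); first by lia.
    by rewrite mulrA -exprSr.
  by rewrite mulrCA; apply: (subringM rQ).
have Qw1 : Q (w * b).
  apply: (IHN m.+1 n); first by lia.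
    by rewrite mulrCA; apply: (subringM rQ).
  by rewrite mulrA -exprSr.
have -> : b = u^-1 * (v * b - h * (w * b)) by rewrite Ev; field.
by apply: (subringM rQ) => //; apply: (subringB rQ) => //; apply: (subringM rQ).
Qed.

Definition localization Q (x d : F) : Prop := exists n, Q (x ^+ n * d).

Lemma localization_in Q x d : Q d -> localization Q x d.
Proof. by exists 0%N; rewrite expr0 mul1r. Qed.

Lemma localizationV Q x : is_subring Q -> x != 0 -> localization Q x x^-1.
Proof. by move=> rQ x0; exists 1%N; rewrite expr1 mulfV //; apply: (subring1 rQ). Qed.

Lemma localization_ring Q x : is_subring Q -> Q x -> is_subring (localization Q x).
Proof.
move=> rQ Qx; have QX n := subringX rQ n Qx.
split; first by apply: localization_in (subring1 rQ).
  move=> a b [m Qa] [n Qb]; exists (m + n)%N.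
  have -> : x ^+ (m + n) * (a - b) = x ^+ n * (x ^+ m * a) - x ^+ m * (x ^+ n * b).
    by rewrite exprD; ring.
  by apply: (subringB rQ); apply: (subringM rQ).
move=> a b [m Qa] [n Qb]; exists (m + n)%N.
have -> : x ^+ (m + n) * (a * b) = (x ^+ m * a) * (x ^+ n * b).
  by rewrite exprD; ring.
exact: (subringM rQ).
Qed.

Lemma laurent_localization D Q x a :
  is_subring Q -> x != 0 -> Q x -> (forall d, D d -> Q d) -> laurent D x a ->
  localization Q x a.
Proof.
move=> rQ x0 Qx DQ [p [n [Dp ap]]]; exists n; rewrite mulrC ap.
by apply: (coefs_in_horner rQ) => //; apply: coefs_inS Dp.
Qed.

Lemma laurent_sub D Q x a :
  is_subring Q -> x != 0 -> Q x -> Q x^-1 -> (forall d, D d -> Q d) ->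
  laurent D x a -> Q a.
Proof.
move=> rQ x0 Qx QV DQ La.
have [n Qn] := laurent_localization rQ x0 Qx DQ La.
have -> : a = x^-1 ^+ n * (x ^+ n * a).
  by rewrite mulrA -exprMn mulVf // expr1n mul1r.
by apply: (subringM rQ) => //; apply: (subringX rQ).
Qed.

Lemma laurentS D E x a :
  (forall d, D d -> E d) -> laurent D x a -> laurent E x a.
Proof. by move=> DE [p [n [Dp ap]]]; exists p, n; split => //; apply: coefs_inS Dp. Qed.

Lemma exprz_congr1 Q (v z k : F) (m : int) :
  is_subring Q -> Q v -> Q v^-1 -> Q z -> Q k -> v != 0 -> v = 1 + z * k ->
  exists2 l, Q l & v ^ m = 1 + z * l.
Proof.
move=> rQ Qv Qv1 Qz Qk v0 Ev.
have P n : forall (u r : F), Q u -> Q r -> u = 1 + z * r ->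
    exists2 l, Q l & u ^+ n = 1 + z * l.
  move=> u r Qu Qr Eu; elim: n => [|n [l Ql IHl]].
    by exists 0; [apply: (subring0 rQ)|rewrite expr0 mulr0 addr0].
  exists (r + u * l).
    by apply: (subringD rQ) => //; apply: (subringM rQ).
  rewrite exprS IHl {1}Eu; have -> : u * l = l + z * r * l by rewrite Eu; ring.
  ring.
case: m => m; first exact: (P m v k).
rewrite NegzE -exprz_inv; apply: (P m.+1 v^-1 (- k * v^-1)) => //.
  by apply: (subringM rQ) => //; apply: (subringN rQ).
have E : v * (z * (- k * v^-1)) = - (z * k) by field.
by apply: (mulfI v0); rewrite mulfV // mulrDr mulr1 E Ev; ring.
Qed.

(** In the application x and y are exchanged with each other, and z occurs in
    one of the two terms of their exchange polynomial, so modulo z this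
    polynomial is the unit be. Therefore the exchange polynomials of z before
    and after the exchange agree modulo z up to units, and w' belongs to Q once
    x is inverted. Hence a belongs to Q if either x or z is inverted, and x is
    a unit modulo z. *)
Lemma exchange_descent D Q (x y be z h w' w'' T T' G a : F) (g : int) :
  is_subring D -> is_subring Q ->
  transcendental D z -> z != 0 -> x != 0 -> y != 0 -> be != 0 ->
  w' != 0 -> D (z * w') ->
  (forall d, D d -> localization Q x d) ->
  Q y -> Q y^-1 -> Q be -> Q be^-1 -> Q z -> Q h -> x * y = be * (1 + z * h) ->
  Q w'' -> Q G -> Q T^-1 -> T != 0 -> z * w'' = T * (1 + G) ->
  localization Q x T' -> z * w' = T' * (1 + G * (x * y / be) ^ g) ->
  laurent D z a -> laurent D w' a -> (exists n, Q (z ^+ n * a)) -> Q a.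
Proof.
move=> rD rQ tz z0 x0 y0 be0 w0 DM DQ Qy Qy1 Qbe Qbe1 Qz Qh Exy.
move=> Qw'' QG QT T0 Ew'' QT' Ew' La La' [n Qn].
have Ex : x = be / y * (1 + z * h) by rewrite -(mulfK y0 x) Exy; field.
have Qby : Q (be / y) by apply: (subringM rQ).
have Q1zh : Q (1 + z * h).
  by apply: (subringD rQ); [apply: (subring1 rQ)|apply: (subringM rQ)].
have Qx : Q x by rewrite Ex; apply: (subringM rQ).
have rL := localization_ring rQ Qx.
have LQ := @localization_in Q x.
have Ev : x * y / be = 1 + z * h by rewrite Exy; field.
have v0 : x * y / be != 0 by rewrite !mulf_neq0 ?invr_neq0.
have Lv1 : localization Q x (x * y / be)^-1.
  rewrite !invfM invrK; apply: (subringM rL); last exact: LQ.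
  by apply: (subringM rL); [apply: localizationV|apply: LQ].
have Lv : localization Q x (x * y / be) by apply: LQ; rewrite Ev.
(* x * y / be is 1 modulo z, and so are its powers *)
have [l Ll El] := exprz_congr1 g rL Lv Lv1 (LQ _ Qz) (LQ _ Qh) v0 Ev.
have Lw' : localization Q x w'.
  have -> : w' = T' * (T^-1 * w'' + G * l).
    apply: (mulfI z0); rewrite Ew' El.
    have -> : z * (T' * (T^-1 * w'' + G * l)) = T' * (T^-1 * (z * w'') + z * (G * l)).
      by ring.
    by rewrite Ew''; field.
  apply: (subringM rL) => //.
  apply: (subringD rL); first by apply: LQ; apply: (subringM rQ).
  by apply: (subringM rL) => //; apply: LQ.
have M0 : z * w' != 0 by rewrite mulf_neq0.
have [m Qm] := laurent_inter rD rL DQ (LQ _ Qz) Lw' tz z0 M0 DM erefl La La'.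
have u0 : be / y != 0 by rewrite mulf_neq0 ?invr_neq0.
apply: (unimodular_descent rQ u0 _ Qx Qz _ _ Qm Qn).
- by rewrite invfM invrK; apply: (subringM rQ).
- by apply: (subringM rQ) Qby Qh.
- by rewrite Ex; ring.
Qed.

(** In the application x and y are exchanged with each other, z is exchanged
    with w, and neither exchange polynomial M1, M2 involves the other pair. In
    an expansion of a in z, the divisibility of the polar coefficients by
    powers of M2 is known over the Laurent polynomials in x; coprimality
    carries it over to the Laurent polynomials in y. *)
Lemma coprime_descent R (x y z w M1 M2 a : F) E Q :
  is_subring R -> is_subring E -> is_subring Q ->
  transcendental R x -> transcendental E z ->
  x != 0 -> y != 0 -> z != 0 -> M1 != 0 -> M2 != 0 ->
  R M1 -> R M2 -> x * y = M1 -> z * w = M2 ->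
  (forall m r h, R r -> R h -> M2 * r = M1 ^+ m * h ->
     exists2 h', R h' & r = M1 ^+ m * h') ->
  (forall d, laurent R x d -> E d) -> (forall d, laurent R y d -> E d) ->
  (forall d, laurent R y d -> Q d) -> Q z -> Q w ->
  laurent (laurent R x) z a -> laurent (laurent R x) w a ->
  laurent (laurent R y) z a -> Q a.
Proof.
move=> rR rE rQ tx tz x0 y0 z0 M10 M20 RM1 RM2 Exy Ezw cop xE yE yQ Qz Qw.
have rLx := laurent_subring rR x0.
have rLy := laurent_subring rR y0.
have Lyx : laurent R y x.
  have -> : x = M1 * y^-1 by rewrite -Exy mulfK.
  apply: (subringM rLy); first exact: laurent_in.
  exact: laurent_varV.
have step d : laurent R x d -> laurent R y (M2 * d) -> laurent R y d.
  move=> [p [n [Rp dp]]] Ld.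
  have Mdp : M2 * d * x ^+ n = (M2 *: p).[x] by rewrite hornerZ -dp mulrA.
  have RMp : coefs_in R (M2 *: p) by apply: coefs_inZ.
  apply: (laurent_in_subring rLy x0 Lyx (laurent_var rR y) Exy dp) => [i _|i lt_in].
    exact: laurent_in.
  have [h Rh] := pole_coef_divisible rR tx x0 M10 RM1 Exy RMp Mdp Ld lt_in.
  rewrite coefZ => /(cop _ _ _ (Rp i) Rh) [h' Rh' ->].
  by exists h' => //; apply: laurent_in.
move=> [p [n [Dp ap]]] Lw [p' [m [Dp' ap']]].
have Ep : p * 'X^m = p' * 'X^n.
  apply: (transcendental_eq rE tz); last by rewrite !hornerM !hornerXn -ap -ap'; ring.
    by apply: (coefs_inMXn rE); apply: coefs_inS Dp.
  by apply: (coefs_inMXn rE); apply: coefs_inS Dp'.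
have Dp1 i : laurent R y p`_i.
  have -> : p`_i = (p' * 'X^n)`_(i + m) by rewrite -Ep coefMXn addnK ltnNge leq_addl.
  by rewrite coefMXn; case: ifP => _; [apply: (subring0 rLy)|apply: Dp'].
have tLz : transcendental (laurent R x) z by apply: transcendentalS tz.
apply: (laurent_in_subring rQ z0 Qz Qw Ezw ap) => [i _|i lt_in]; first exact: yQ.
have LM2 : laurent R x M2 by apply: laurent_in.
have [h Dh Eh] := pole_coef_divisible rLx tLz z0 M20 LM2 Ezw Dp ap Lw lt_in.
exists h => //; apply: yQ.
have := Dp1 i; rewrite Eh.
elim: (n - i)%N => [|k IHk]; first by rewrite expr0 mul1r.
rewrite exprS -mulrA => /step H; apply: IHk; apply: H.
by apply: (subringM rLx) => //; apply: (subringX rLx).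
Qed.

Lemma coprime_powers R (M1 M2 : F) :
  is_subring R -> M1 != 0 -> R M2 ->
  (forall r h, R r -> R h -> M2 * r = M1 * h -> exists2 h', R h' & r = M1 * h') ->
  R M1 ->
  forall m r h, R r -> R h -> M2 * r = M1 ^+ m * h ->
     exists2 h', R h' & r = M1 ^+ m * h'.
Proof.
move=> rR M10 RM2 cop RM1; elim=> [|m IHm] r h Rr Rh E.
  by exists r => //; rewrite expr0 mul1r.
have [] := IHm r (M1 * h) Rr; first exact: (subringM rR).
  by rewrite E exprSr; ring.
move=> h1 Rh1 Er; have [|h2 Rh2 Eh1] := cop h1 h Rh1 Rh.
  by apply: (mulfI (expf_neq0 m M10)); rewrite mulrCA -Er E exprSr; ring.
by exists h2 => //; rewrite Er Eh1 exprSr; ring.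
Qed.

(** A nonzero w that does not involve x is regular modulo a polynomial that
    is monic in x: the coefficients of the quotient are found from the top
    degree downwards. *)
Lemma monic_binomial_division R (x w ka r h : F) c :
  is_subring R -> transcendental R x -> x != 0 -> R ka -> R w -> w != 0 ->
  (0 < c)%N -> laurent R x r -> laurent R x h -> w * r = (x ^+ c + ka) * h ->
  exists2 h', laurent R x h' & r = (x ^+ c + ka) * h'.
Proof.
move=> rR tx x0 Rka Rw w0 c0 [p [n [Rp rp]]] [q [m [Rq hq]]] E.
have EP : w *: (p * 'X^m) = ('X^c + ka%:P) * (q * 'X^n).
  apply: (transcendental_eq rR tx).
  - by apply: coefs_inZ => //; apply: coefs_inMXn.
  - apply: coefs_inM => //; last exact: coefs_inMXn.
    move=> i; rewrite coefD; apply: (subringD rR); first exact: coefs_inXn.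
    exact: coefs_inC.
  rewrite hornerZ !hornerM hornerD !hornerXn hornerC -rp -hq.
  have -> : w * (r * x ^+ n * x ^+ m) = (w * r) * (x ^+ n * x ^+ m) by ring.
  by rewrite E; ring.
set P := p * 'X^m in EP; set H := q * 'X^n in EP.
have RP : coefs_in R P by apply: coefs_inMXn.
have RH1 k : forall i, (size H <= i + k)%N -> R (w^-1 * H`_i).
  elim: k => [|k IHk] i le_ik.
    by rewrite addn0 in le_ik; rewrite nth_default // mulr0; apply: (subring0 rR).
  have := congr1 (fun s : {poly F} => s`_(i + c)) EP.
  rewrite coefZ mulrDl coefD coefXnM mul_polyC coefZ ltnNge leq_addl /= addnK => Ei.
  have -> : w^-1 * H`_i = P`_(i + c) - ka * (w^-1 * H`_(i + c)).
    by apply: (mulfI w0); rewrite mulrBr Ei; field.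
  apply: (subringB rR) => //; apply: (subringM rR) => //; apply: IHk; lia.
have LR := laurent_subring rR x0.
exists (w^-1 * h).
  exists (w^-1 *: H), (m + n)%N; split.
    by move=> i; rewrite coefZ; apply: (RH1 (size H)); rewrite leq_addl.
  by rewrite hornerZ /H hornerM hornerXn -hq exprD; ring.
by apply: (mulfI w0); rewrite E; field.
Qed.

(** Modulo 1 + Y, the unit Y equals -1. *)
Lemma signed_power_congr R (Y : F) (m : int) :
  is_subring R -> R Y -> R Y^-1 -> Y != 0 ->
  exists2 g, R g & Y ^ m - (-1) ^ m = g * (1 + Y).
Proof.
move=> rR RY RY1 Y0.
have P n : exists2 g, R g & Y ^+ n - (-1) ^+ n = g * (1 + Y).
  elim: n => [|n [g Rg IHn]].
    by exists 0; [apply: (subring0 rR)|rewrite !expr0 subrr mul0r].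
  exists (Y ^+ n - g).
    by apply: (subringB rR) => //; apply: (subringX rR).
  have -> : Y ^+ n.+1 - (-1) ^+ n.+1 = Y ^+ n * (1 + Y) - (Y ^+ n - (-1) ^+ n).
    by rewrite !exprS; ring.
  by rewrite IHn; ring.
case: m => n; first exact: P.
have [g Rg Eg] := P n.+1.
exists (- (-1) ^+ n.+1 * Y^-1 ^+ n.+1 * g).
  apply: (subringM rR) => //; apply: (subringM rR); last exact: (subringX rR).
  by apply: (subringN rR); apply: (subringX rR); apply: (subringN rR); apply: (subring1 rR).
rewrite -[RHS]mulrA -Eg !NegzE -!exprnN.
have e2 : (-1) ^+ n.+1 * (-1) ^+ n.+1 = 1 :> F by rewrite -exprMn mulrNN mulr1 expr1n.
have -> : (-1) ^- n.+1 = (-1) ^+ n.+1 :> F by rewrite -exprVn invrN1.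
rewrite exprVn -?exprnP; set e := (-1) ^+ n.+1 in e2 *.
have Yn : Y ^+ n.+1 != 0 by rewrite expf_neq0.
transitivity ((e * e) * (Y ^+ n.+1)^-1 - e * (Y ^+ n.+1 * (Y ^+ n.+1)^-1)).
  by rewrite e2 mulfV // mul1r mulr1.
ring.
Qed.

End TwoVariables.

(** * Algebraically independent families and their Laurent rings *)

Lemma mpoly_hom_ext (R : comNzRingType) (S : nzRingType) n
    (f g : {rmorphism {mpoly R[n]} -> S}) :
  (forall c, f c%:MP = g c%:MP) -> (forall i, f 'X_i = g 'X_i) -> f =1 g.
Proof.
move=> fgC fgX p; rewrite (mpolyE p) !rmorph_sum; apply: eq_bigr => m _.
rewrite -mul_mpolyC !rmorphM fgC; congr (_ * _).
rewrite mpolyXE_id !rmorph_prod; apply: eq_bigr => i _.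
by rewrite !rmorphXn fgX.
Qed.

Definition upd (I : eqType) (T : Type) (x : I -> T) (k : I) (v : T) (i : I) : T :=
  if i == k then v else x i.

Lemma upd_same (I : eqType) T (x : I -> T) k v : upd x k v k = v.
Proof. by rewrite /upd eqxx. Qed.

Lemma upd_neq (I : eqType) T (x : I -> T) k v i : i != k -> upd x k v i = x i.
Proof. by rewrite /upd => /negbTE->. Qed.

Definition off_two n (i k : 'I_n) : pred 'I_n := [pred l | (l != i) && (l != k)].

Section SeveralVariables.
Variables (K F : fieldType) (j : {rmorphism K -> F}) (n : nat).
Implicit Types (x y : 'I_n -> F) (q r : {mpoly K[n]}).

Definition alg_indep x : Prop := forall q, mmap j x q = 0 -> q = 0.

(** Setting x k to 1 removes this variable from rational functions. *)
Definition others_field k x : F -> Prop := in_adjoin j (upd x k 1).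

Section OthersField.
Variables (k : 'I_n) (x : 'I_n -> F).
Let E := others_field k x.

Lemma others_field_const c : E (j c).
Proof. by exists c%:MP, 1; rewrite rmorph1 divr1 mmapC oner_neq0. Qed.

Lemma others_field_var i : i != k -> E (x i).
Proof.
by move=> ik; exists 'X_i, 1; rewrite rmorph1 divr1 mmapX mmap1U upd_neq // oner_neq0.
Qed.

Lemma others_field_ring : is_subring E.
Proof.
split; first by rewrite -(rmorph1 j); apply: others_field_const.
  move=> _ _ [q [r [r0 ->]]] [q' [r' [r'0 ->]]].
  exists (q * r' - q' * r), (r * r'); rewrite !(rmorphM, rmorphB) /= mulf_neq0 //.
  by split=> //; field; apply/andP.
move=> _ _ [q [r [r0 ->]]] [q' [r' [r'0 ->]]].
exists (q * q'), (r * r'); rewrite !rmorphM /= mulf_neq0 //.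
by split=> //; field; apply/andP.
Qed.

Lemma others_fieldV a : E a -> E a^-1.
Proof.
have [->|a0] := eqVneq a 0; first by rewrite invr0.
move=> [q [r [r0 Ea]]]; exists r, q; rewrite Ea invfM invrK mulrC; split=> //.
by apply: contraNneq a0 => q0; rewrite Ea q0 mul0r.
Qed.

Lemma others_field_div a b : E a -> E b -> E (a / b).
Proof. by move=> Ea Eb; apply: (subringM others_field_ring) => //; apply: others_fieldV. Qed.

End OthersField.

Section IsolateVariable.
Variable (k : 'I_n).

(** Polynomials in all variables as polynomials in the variable k over the
    polynomials in the other variables. *)
Definition split_var : {mpoly K[n]} -> {poly {mpoly K[n]}} :=
  mmap (polyC \o @mpolyC n K) (fun i => if i == k then 'X else ('X_i)%:P).

HB.instance Definition _ := GRing.RMorphism.on split_var.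

Definition drop_var : {mpoly K[n]} -> {mpoly K[n]} :=
  mmap (@mpolyC n K) (upd (fun i => 'X_i) k 1).

HB.instance Definition _ := GRing.RMorphism.on drop_var.

Lemma split_varC c : split_var c%:MP = c%:MP%:P.
Proof. by rewrite /split_var mmapC. Qed.

Lemma split_varX i : split_var 'X_i = if i == k then 'X else ('X_i)%:P.
Proof. by rewrite /split_var mmapX mmap1U. Qed.

Lemma drop_varC c : drop_var c%:MP = c%:MP.
Proof. by rewrite /drop_var mmapC. Qed.

Lemma drop_varX i : drop_var 'X_i = if i == k then 1 else 'X_i.
Proof. by rewrite /drop_var mmapX mmap1U. Qed.

Lemma split_drop q : split_var (drop_var q) = (drop_var q)%:P.
Proof.
pose f := split_var \o drop_var; pose g := @polyC _ \o drop_var.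
apply: (@mpoly_hom_ext _ _ _ f g) => [c|i] /=.
  by rewrite drop_varC split_varC.
by rewrite drop_varX; case: ifP => ik; rewrite ?rmorph1 // split_varX ik.
Qed.

Lemma mmap_drop x q : mmap j x (drop_var q) = mmap j (upd x k 1) q.
Proof.
apply: (@mpoly_hom_ext _ _ _ (mmap j x \o drop_var) (mmap j (upd x k 1))) => [c|i] /=.
  by rewrite drop_varC !mmapC.
rewrite drop_varX mmapX mmap1U /upd; case: ifP => ik; first by rewrite rmorph1.
by rewrite mmapX mmap1U.
Qed.

Lemma mmap_split x y q : (forall i, i != k -> x i = y i) ->
  mmap j x q = (map_poly (mmap j (upd y k 1)) (split_var q)).[x k].
Proof.
move=> xy.
pose g := horner_eval (x k) \o map_poly (mmap j (upd y k 1)) \o split_var.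
apply: (@mpoly_hom_ext _ _ _ (mmap j x) g) => [c|i]; rewrite /= /horner_eval.
  by rewrite split_varC map_polyC hornerC /= !mmapC.
rewrite split_varX mmapX mmap1U; case: ifP => [/eqP->|ik].
  by rewrite map_polyX hornerX.
by rewrite map_polyC hornerC /= mmapX mmap1U /upd ik xy ?ik.
Qed.

(** After clearing denominators, an algebraic equation of x k over the field
    of the other variables is a polynomial relation between all variables. *)
Lemma var_transcendental x : alg_indep x -> transcendental (others_field k x) (x k).
Proof.
move=> ax p Ep px; set h := upd x k 1 in Ep.
have [P [R [R0 EP]]] : exists (P : {poly {mpoly K[n]}}) (R : {mpoly K[n]}),
    mmap j h R != 0 /\ map_poly (mmap j h) P = mmap j h R *: p.
  rewrite -[p]coefK poly_def; elim: (size p) => [|s [P [R [R0 IHs]]]].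
    by exists 0, 1; rewrite big_ord0 scaler0 !rmorph0 rmorph1 oner_neq0.
  have [q [r [r0 Eq]]] := Ep s.
  exists (r *: P + (R * q) *: 'X^s), (R * r); rewrite rmorphM mulf_neq0 //; split=> //.
  rewrite big_ord_recr rmorphD /= !map_polyZ map_polyXn IHs /= Eq.
  rewrite !rmorphM scalerDr !scalerA; congr (_ + _); last by congr (_ *: _); field.
  by rewrite mulrC.
pose psi := (map_poly drop_var P).['X_k].
have psi0 : psi = 0.
  apply: ax; rewrite /psi -(horner_map (mmap j x)) -map_poly_comp /=.
  have -> : map_poly (mmap j x \o drop_var) P = map_poly (mmap j h) P.
    by apply: eq_map_poly => q /=; apply: mmap_drop.
  by rewrite mmapX mmap1U EP hornerZ px mulr0.
have P0 : map_poly drop_var P = 0.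
  have : split_var psi = 0 by rewrite psi0 rmorph0.
  rewrite /psi -[LHS](horner_map split_var) /= split_varX eqxx -map_poly_comp.
  rewrite (eq_map_poly (split_drop : _ =1 polyC \o drop_var)) map_poly_comp.
  by move=> <-; rewrite -[LHS]comp_polyXr.
have : map_poly (mmap j h) P = 0.
  have -> : map_poly (mmap j h) P = map_poly (mmap j x) (map_poly drop_var P).
    by rewrite -map_poly_comp; apply: eq_map_poly => q /=; rewrite mmap_drop.
  by rewrite P0 rmorph0.
by rewrite EP => /eqP; rewrite scaler_eq0 (negbTE R0) => /eqP.
Qed.

End IsolateVariable.

Lemma transcendental_flip (E : F -> Prop) (x M : F) :
  is_subring E -> E M -> M != 0 -> x != 0 -> transcendental E x ->
  transcendental E (M / x).
Proof.
move=> rE EM M0 x0 tx p Ep pMx.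
pose s := size p; pose r := \poly_(t < s.+1) (p`_(s - t) * M ^+ (s - t)).
have r0 : r = 0.
  apply: tx.
    by apply: coefs_in_poly => // t; apply: (subringM rE); [apply: Ep|apply: (subringX rE)].
  rewrite horner_poly (reindex_inj rev_ord_inj) /=.
  transitivity (x ^+ s * p.[M / x]); last by rewrite pMx mulr0.
  rewrite (@horner_coef_wide _ s.+1) // mulr_sumr.
  apply: eq_bigr => [[t /= lt_ts]] _; rewrite subSS subKn //.
  have -> : x ^+ s = x ^+ (s - t) * x ^+ t by rewrite -exprD subnK.
  by rewrite exprMn exprVn; field; apply: expf_neq0.
apply/polyP => i; rewrite coef0; case: (leqP i s) => [le_is|lt_si]; last first.
  by rewrite nth_default // ltnW.
have := congr1 (fun u : {poly F} => u`_(s - i)) r0.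
rewrite coef0 coef_poly ltnS leq_subr subKn // => /eqP.
by rewrite mulf_eq0 (negbTE (expf_neq0 _ M0)) orbF => /eqP.
Qed.

Lemma alg_indep_neq0 x i : alg_indep x -> x i != 0.
Proof.
move=> ax; apply/eqP => xi0; have : 'X_i = 0 :> {mpoly K[n]}.
  by apply: ax; rewrite mmapX mmap1U.
by move/(congr1 (mcoeff U_(i))); rewrite mcoeffXU mcoeff0 eqxx => /eqP; rewrite oner_eq0.
Qed.

(** M / x k is transcendental over the field of the other variables because
    x k is. *)
Lemma alg_indep_upd x k M : alg_indep x -> others_field k x M -> M != 0 ->
  alg_indep (upd x k (M / x k)).
Proof.
move=> ax EM M0 q; set y := upd x k _ => qy.
have x0 := alg_indep_neq0 k ax.
have rE := others_field_ring k x.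
have Ey i : i != k -> y i = x i by apply: upd_neq.
have Ex i : i != k -> x i = x i by [].
rewrite (mmap_split _ Ey) in qy.
apply: (ax); rewrite (mmap_split _ Ex).
suff -> : map_poly (mmap j (upd x k 1)) (split_var k q) = 0 by rewrite horner0.
have := transcendental_flip rE EM M0 x0 (var_transcendental ax).
apply; last by rewrite -qy /y upd_same.
move=> i; rewrite coef_map; exists ((split_var k q)`_i), 1.
by rewrite rmorph1 oner_neq0 divr1.
Qed.

Inductive laurent_ring_on (A : pred 'I_n) x : F -> Prop :=
| Laurent_const c : laurent_ring_on A x (j c)
| Laurent_var i : A i -> laurent_ring_on A x (x i)
| Laurent_varV i : A i -> laurent_ring_on A x (x i)^-1
| Laurent_sub a b : laurent_ring_on A x a -> laurent_ring_on A x b ->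
    laurent_ring_on A x (a - b)
| Laurent_mul a b : laurent_ring_on A x a -> laurent_ring_on A x b ->
    laurent_ring_on A x (a * b).

Local Notation Lau := laurent_ring_on.

Lemma Laurent_subring (A : pred 'I_n) x : is_subring (Lau A x).
Proof.
split; first by rewrite -(rmorph1 j); apply: Laurent_const.
  exact: Laurent_sub.
exact: Laurent_mul.
Qed.

Lemma Laurent_min (A : pred 'I_n) x (Q : F -> Prop) : is_subring Q -> (forall c, Q (j c)) ->
  (forall i, A i -> Q (x i) /\ Q (x i)^-1) -> forall a, Lau A x a -> Q a.
Proof.
move=> rQ QC QX a; elim=> {a}.
- by [].
- by move=> i /QX[].
- by move=> i /QX[].
- by move=> a b _ Qa _ Qb; apply: (subringB rQ).
- by move=> a b _ Qa _ Qb; apply: (subringM rQ).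
Qed.

Lemma LaurentS (A B : pred 'I_n) x a :
  (forall i, A i -> B i) -> Lau A x a -> Lau B x a.
Proof.
move=> AB; apply: Laurent_min; first exact: Laurent_subring.
  exact: Laurent_const.
by move=> i /AB Bi; split; [apply: Laurent_var|apply: Laurent_varV].
Qed.

Lemma Laurent_ext (A : pred 'I_n) x y a :
  (forall i, A i -> x i = y i) -> Lau A x a -> Lau A y a.
Proof.
move=> xy; apply: Laurent_min; first exact: Laurent_subring.
  exact: Laurent_const.
by move=> i Ai; rewrite xy //; split; [apply: Laurent_var|apply: Laurent_varV].
Qed.

Lemma Laurent_upd (A : pred 'I_n) x k v a : ~~ A k ->
  Lau A (upd x k v) a -> Lau A x a.
Proof.
move=> Ak; apply: Laurent_ext => i Ai; rewrite upd_neq //.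
by apply: contraTneq Ai => ->.
Qed.

Lemma Laurent_updV (A : pred 'I_n) x k v a : ~~ A k ->
  Lau A x a -> Lau A (upd x k v) a.
Proof.
move=> Ak; apply: Laurent_ext => i Ai; rewrite upd_neq //.
by apply: contraTneq Ai => ->.
Qed.

Lemma Laurent_laurent (A : pred 'I_n) x k a : x k != 0 ->
  Lau A x a -> laurent (Lau (predD1 A k) x) (x k) a.
Proof.
move=> xk0; have rL := Laurent_subring (predD1 A k) x.
apply: Laurent_min; first exact: laurent_subring.
  by move=> c; apply: laurent_in => //; apply: Laurent_const.
move=> i Ai; have [->|ik] := eqVneq i k.
  by split; [apply: laurent_var|apply: laurent_varV].
have Bi : predD1 A k i by rewrite /= ik.
by split; apply: laurent_in => //; [apply: Laurent_var|apply: Laurent_varV].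
Qed.

Lemma Laurent_of_laurent (A : pred 'I_n) x k a : A k -> x k != 0 ->
  laurent (Lau (predD1 A k) x) (x k) a -> Lau A x a.
Proof.
move=> Ak x0; apply: laurent_sub => //; first exact: Laurent_subring.
- exact: Laurent_var.
- exact: Laurent_varV.
- by move=> d; apply: LaurentS => i /andP[].
Qed.

Lemma Laurent_others_field (A : pred 'I_n) x k a :
  ~~ A k -> Lau A x a -> others_field k x a.
Proof.
move=> Ak; apply: Laurent_min.
- exact: others_field_ring.
- exact: others_field_const.
move=> i Ai; have Ei : others_field k x (x i).
  by apply: others_field_var; apply: contraTneq Ai => ->.
by split=> //; apply: others_fieldV.
Qed.

Definition mon x (v : 'I_n -> int) : F := \prod_i x i ^ v i.

Lemma mon_neq0 x v : (forall i, x i != 0) -> mon x v != 0.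
Proof. by move=> x0; apply/prodf_neq0 => i _; rewrite expfz_neq0. Qed.

Lemma monD x u v : (forall i, x i != 0) ->
  mon x u * mon x v = mon x (fun i => u i + v i).
Proof.
by move=> x0; rewrite -big_split; apply: eq_bigr => i _; rewrite /= expfzDr.
Qed.

Lemma monXz x v m : mon x v ^ m = mon x (fun i => v i * m).
Proof.
rewrite /mon; apply: (big_rec2 (fun a b => a ^ m = b)); first by rewrite exp1rz.
by move=> i a b _ <-; rewrite expfzMl -exprz_exp.
Qed.

Lemma eq_mon x u v : u =1 v -> mon x u = mon x v.
Proof. by move=> uv; apply: eq_bigr => i _; rewrite uv. Qed.

Lemma monV x v : (mon x v)^-1 = mon x (fun i => - v i).
Proof. by rewrite -[LHS]/(mon x v ^ (-1)) monXz; apply: eq_mon => i; rewrite mulrN1. Qed.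

Lemma mon_upd x k w v : mon (upd x k w) v = w ^ v k * mon x (upd v k 0).
Proof.
rewrite /mon (bigD1 k) //= upd_same; congr (_ * _).
rewrite [RHS](bigD1 k) //= upd_same expr0z mul1r; apply: eq_bigr => i ik.
by rewrite !upd_neq.
Qed.

Lemma mon_split x k v : mon x v = x k ^ v k * mon x (upd v k 0).
Proof.
rewrite -mon_upd; apply: eq_bigr => i _; rewrite /upd.
by case: eqP => // ->.
Qed.

Lemma Laurent_mon (A : pred 'I_n) x v :
  (forall i, v i != 0 -> A i) -> Lau A x (mon x v).
Proof.
move=> vA; have rL := Laurent_subring A x; apply: subring_prod => // i _.
have [->|/vA Ai] := eqVneq (v i) 0; first by rewrite expr0z; apply: subring1 rL.
by apply: subringXz => //; [apply: Laurent_var|apply: Laurent_varV].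
Qed.

Lemma others_field_power x k (a b : F) (m : int) :
  alg_indep x -> others_field k x a -> others_field k x b -> a != 0 ->
  a * x k ^ m = b -> m = 0.
Proof.
move=> ax Ea Eb a0.
have x0 := alg_indep_neq0 k ax.
have rE := others_field_ring k x; have tx := var_transcendental (k := k) ax.
have P c d s : others_field k x c -> others_field k x d -> c != 0 ->
    c * x k ^+ s.+1 = d -> False.
  move=> Ec Ed c0 E; suff : c *: 'X^(s.+1) - d%:P = 0 :> {poly F}.
    move/(congr1 (fun p : {poly F} => p`_s.+1)).
    rewrite coefB coefZ coefXn coefC eqxx mulr1 subr0 coef0 => /eqP.
    by rewrite (negbTE c0).
  apply: tx; last by rewrite !hornerE E subrr.
  apply: coefs_inB => //; last exact: coefs_inC.
  by apply: coefs_inZ => //; apply: coefs_inXn.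
case: m => [[|s]|s] // E; first by case: (P a b s Ea Eb a0 E).
have b0 : b != 0 by rewrite -E mulf_neq0 // expfz_neq0.
case: (P b a s Eb Ea b0); rewrite -E NegzE -exprnN -mulrA mulVf ?mulr1 //.
by rewrite expf_neq0.
Qed.

End SeveralVariables.

(** * Mutation of symmetrizable matrices *)

Definition zpos (m : int) : int := if 0 < m then m else 0.

Lemma zpos_ge0 m : 0 <= zpos m.
Proof. by rewrite /zpos; case: ifP => // /ltW. Qed.

Lemma zposB m : zpos m - zpos (- m) = m.
Proof. by rewrite /zpos; do ?case: ifP; lia. Qed.

Lemma zposE m : 0 <= m -> zpos m = m.
Proof. by rewrite /zpos; do ?case: ifP; lia. Qed.

Lemma zpos0 m : m <= 0 -> zpos m = 0.
Proof. by rewrite /zpos; do ?case: ifP; lia. Qed.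

Section ExchangeMatrices.
Variables (n : nat).
Implicit Types (b : 'I_n -> 'I_n -> int) (k i l : 'I_n).

(** The factors d symmetrize on the left; their inverses symmetrize on the
    right. *)
Definition symmetrized_by (d : 'I_n -> rat) b : Prop :=
  (forall i, 0 < d i) /\ forall i l, d i * (b i l)%:~R = - (d l * (b l i)%:~R).

Definition trivial_kernel b : Prop :=
  forall v : 'I_n -> int, (forall i, \sum_l b i l * v l = 0) -> forall l, v l = 0.

(** In this form, mutation is the composition of a column operation, which
    adds multiples of column k, and a row operation, which adds multiples of
    row k. *)
Lemma matrix_mutationE k b i l : matrix_mutation k b i l =
  if (i == k) || (l == k) then - b i l
  else b i l + b i k * zpos (b k l) + zpos (- b i k) * b k l.
Proof.
rewrite /matrix_mutation; case: ifP => // _; rewrite -addrA; congr (_ + _).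
have half (m u : int) : u = m * 2 -> (u %/ 2)%Z = m by move=> ->; rewrite mulzK.
apply: half; rewrite /zpos.
case: (ltrP 0 (b k l)) => c0; case: (ltrP 0 (- b i k)) => a0.
- by rewrite (gtr0_norm c0) ltr0_norm; [ring|lia].
- by rewrite (gtr0_norm c0) ger0_norm; [ring|lia].
- by rewrite (ler0_norm c0) ltr0_norm; [ring|lia].
- by rewrite (ler0_norm c0) ger0_norm; [ring|lia].
Qed.

Lemma matrix_mutation_pos k b i l : i != k -> l != k -> 0 <= b k l ->
  matrix_mutation k b i l = b i l + zpos (b i k) * b k l.
Proof.
move=> ik lk c0; rewrite matrix_mutationE (negbTE ik) (negbTE lk) /= (zposE c0).
by rewrite -addrA -mulrDl -{1}(zposB (b i k)) subrK.
Qed.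

Lemma matrix_mutation_neg k b i l : i != k -> l != k -> b k l <= 0 ->
  matrix_mutation k b i l = b i l + zpos (- b i k) * b k l.
Proof.
move=> ik lk c0; rewrite matrix_mutationE (negbTE ik) (negbTE lk) /= (zpos0 c0).
by rewrite mulr0 addr0.
Qed.

Section Symmetrized.
Variables (d : 'I_n -> rat) (b : 'I_n -> 'I_n -> int).
Hypothesis sb : symmetrized_by d b.

Lemma symmetrized_diag k : b k k = 0.
Proof.
have [d0 /(_ k k)] := sb; move: (d0 k) => dk E.
have : d k * (b k k)%:~R = 0 by lra.
by move/eqP; rewrite mulf_eq0 gt_eqF //= intr_eq0 => /eqP.
Qed.

Lemma symmetrized_gt0 i l : (0 < b i l) = (b l i < 0).
Proof.
have [d0 /(_ i l) E] := sb; move: (d0 i) (d0 l) => di dl.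
rewrite -(ltr0z rat) -(ltrz0 rat) -(pmulr_rgt0 _ di) E oppr_gt0.
by rewrite pmulr_rlt0.
Qed.

Lemma symmetrized_eq0 i l : (b i l == 0) = (b l i == 0).
Proof. have := symmetrized_gt0 i l; have := symmetrized_gt0 l i; lia. Qed.

Lemma symmetrized_mutation k : symmetrized_by d (matrix_mutation k b).
Proof.
have [d0 E] := sb; split=> // i l; rewrite !matrix_mutationE orbC.
case: ifP => [_|/norP[lk ik]]; first by rewrite !rmorphN !mulrN E.
have P u v : d u * (zpos (b u v))%:~R = d v * (zpos (- b v u))%:~R.
  have Eu := E u v; have Gu := symmetrized_gt0 u v; rewrite /zpos oppr_gt0 -Gu.
  by case: ifP => _; rewrite ?mulr0 // Eu rmorphN mulrN.
have P' u v : d u * (zpos (- b u v))%:~R = d v * (zpos (b v u))%:~R by rewrite P.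
have Eil := E i l; have Eik := E i k; have Ekl := E k l.
have Pk := P k l; have Pi := P' i k.
rewrite !(rmorphD, rmorphM) /= !mulrDr !mulrA Eil Eik Pi.
have -> : - (d k * (b k i)%:~R) * (zpos (b k l))%:~R =
  - ((d k * (zpos (b k l))%:~R) * (b k i)%:~R) by ring.
have -> : d k * (zpos (b k i))%:~R * (b k l)%:~R =
  (d k * (b k l)%:~R) * (zpos (b k i))%:~R by ring.
by rewrite Pk Ekl; ring.
Qed.

(** The row and column operations that make up a mutation are invertible. *)
Lemma trivial_kernel_mutation k :
  trivial_kernel b -> trivial_kernel (matrix_mutation k b).
Proof.
move=> kb v' bv'.
pose v := upd v' k (- v' k + \sum_(l | l != k) zpos (b k l) * v' l).
have vk : v k = - v' k + \sum_(l | l != k) zpos (b k l) * v' l by rewrite /v upd_same.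
have vl l : l != k -> v l = v' l by move=> lk; rewrite /v upd_neq.
have bvE i : \sum_l b i l * v l =
    - (b i k * v' k) + \sum_(l | l != k) (b i l + b i k * zpos (b k l)) * v' l.
  rewrite (bigD1 k) //= vk mulrDr mulrN -addrA; congr (_ + _).
  rewrite mulr_sumr -big_split; apply: eq_bigr => l lk.
  by rewrite vl //=; ring.
have Nk : \sum_(l | l != k) b k l * v' l = 0.
  have := bv' k; rewrite (bigD1 k) //= matrix_mutationE eqxx /= symmetrized_diag.
  rewrite oppr0 mul0r add0r.
  under eq_bigr do rewrite matrix_mutationE eqxx /= mulNr.
  by rewrite sumrN => /eqP; rewrite oppr_eq0 => /eqP.
have bv i : \sum_l b i l * v l = 0.
  have [->|ik] := eqVneq i k.
    rewrite bvE symmetrized_diag mul0r oppr0 add0r -[RHS]Nk.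
    by apply: eq_bigr => l _; ring.
  have := bv' i; rewrite (bigD1 k) //= matrix_mutationE eqxx orbT.
  under eq_bigr => l lk do rewrite matrix_mutationE (negbTE ik) (negbTE lk) /= mulrDl -mulrA.
  by rewrite big_split /= -mulr_sumr Nk mulr0 addr0 bvE mulNr.
have v0 := kb v bv.
have v'0 l : l != k -> v' l = 0 by move=> lk; rewrite -vl.
move=> l; have [->|/v'0 //] := eqVneq l k.
have := v0 k; rewrite vk big1 => [|i ik]; last by rewrite v'0 // mulr0.
by rewrite addr0 => /eqP; rewrite oppr_eq0 => /eqP.
Qed.

Lemma trivial_kernel_col k : trivial_kernel b -> exists i, b i k != 0.
Proof.
move=> kb; apply/existsP; apply: contraT; rewrite negb_exists => /forallP b0.
pose v l : int := (l == k)%:R.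
suff /kb/(_ k)/eqP : forall i, \sum_l b i l * v l = 0 by rewrite /v eqxx.
move=> i; rewrite (bigD1 k) //= /v eqxx mulr1 big1 ?addr0.
  by apply/eqP; have := b0 i; rewrite negbK.
by move=> l lk; rewrite (negbTE lk) mulr0.
Qed.

Lemma trivial_kernel_minor k l : trivial_kernel b -> l != k ->
  exists i i', b i k != 0 /\ b i k * b i' l != b i' k * b i l.
Proof.
move=> kb lk; have [i bik] := trivial_kernel_col k kb; exists i.
suff /existsP[i' Hi'] : [exists i', b i k * b i' l != b i' k * b i l] by exists i'.
apply: contraT; rewrite negb_exists => /forallP b0.
pose v m : int := if m == k then b i l else if m == l then - b i k else 0.
suff /kb/(_ l)/eqP : forall i', \sum_m b i' m * v m = 0.
  by rewrite /v (negbTE lk) eqxx oppr_eq0 (negbTE bik).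
move=> i'; rewrite (bigD1 k) //= (bigD1 l) //= big1 => [|m /andP[mk ml]].
  rewrite /v eqxx (negbTE lk) eqxx addr0.
  by have := b0 i'; rewrite negbK => /eqP; lia.
by rewrite /v (negbTE mk) (negbTE ml) mulr0.
Qed.

End Symmetrized.
End ExchangeMatrices.

(** * Labeled seeds, upper bounds and coprime exchange polynomials *)

Section LabeledSeeds.
Variables (K F : fieldType) (j : {rmorphism K -> F}) (n : nat).

(** The coefficients are arbitrary elements of K, not normalized, so that the
    same notion covers the enlarged seeds, whose new vertices have no
    coefficients in P. The mutation rule prescribes only the ratios of the new
    coefficients. *)
Record lseed := LSeed {
  lvar : 'I_n -> F;
  lplus : 'I_n -> K;
  lminus : 'I_n -> K;
  lmat : 'I_n -> 'I_n -> int
}.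

Implicit Types (S : lseed) (k l i : 'I_n).

Definition lexchange S k : F :=
  j (lplus S k) * mon (lvar S) (fun i => zpos (lmat S i k)) +
  j (lminus S k) * mon (lvar S) (fun i => zpos (- lmat S i k)).

Record lmutation k S S' : Prop := LMutation {
  lmut_other : forall i, i != k -> lvar S' i = lvar S i;
  lmut_new : lvar S k * lvar S' k = lexchange S k;
  lmut_mat : forall i l, lmat S' i l = matrix_mutation k (lmat S) i l;
  lmut_coef_new : lplus S' k * lplus S k = lminus S' k * lminus S k;
  lmut_coef_pos : forall i, i != k -> 0 <= lmat S k i ->
    lplus S' i / lminus S' i = lplus S k ^ lmat S k i * (lplus S i / lminus S i);
  lmut_coef_neg : forall i, i != k -> lmat S k i <= 0 ->
    lplus S' i / lminus S' i = lminus S k ^ lmat S k i * (lplus S i / lminus S i)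
}.

Record lvalid (d : 'I_n -> rat) S : Prop := LValid {
  lvalid_indep : alg_indep j (lvar S);
  lvalid_plus : forall i, lplus S i != 0;
  lvalid_minus : forall i, lminus S i != 0;
  lvalid_mat : symmetrized_by d (lmat S)
}.

(** The ratio of the two terms of the exchange polynomial. *)
Definition yhat S k : F :=
  j (lplus S k / lminus S k) * mon (lvar S) (fun i => lmat S i k).

Definition ltail S k : F :=
  j (lminus S k) * mon (lvar S) (fun i => zpos (- lmat S i k)).

Local Notation Lau := (laurent_ring_on j).

(** The upper bound of Berenstein, Fomin and Zelevinsky. *)
Definition upper S (a : F) : Prop :=
  Lau predT (lvar S) a /\
  forall l, Lau predT (upd (lvar S) l (lexchange S l / lvar S l)) a.

Section ValidSeed.
Variables (d : 'I_n -> rat) (S : lseed).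
Hypothesis vS : lvalid d S.
Let x := lvar S.
Let b := lmat S.

Lemma lvar_neq0 i : x i != 0.
Proof. exact: alg_indep_neq0 (lvalid_indep vS). Qed.

Lemma lmat_diag k : b k k = 0.
Proof. exact: symmetrized_diag (lvalid_mat vS) k. Qed.

Lemma lmat_eq0 k l : b k l = 0 -> b l k = 0.
Proof. by move/eqP; rewrite (symmetrized_eq0 (lvalid_mat vS)) => /eqP. Qed.

Lemma ltail_neq0 k : ltail S k != 0.
Proof.
rewrite mulf_neq0 ?fmorph_eq0 ?(lvalid_minus vS) //.
by apply: mon_neq0; apply: lvar_neq0.
Qed.

Lemma lratio_neq0 k : lplus S k / lminus S k != 0.
Proof. by rewrite mulf_neq0 ?invr_eq0 ?(lvalid_minus vS) ?(lvalid_plus vS). Qed.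

Lemma lratio_mon_neq0 k v : j (lplus S k / lminus S k) * mon x v != 0.
Proof.
rewrite mulf_neq0 ?fmorph_eq0 ?lratio_neq0 //.
by apply: mon_neq0; apply: lvar_neq0.
Qed.

Lemma yhat_neq0 k : yhat S k != 0.
Proof. exact: lratio_mon_neq0. Qed.

Lemma lexchange_yhat k : lexchange S k = ltail S k * (1 + yhat S k).
Proof.
rewrite /lexchange /ltail /yhat mulrDr mulr1 addrC; congr (_ + _).
have -> : mon (lvar S) (fun i => zpos (lmat S i k)) =
   mon (lvar S) (fun i => zpos (- lmat S i k)) * mon (lvar S) (fun i => lmat S i k).
  rewrite monD; last exact: lvar_neq0.
  by apply: eq_mon => i; have := zposB (lmat S i k); lia.
rewrite fmorph_div; field.
by rewrite fmorph_eq0 (lvalid_minus vS).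
Qed.

Lemma lexchange_in (Q : F -> Prop) k : is_subring Q -> (forall c, Q (j c)) ->
  (forall i, b i k != 0 -> Q (x i)) -> Q (lexchange S k).
Proof.
move=> rQ QC QX.
have Qm (e : 'I_n -> int) : (forall i, 0 <= e i) -> (forall i, b i k = 0 -> e i = 0) ->
    Q (mon x e).
  move=> e0 be; apply: (subring_prod rQ) => i _.
  have [/be->|/QX Qi] := eqVneq (b i k) 0; first by rewrite expr0z; apply: (subring1 rQ).
  by have := e0 i; case: (e i) => // m _; apply: (subringX rQ).
apply: (subringD rQ); apply: (subringM rQ) => //; apply: Qm => i; rewrite ?zpos_ge0 //.
  by move=> bik; rewrite [lmat S i k]bik.
by move=> bik; rewrite [lmat S i k]bik.
Qed.

Lemma lexchange_Laurent (A : pred 'I_n) k :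
  (forall i, b i k != 0 -> A i) -> Lau A x (lexchange S k).
Proof.
move=> bA; apply: lexchange_in; first exact: Laurent_subring.
  exact: Laurent_const.
by move=> i /bA Ai; apply: Laurent_var.
Qed.

Lemma ltail_Laurent (A : pred 'I_n) k :
  (forall i, b i k != 0 -> A i) -> Lau A x (ltail S k) /\ Lau A x (ltail S k)^-1.
Proof.
move=> bA; have rL := Laurent_subring j A x.
have zA i : zpos (- lmat S i k) != 0 -> A i.
  by move=> H; apply: bA; apply: contraNneq H => bik; rewrite [lmat S i k]bik.
split; rewrite ?invfM -?fmorphV ?monV.
  by apply: (subringM rL); [apply: Laurent_const|apply: Laurent_mon].
apply: (subringM rL); first exact: Laurent_const.
by apply: Laurent_mon => i; rewrite oppr_eq0; apply: zA.
Qed.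

Lemma yhat_Laurent (A : pred 'I_n) k :
  (forall i, b i k != 0 -> A i) -> Lau A x (yhat S k) /\ Lau A x (yhat S k)^-1.
Proof.
move=> bA; have rL := Laurent_subring j A x.
split; rewrite ?invfM -?fmorphV ?monV.
  by apply: (subringM rL); [apply: Laurent_const|apply: Laurent_mon].
apply: (subringM rL); first exact: Laurent_const.
by apply: Laurent_mon => i; rewrite oppr_eq0; apply: bA.
Qed.

Lemma lexchange_neq0 k : trivial_kernel b -> lexchange S k != 0.
Proof.
move=> /(trivial_kernel_col k)[i bik]; rewrite lexchange_yhat mulf_neq0 ?ltail_neq0 //.
apply/eqP => Y1; move/eqP: bik; apply.
apply: (others_field_power (k := i) (j := j) (a := j (lplus S k / lminus S k) *
   mon x (upd (fun i => b i k) i 0)) (b := - 1) (lvalid_indep vS)).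
- apply: (subringM (others_field_ring j i x)); first exact: others_field_const.
  apply: (@Laurent_others_field _ _ _ _ (predC1 i)); first by rewrite /= eqxx.
  by apply: Laurent_mon => l; rewrite /upd; case: ifP; rewrite ?eqxx //= => ->.
- by rewrite -(rmorph1 j) -rmorphN; apply: others_field_const.
- exact: lratio_mon_neq0.
rewrite -mulrA [_ * x i ^ _]mulrC -(mon_split x i (fun i => b i k)).
by apply/eqP; rewrite -addr_eq0 addrC; apply/eqP.
Qed.

(** Let x i be a variable that occurs in column k. The ratios of the terms of
    the two exchange polynomials have independent exponents, so a product of
    their powers is a nonconstant monomial that does not involve x i. Modulo the
    two exchange polynomials both ratios are -1; hence the ideal that they
    generate contains a nonzero element w free of x i. As the exchange
    polynomial of k is monic in x i up to a unit, w is regular modulo it. *)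
Lemma exchange_coprime k l : trivial_kernel b -> k != l -> b k l = 0 ->
  let R := Lau (off_two k l) x in
  forall r h, R r -> R h -> lexchange S l * r = lexchange S k * h ->
  exists2 h', R h' & r = lexchange S k * h'.
Proof.
move=> kb kl bkl R r h Rr Rh.
have blk := lmat_eq0 bkl; have bkk := lmat_diag k; have bll := lmat_diag l.
have rR : is_subring R by apply: Laurent_subring.
have lk : l != k by rewrite eq_sym.
have [i [i' [bi bii]]] := trivial_kernel_minor kb lk.
have colk m : b m k != 0 -> (m != k) && (m != l).
  by move=> bm; apply/andP; split; apply: contraNneq bm => ->; rewrite ?bkk ?blk.
have coll m : b m l != 0 -> (m != k) && (m != l).
  by move=> bm; apply/andP; split; apply: contraNneq bm => ->; rewrite ?bkl ?bll.
have Ai := colk i bi; pose R0 := Lau (predD1 (off_two k l) i) x.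
have rR0 : is_subring R0 by apply: Laurent_subring.
have R0R a : R0 a -> R a by apply: LaurentS => m /andP[].
have xi0 := lvar_neq0 i; have axS := lvalid_indep vS.
have RL a : R a -> laurent R0 (x i) a by apply: Laurent_laurent.
have LR a : laurent R0 (x i) a -> R a by apply: Laurent_of_laurent.
have [RYk RYkV] := yhat_Laurent (A := (off_two k l)) colk.
have [RYl RYlV] := yhat_Laurent (A := (off_two k l)) coll.
have [RTk RTkV] := ltail_Laurent (A := (off_two k l)) colk.
have [RTl RTlV] := ltail_Laurent (A := (off_two k l)) coll.
have Yk0 := yhat_neq0 k; have Yl0 := yhat_neq0 l.
have Tk0 := ltail_neq0 k; have Tl0 := ltail_neq0 l.
rewrite !lexchange_yhat => Erh.
set c := b i k in bi bii *.
(* 1 + yhat is, up to a unit, a monic binomial in x i *)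
have [u [ka [Ru RuV u0 R0ka EYk]]] : exists u ka, [/\ R u, R u^-1, u != 0, R0 ka &
    1 + yhat S k = u * (x i ^+ `|c|%N + ka)].
  pose al := j (lplus S k / lminus S k) * mon x (upd (fun i => b i k) i 0).
  have al0 : al != 0 by apply: lratio_mon_neq0.
  have updA m : upd (fun i => b i k) i 0 m != 0 -> predD1 (off_two k l) i m.
    by rewrite /upd /=; case: ifP => //= _; apply: colk.
  have R0al : R0 al.
    by apply: (subringM rR0); [apply: Laurent_const|apply: Laurent_mon].
  have R0alV : R0 al^-1.
    rewrite invfM -fmorphV monV; apply: (subringM rR0); first exact: Laurent_const.
    by apply: Laurent_mon => m; rewrite oppr_eq0; apply: updA.
  have EY : yhat S k = al * x i ^ c.
    by rewrite /yhat (mon_split _ i) /al -/x -/b -/c; ring.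
  have [c0|c0] : 0 < c \/ c < 0 by move: bi; rewrite neq_lt; case: (c < 0) => /=; auto.
    exists al, al^-1; split=> //; try exact: R0R.
    have Ec : x i ^ c = x i ^+ `|c|%N by rewrite -{1}(gtz0_abs c0).
    by rewrite EY Ec; field.
  exists (x i ^ c), al; split=> //.
  - by apply: (subringXz rR); [apply: Laurent_var|apply: Laurent_varV].
  - by rewrite invr_expz; apply: (subringXz rR); [apply: Laurent_var|apply: Laurent_varV].
  - by rewrite expfz_neq0.
  rewrite EY mulrDr [x i ^ c * al]mulrC; congr (_ + _).
  have -> : x i ^ c = (x i ^+ `|c|%N)^-1.
    by rewrite -{1}[c]opprK -{1}(ltz0_abs c0) -exprnN.
  by rewrite mulVf // expf_neq0.
(* eliminating x i from the two binomials *)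
pose p := b i l; pose q := - c.
pose w := yhat S k ^ p * yhat S l ^ q - (-1) ^ p * (-1) ^ q.
pose e m := b m k * p + b m l * q.
have EW : yhat S k ^ p * yhat S l ^ q =
    j ((lplus S k / lminus S k) ^ p * (lplus S l / lminus S l) ^ q) * mon x e.
  rewrite /yhat [(j _ * _) ^ p]expfzMl [(j _ * _) ^ q]expfzMl !monXz.
  rewrite [j (_ ^ p * _)]rmorphM !fmorphXz.
  rewrite -monD; last exact: lvar_neq0.
  by ring.
have ei : e i = 0 by rewrite /e /p /q -/c; ring.
have ei' : e i' != 0.
  by apply: contraNneq bii; rewrite /e /p /q => E; apply/eqP; lia.
have cst0 : j ((lplus S k / lminus S k) ^ p * (lplus S l / lminus S l) ^ q) != 0.
  by rewrite fmorph_eq0 mulf_neq0 ?expfz_neq0 ?lratio_neq0.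
have R0w : R0 w.
  rewrite /w EW; apply: (subringB rR0); last by apply: (subringM rR0); apply: subring_signz.
  apply: (subringM rR0); first exact: Laurent_const.
  apply: Laurent_mon => m em /=; rewrite andbC; apply/andP; split; last first.
    by apply: contraNneq em => ->; rewrite ei.
  have [bmk|/colk //] := eqVneq (b m k) 0; apply: coll.
  by apply: contraNneq em => bml; rewrite /e bmk bml !mul0r.
have w0 : w != 0.
  apply/eqP => w0; move/eqP: ei'; apply.
  have sgn : others_field j i' x ((-1) ^ p * (-1) ^ q).
    by apply: (subringM (others_field_ring j i' x)); apply: subring_signz (others_field_ring j i' x) _.
  apply: (others_field_power (k := i') axS _ sgn (a :=
    j ((lplus S k / lminus S k) ^ p * (lplus S l / lminus S l) ^ q) * mon x (upd e i' 0))).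
  - apply: (subringM (others_field_ring j i' x)); first exact: others_field_const.
    apply: (@Laurent_others_field _ _ _ _ (predC1 i')); first by rewrite /= eqxx.
    by apply: Laurent_mon => m; rewrite /upd; case: ifP; rewrite ?eqxx //= => ->.
  - by rewrite mulf_neq0 //; apply: mon_neq0; apply: lvar_neq0.
  rewrite -mulrA [_ * x i' ^ _]mulrC -mon_split -EW.
  by apply/eqP; rewrite -subr_eq0; apply/eqP.
have [g1 Rg1 Eg1] := signed_power_congr p rR RYk RYkV Yk0.
have [g2 Rg2 Eg2] := signed_power_congr q rR RYl RYlV Yl0.
pose h1 := u * (g1 * yhat S l ^ q * r + (-1) ^ p * g2 * (ltail S k * h / ltail S l)).
have Rh1 : R h1.
  apply: (subringM rR) => //; apply: (subringD rR).
    by do 2?[apply: (subringM rR) => //]; apply: subringXz.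
  apply: (subringM rR); first by apply: (subringM rR) => //; apply: subring_signz.
  by do 2?[apply: (subringM rR) => //].
have Ewr : w * r = (x i ^+ `|c|%N + ka) * h1.
  have Yr : (1 + yhat S l) * r = (1 + yhat S k) * (ltail S k * h / ltail S l).
    by apply: (mulfI Tl0); rewrite [LHS]mulrA; rewrite Erh; field.
  transitivity (g1 * (1 + yhat S k) * yhat S l ^ q * r +
      (-1) ^ p * g2 * ((1 + yhat S l) * r)).
    transitivity ((yhat S k ^ p - (-1) ^ p) * yhat S l ^ q * r +
        (-1) ^ p * (yhat S l ^ q - (-1) ^ q) * r); first by rewrite /w; ring.
    by rewrite Eg1 Eg2; ring.
  by rewrite Yr EYk /h1; ring.
have c0 : (0 < `|c|)%N by rewrite absz_gt0.
have tR0 : transcendental R0 (x i).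
  apply: (transcendentalS _ (var_transcendental (k := i) axS)) => a.
  by apply: Laurent_others_field; rewrite /= eqxx.
have [h' Lh' Er] := monic_binomial_division rR0 tR0 xi0 R0ka R0w w0 c0 (RL _ Rr) (RL _ Rh1) Ewr.
exists ((ltail S k)^-1 * u^-1 * h').
  by do 2?[apply: (subringM rR) => //]; apply: LR.
by rewrite EYk Er; field; apply/andP.
Qed.

End ValidSeed.
End LabeledSeeds.

(** * Mutation preserves the upper bound *)

Section UpperBound.
Variables (K F : fieldType) (j : {rmorphism K -> F}) (n : nat).
Variables (d : 'I_n -> rat) (k : 'I_n) (S S' : lseed K F n).
Hypotheses (vS : lvalid j d S) (vS' : lvalid j d S').
Hypothesis SS' : lmutation j k S S'.
Local Notation Lau := (laurent_ring_on j).
Let x := lvar S.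
Let x' := lvar S'.
Let b := lmat S.
Let b' := lmat S'.

Lemma lmut_col i : b' i k = - b i k.
Proof. by rewrite /b' (lmut_mat SS') matrix_mutationE eqxx orbT. Qed.

Lemma lmut_row i : b' k i = - b k i.
Proof. by rewrite /b' (lmut_mat SS') matrix_mutationE eqxx. Qed.

Lemma mon_lmut v : v k = 0 -> mon x' v = mon x v.
Proof.
move=> vk; apply: eq_bigr => i _; have [->|ik] := eqVneq i k.
  by rewrite vk !expr0z.
by rewrite /x' (lmut_other SS').
Qed.

Lemma lexchange_lmut :
  lexchange j S' k = j (lplus S' k / lminus S k) * lexchange j S k.
Proof.
have bk : b k k = 0 by apply: (lmat_diag vS).
have m0 := lvalid_minus vS k; have p0 := lvalid_plus vS k.
have E1 : lplus S' k = lplus S' k / lminus S k * lminus S k by rewrite divfK.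
have E2 : lminus S' k = lplus S' k / lminus S k * lplus S k.
  by apply: (mulIf m0); rewrite -(lmut_coef_new SS') mulrAC divfK.
rewrite /lexchange {1}E1 E2 !rmorphM.
have -> : mon (lvar S') (fun i => zpos (lmat S' i k)) =
          mon x (fun i => zpos (- b i k)).
  rewrite -mon_lmut ?bk //; apply: eq_mon => i.
  by rewrite -[lmat S' i k]/(b' i k) lmut_col.
have -> : mon (lvar S') (fun i => zpos (- lmat S' i k)) =
          mon x (fun i => zpos (b i k)).
  rewrite -mon_lmut ?bk //; apply: eq_mon => i.
  by rewrite -[lmat S' i k]/(b' i k) lmut_col opprK.
by rewrite -/x -/b; ring.
Qed.

Lemma upper_initial a : upper j S' a -> Lau predT x a.
Proof.
move=> [_ /(_ k)]; apply: Laurent_min; first exact: Laurent_subring.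
  exact: Laurent_const.
move=> i _; rewrite /upd; case: eqP => [_|/eqP ik].
  rewrite lexchange_lmut -(lmut_new SS') mulrA mulfK ?(lvar_neq0 vS') //.
  have rL := Laurent_subring j predT x.
  split; rewrite ?invfM -?fmorphV; apply: (subringM rL); try exact: Laurent_const.
    exact: Laurent_var.
  exact: Laurent_varV.
by rewrite (lmut_other SS') //; split; [apply: Laurent_var|apply: Laurent_varV].
Qed.

Lemma upper_neighbour a : upper j S' a ->
  Lau predT (upd x k (lexchange j S k / x k)) a.
Proof.
move=> [+ _]; apply: Laurent_ext => i _; rewrite /upd; case: eqP => [->|/eqP ik].
  by rewrite -(lmut_new SS') mulrAC mulfV ?mul1r ?(lvar_neq0 vS).
by rewrite (lmut_other SS').
Qed.

Section OtherDirection.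
Variables (l : 'I_n) (a : F).
Hypotheses (lk : l != k) (b'ker : trivial_kernel b') (ker : trivial_kernel b).
Hypothesis Ua : upper j S' a.
Let w := lexchange j S' l / x' l.
Let w2 := lexchange j S l / x l.
Let Q := Lau predT (upd x l w2).

Let rQ : is_subring Q. Proof. exact: Laurent_subring. Qed.
Let QC c : Q (j c). Proof. exact: Laurent_const. Qed.
Let x0 i : x i != 0. Proof. exact: (lvar_neq0 vS). Qed.
Let x'0 i : x' i != 0. Proof. exact: (lvar_neq0 vS'). Qed.
Let xl : x' l = x l. Proof. exact: (lmut_other SS'). Qed.
Let E0 : lexchange j S l != 0. Proof. exact: (lexchange_neq0 vS). Qed.
Let E'0 : lexchange j S' l != 0. Proof. exact: (lexchange_neq0 vS'). Qed.

Let Qi i : i != l -> Q (x i) /\ Q (x i)^-1.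
Proof.
move=> il; have -> : x i = upd x l w2 i by rewrite upd_neq.
by split; [apply: Laurent_var|apply: Laurent_varV].
Qed.

Let Qw2 : Q w2 /\ Q w2^-1.
Proof.
rewrite -(upd_same x l w2).
by split; [apply: Laurent_var|apply: Laurent_varV].
Qed.

Let Ql : Q (x l).
Proof.
have -> : x l = lexchange j S l * w2^-1 by rewrite /w2 invfM invrK mulVKf ?E0.
apply: (subringM rQ); last by case: Qw2.
apply: lexchange_in => // i bil; apply: (Qi _).1.
by apply: contraNneq bil => ->; rewrite (lmat_diag vS).
Qed.

Let Qmon v : 0 <= v l -> Q (mon x v).
Proof.
move=> vl; apply: (subring_prod rQ) => i _; have [->|il] := eqVneq i l.
  by case: (v l) vl => // m _; apply: (subringX rQ).
by have [? ?] := Qi il; apply: subringXz.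
Qed.

Let La : laurent (Lau (predD1 predT l) x') (x l) a.
Proof. by rewrite -xl; apply: Laurent_laurent => //; have [] := Ua. Qed.

Let Lw : laurent (Lau (predD1 predT l) x') w a.
Proof.
have [_ /(_ l) La'] := Ua.
have : laurent (Lau (predD1 predT l) (upd x' l w)) (upd x' l w l) a.
  by apply: Laurent_laurent => //; rewrite upd_same mulf_neq0 ?invr_eq0.
rewrite upd_same; apply: laurentS => c.
by apply: Laurent_upd; rewrite /= eqxx.
Qed.

Let xlw : x l * w = lexchange j S' l.
Proof. by rewrite /w -xl mulrCA mulfV ?mulr1. Qed.

Lemma upper_disconnected : b k l = 0 -> Q a.
Proof.
move=> bkl; have blk : b l k = 0 := lmat_eq0 vS bkl.
pose A := [pred i | (i != k) && (i != l)].
have axS := lvalid_indep vS; have axS' := lvalid_indep vS'.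
have b'l i : b' i l = b i l.
  have [->|ik] := eqVneq i k; first by rewrite lmut_row bkl.
  by rewrite /b' (lmut_mat SS') matrix_mutation_pos // -/b bkl // mulr0 addr0.
have yl : lplus S' l / lminus S' l = lplus S l / lminus S l.
  by rewrite (lmut_coef_pos SS') // -/b bkl // expr0z mul1r.
pose e := lminus S' l / lminus S l.
have e0 : e != 0 by rewrite mulf_neq0 ?invr_eq0 ?(lvalid_minus vS) ?(lvalid_minus vS').
have Ee : lexchange j S' l = j e * lexchange j S l.
  have -> : e = lplus S' l / lplus S l.
    have := yl; have := lvalid_minus vS l; have := lvalid_minus vS' l.
    have := lvalid_plus vS l; rewrite /e => p0 m'0 m0 yl'.
    by rewrite -(divfK m'0 (lplus S' l)) yl'; field; apply/andP.
  rewrite /lexchange mulrDr !mulrA -!rmorphM.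
  have {1}-> : lplus S' l / lplus S l * lplus S l = lplus S' l.
    by rewrite divfK // (lvalid_plus vS).
  have -> : lplus S' l / lplus S l * lminus S l = lminus S' l.
    have := yl; have := lvalid_minus vS l; have := lvalid_minus vS' l.
    have := lvalid_plus vS l => p0 m'0 m0 yl'.
    by rewrite -[lplus S' l](divfK m'0) yl'; field; apply/andP.
  congr (_ * _ + _ * _).
    rewrite -mon_lmut -/b ?bkl //; apply: eq_mon => i.
    by rewrite -[lmat S' i l]/(b' i l) b'l.
  rewrite -mon_lmut -/b ?bkl //; apply: eq_mon => i.
  by rewrite -[lmat S' i l]/(b' i l) b'l.
have bkk : b k k = 0 := lmat_diag vS k; have bll : b l l = 0 := lmat_diag vS l.
have colk i : b i k != 0 -> A i.
  by move=> bi; apply/andP; split; apply: contraNneq bi => ->; rewrite ?bkk ?blk.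
have coll i : b i l != 0 -> A i.
  by move=> bi; apply/andP; split; apply: contraNneq bi => ->; rewrite ?bkl ?bll.
have rR : is_subring (Lau A x) by apply: Laurent_subring.
have RM1 : Lau A x (lexchange j S k) by apply: lexchange_Laurent.
have RM2 : Lau A x (lexchange j S' l).
  by rewrite Ee; apply: (subringM rR); [apply: Laurent_const|apply: lexchange_Laurent].
have x'k : x' k * x k = lexchange j S k by rewrite mulrC (lmut_new SS').
have Ax y : (forall i, A i -> y i = x i) -> forall c,
    Lau (predD1 (predD1 predT l) k) y c -> Lau A x c.
  move=> yx c; move/(Laurent_ext (A := predD1 (predD1 predT l) k) (y := x)).
  move=> H; apply: (LaurentS _ (H _)) => i /andP[? /andP[? _]]; first exact/andP.
  exact/yx/andP.
have D1 y : (forall i, A i -> y i = x i) -> y k != 0 -> forall c,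
    Lau (predD1 predT l) y c -> laurent (Lau A x) (y k) c.
  by move=> yx yk c Lc; apply: (laurentS (Ax y yx)); apply: Laurent_laurent.
have x'A i : A i -> x' i = x i by move=> /andP[ik _]; apply: (lmut_other SS').
have fE := others_field_ring j l x.
have RE c : Lau A x c -> others_field j l x c.
  by apply: Laurent_others_field; rewrite /A /= eqxx andbF.
have Exk : others_field j l x (x k) by apply: others_field_var; rewrite eq_sym.
have Ex'k : others_field j l x (x' k).
  have -> : x' k = lexchange j S k / x k by rewrite -x'k mulfK.
  by apply: others_field_div => //; apply: RE.
have tRx' : transcendental (Lau A x) (x' k).
  apply: (transcendentalS _ (var_transcendental (k := k) axS')) => c Rc.
  apply: (@Laurent_others_field _ _ _ _ A); first by rewrite /A /= eqxx.
  by apply: (Laurent_ext _ Rc) => i /x'A.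
have cop m r h : Lau A x r -> Lau A x h ->
    lexchange j S' l * r = lexchange j S k ^+ m * h ->
    exists2 h', Lau A x h' & r = lexchange j S k ^+ m * h'.
  apply: coprime_powers => //; first exact: (lexchange_neq0 vS).
  move=> {m r h} r h Rr Rh; rewrite Ee => Erh.
  have kl : k != l by rewrite eq_sym.
  have [] := @exchange_coprime _ _ _ _ _ _ vS k l ker kl bkl (j e * r) h.
  - by apply: (subringM rR) => //; apply: Laurent_const.
  - exact: Rh.
  - by rewrite -Erh; ring.
  move=> h' Rh' Er; exists (j e^-1 * h').
    by apply: (subringM rR) => //; apply: Laurent_const.
  rewrite mulrCA -Er mulrA -rmorphM mulVf // rmorph1 mul1r //.
have Qk := Qi (i := k); rewrite eq_sym in Qk; have [Qk1 QkV] := Qk lk.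
apply: (@coprime_descent F (Lau A x) (x' k) (x k) (x l) w (lexchange j S k)
  (lexchange j S' l) a (others_field j l x) Q) => //.
- exact: var_transcendental.
- exact: (lexchange_neq0 vS k ker).
- by move=> c; apply: laurent_sub => //; apply: others_fieldV.
- by move=> c; apply: laurent_sub => //; apply: others_fieldV.
- move=> c; apply: laurent_sub => // {}c Rc; apply: (LaurentS (A := A)) => //.
  by apply: Laurent_updV => //; rewrite /A /= eqxx andbF.
- have -> : w = j e * w2 by rewrite /w /w2 Ee xl mulrA.
  by apply: (subringM rQ) => //; case: Qw2.
- by apply: laurentS La; apply: D1.
- by apply: laurentS Lw; apply: D1.
have : laurent (Lau (predD1 predT l) x) (x l) a.
  by apply: Laurent_laurent => //; apply: upper_initial.
by apply: laurentS; apply: D1.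
Qed.

Lemma upper_connected : b k l != 0 -> Q a.
Proof.
move=> bkl; have kl : k != l by rewrite eq_sym.
have [Qk QkV] := Qi kl.
have x'k : x' k * x k = lexchange j S k by rewrite mulrC (lmut_new SS').
have bkk : b k k = 0 := lmat_diag vS k; have bll : b l l = 0 := lmat_diag vS l.
have p0 := lvalid_plus vS k; have m0 := lvalid_minus vS k.
(* the exchange polynomial in direction k is be (1 + x l h) with be a unit *)
have [c [v [h]]] : exists (c : K) (v : 'I_n -> int) (h : F),
  [/\ c != 0, v l = 0 /\ v k = 0,
   (forall i, i != k -> b' i l = b i l + v i * b k l) /\
   lplus S' l / lminus S' l = c ^ b k l * (lplus S l / lminus S l),
   Q h & lexchange j S k = j c * mon x v * (1 + x l * h)].
  have monxl (u : 'I_n -> int) : x l * mon x (upd u l (u l - 1)) = mon x u.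
    rewrite (mon_split x l u) (mon_split x l (upd u l _)) upd_same mulrA.
    have -> : x l * x l ^ (u l - 1) = x l ^ u l.
      by rewrite -{1}[x l]expr1z -expfzDr // addrC subrK.
    congr (_ * _); apply: eq_mon => i; rewrite /upd.
    by case: (i == l).
  have E r s (u : 'I_n -> int) : r != 0 -> j r * mon x (fun i => zpos (u i)) +
      j s * mon x (fun i => zpos (- u i)) = j r * mon x (fun i => zpos (u i)) *
      (1 + x l * (j (s / r) * mon x (upd (fun i => - u i) l (- u l - 1)))).
    move=> r0; rewrite mulrCA (monxl (fun i => - u i)) mulrDr mulr1; congr (_ + _).
    rewrite mulrACA -rmorphM monD //; congr (j _ * _); first by rewrite mulrCA mulfV // mulr1.
    by apply: eq_mon => i; have := zposB (u i); lia.
  have sgn := symmetrized_gt0 (lvalid_mat vS); rewrite -/b in sgn.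
  have [gt0|lt0] : 0 < b k l \/ b k l < 0 by move: bkl; rewrite neq_lt; case/orP; auto.
    have blk : b l k < 0 by rewrite -sgn.
    exists (lplus S k), (fun i => zpos (b i k)), (j (lminus S k / lplus S k) *
       mon x (upd (fun i => - b i k) l (- b l k - 1))).
    split=> //.
    - by rewrite bkk zpos0 // ltW.
    - split=> [i ik|]; last by apply: (lmut_coef_pos SS') => //; apply: ltW.
      by rewrite /b' (lmut_mat SS') matrix_mutation_pos // ltW.
    - by apply: (subringM rQ) => //; apply: Qmon; rewrite upd_same; lia.
    by rewrite /lexchange (E _ _ (fun i => b i k)).
  have blk : 0 < b l k by rewrite sgn.
  exists (lminus S k), (fun i => zpos (- b i k)), (j (lplus S k / lminus S k) *
     mon x (upd (fun i => b i k) l (b l k - 1))).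
  split=> //.
  - by rewrite bkk zpos0 // oppr_le0 ltW.
  - split=> [i ik|]; last by apply: (lmut_coef_neg SS') => //; apply: ltW.
    by rewrite /b' (lmut_mat SS') matrix_mutation_neg // ltW.
  - by apply: (subringM rQ) => //; apply: Qmon; rewrite upd_same; lia.
  have := E (lminus S k) (lplus S k) (fun i => - b i k) m0.
  rewrite opprK => E2.
  have -> : mon x (upd (fun i => b i k) l (b l k - 1)) =
      mon x (upd (fun i => - - b i k) l (b l k - 1)).
    by apply: eq_mon => i; rewrite /upd opprK.
  rewrite -E2 /lexchange addrC; congr (_ + _ * _).
  by apply: eq_mon => i; rewrite opprK.
move=> [c0 [vl vk] [Eb' Ey] Qh Exk].
pose be := j c * mon x v.
have be0 : be != 0 by rewrite mulf_neq0 ?fmorph_eq0 //; apply: mon_neq0.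
have Qbe : Q be by apply: (subringM rQ) => //; apply: Qmon; rewrite vl.
have QbeV : Q be^-1.
  rewrite invfM -fmorphV monV; apply: (subringM rQ) => //; apply: Qmon.
  by rewrite vl oppr0.
have Qx'k : Q (x' k).
  have -> : x' k = lexchange j S k * (x k)^-1 by rewrite -x'k mulfK.
  apply: (subringM rQ) => //; rewrite Exk; apply: (subringM rQ) => //.
  by apply: (subringD rQ); [apply: (subring1 rQ)|apply: (subringM rQ)].
have rLoc := localization_ring rQ Qx'k.
have DLoc c' : Lau (predD1 predT l) x' c' -> localization Q (x' k) c'.
  move: c'; apply: Laurent_min => //; first by move=> c'; apply: localization_in.
  move=> i /andP[il _]; have [->|ik] := eqVneq i k.
    by split; [apply: localization_in|apply: localizationV].
  have -> : x' i = x i by apply: (lmut_other SS').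
  have [] := Qi il.
  by split; apply: localization_in.
have col'l i : b' i l != 0 -> predD1 predT l i.
  by move=> bi; rewrite /= andbT; apply: contraNneq bi => ->; apply/eqP/(lmat_diag vS').
have coll i : b i l != 0 -> predD1 predT l i.
  by move=> bi; rewrite /= andbT; apply: contraNneq bi => ->; rewrite bll.
have DQ c' : Lau (predD1 predT l) x c' -> Q c'.
  move: c'; apply: Laurent_min => // i /andP[il _]; exact: Qi.
have [_ QTV] := ltail_Laurent j (A := predD1 predT l) coll.
have [QY _] := yhat_Laurent j (A := predD1 predT l) coll.
have [DT' _] := ltail_Laurent j (A := predD1 predT l) col'l.
apply: (@exchange_descent F (Lau (predD1 predT l) x') Q (x' k) (x k) be (x l) h w w2
  (ltail j S l) (ltail j S' l) (yhat j S l) a (- b k l)) => //.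
- exact: Laurent_subring.
- rewrite -xl; apply: (transcendentalS _ (var_transcendental (k := l) (lvalid_indep vS'))).
  by move=> c'; apply: Laurent_others_field; rewrite /= eqxx.
- by rewrite mulf_neq0 ?invr_eq0.
- by rewrite xlw; apply: lexchange_Laurent.
- by rewrite x'k Exk.
- by case: Qw2.
- exact: DQ.
- exact: DQ.
- exact: (ltail_neq0 vS).
- by rewrite /w2 mulrCA mulfV ?mulr1 //; apply: lexchange_yhat vS l.
- exact: DLoc.
- rewrite xlw (lexchange_yhat vS'); congr (_ * (1 + _)).
  rewrite /yhat Ey -/x -/x' -/b -/b'.
  rewrite (mon_split x' k) (mon_split x k) mon_lmut ?upd_same // lmut_row.
  have -> : mon x (upd (fun i => b' i l) k 0) =
      mon x (upd (fun i => b i l) k 0) * mon x v ^ b k l.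
    rewrite monXz monD //; apply: eq_mon => i; rewrite /upd.
    by case: eqP => [->|/eqP ik]; [rewrite vk mul0r addr0|apply: Eb'].
  have -> : (x' k * x k / be) ^ (- b k l) =
      x' k ^ (- b k l) * x k ^ (- b k l) * (j c ^ b k l * mon x v ^ b k l).
    by rewrite !expfzMl exprz_inv opprK /be expfzMl.
  rewrite [j (c ^ _ * _)]rmorphM fmorphXz.
  have xk1 : x k ^ b k l * x k ^ (- b k l) = 1 by rewrite -expfzDr // subrr expr0z.
  by rewrite -[LHS]mulr1 -xk1; ring.
- have [N QN] := laurent_localization rQ (x0 l) Ql DQ
    (Laurent_laurent (A := predT) (x0 l) (upper_initial Ua)).
  by exists N.
Qed.

End OtherDirection.

(** For a direction l other than k, the neighbour of S at l is at distance two
    from S'. If k and l are not connected, membership in its Laurent ring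
    follows from coprimality; if they are, the variable at l occurs in one term
    of the exchange polynomial of k, and the other term is a unit. *)
Lemma upper_mutation a : trivial_kernel b -> trivial_kernel b' ->
  upper j S' a -> upper j S a.
Proof.
move=> kb kb' Ua; split; first exact: upper_initial.
move=> l; have [->|lk] := eqVneq l k; first exact: upper_neighbour.
have [bkl|bkl] := eqVneq (b k l) 0; first exact: upper_disconnected.
exact: upper_connected.
Qed.

End UpperBound.

(** * Specialization and the Laurent phenomenon *)

Section LaurentExpansion.
Variables (K F : fieldType) (j : {rmorphism K -> F}) (n : nat).
Variables (x : 'I_n -> F).

Lemma mmap_in (Q : F -> Prop) (q : {mpoly K[n]}) :
  is_subring Q -> (forall c, Q (j c)) -> (forall i, Q (x i)) -> Q (mmap j x q).
Proof.
move=> rQ QC QX; apply: (subring_sum rQ) => m _; apply: (subringM rQ) => //.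
by apply: (subring_prod rQ) => i _; apply: (subringX rQ).
Qed.

Definition prod_vars : {mpoly K[n]} := \prod_i 'X_i.

(** Powers of the product of all variables serve as common denominators. *)
Definition expands (a : F) (q : {mpoly K[n]}) (m : nat) : Prop :=
  a * mmap j x prod_vars ^+ m = mmap j x q.

Lemma mmap_prod_vars : mmap j x prod_vars = \prod_i x i.
Proof. by rewrite rmorph_prod; apply: eq_bigr => i _; rewrite /= mmapX mmap1U. Qed.

Lemma expandsC c : expands (j c) c%:MP 0.
Proof. by rewrite /expands mulr1 mmapC. Qed.

Lemma expandsX i : expands (x i) 'X_i 0.
Proof. by rewrite /expands mulr1 mmapX mmap1U. Qed.

Lemma expandsV i : x i != 0 ->
  expands (x i)^-1 (\prod_(l | l != i) 'X_l) 1.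
Proof.
move=> xi0; rewrite /expands expr1 mmap_prod_vars (bigD1 i) //= mulKf //.
by rewrite rmorph_prod; apply: eq_bigr => l _; rewrite /= mmapX mmap1U.
Qed.

Lemma expandsD a q m b r s : expands a q m -> expands b r s ->
  expands (a + b) (q * prod_vars ^+ s + r * prod_vars ^+ m) (m + s).
Proof.
by rewrite /expands rmorphD !rmorphM !rmorphXn /= => <- <-; rewrite exprD; ring.
Qed.

Lemma expandsM a q m b r s : expands a q m -> expands b r s ->
  expands (a * b) (q * r) (m + s).
Proof. by rewrite /expands rmorphM /= => <- <-; rewrite exprD; ring. Qed.

Lemma Laurent_expands a : (forall i, x i != 0) ->
  laurent_ring_on j predT x a -> exists q m, expands a q m.
Proof.
move=> x0; move: a; apply: Laurent_min; [|by move=> c; exists c%:MP, 0%N; apply: expandsC|].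
  split; first by exists 1, 0%N; rewrite /expands mulr1 rmorph1.
    move=> a1 b [q [m aq]] [r [s br]].
    exists (q * prod_vars ^+ s + - r * prod_vars ^+ m), (m + s)%N.
    by apply: expandsD => //; rewrite /expands rmorphN /= -br mulNr.
  by move=> a1 b [q [m aq]] [r [s br]]; exists (q * r), (m + s)%N; apply: expandsM.
move=> i _; split; first by exists 'X_i, 0%N; apply: expandsX.
by exists (\prod_(l | l != i) 'X_l), 1%N; apply: expandsV.
Qed.

Lemma expands_unique a q m r s : alg_indep j x ->
  expands a q m -> expands a r s ->
  q * prod_vars ^+ s = r * prod_vars ^+ m.
Proof.
move=> ax aq ar; apply/eqP; rewrite -subr_eq0; apply/eqP; apply: ax.
by rewrite rmorphB !rmorphM !rmorphXn /= -aq -ar; ring.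
Qed.

End LaurentExpansion.

Section Specialization.
Variables (K F G : fieldType) (j : {rmorphism K -> F}) (jG : {rmorphism K -> G}).
Variables (n : nat) (x : 'I_n -> F) (t : 'I_n -> G).
Hypotheses (ax : alg_indep j x) (t0 : forall i, t i != 0).

(** The substitution of t for x in Laurent polynomials, as a relation between
    values; algebraic independence of x makes it a ring morphism. *)
Definition specializes (a : F) (c : G) : Prop :=
  exists q m, expands j x a q m /\ expands jG t c q m.

Let w0 : mmap jG t (prod_vars K n) != 0.
Proof. by rewrite mmap_prod_vars; apply/prodf_neq0 => i _. Qed.

Lemma specializes_unique a c c' : specializes a c -> specializes a c' -> c = c'.
Proof.
move=> [q [m [aq cq]]] [r [s [ar cr]]].
have E := congr1 (mmap jG t) (expands_unique ax aq ar).
rewrite !rmorphM !rmorphXn /= -cq -cr in E.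
apply: (mulIf (expf_neq0 (m + s) w0)); rewrite exprD mulrA E; ring.
Qed.

Lemma specializesC c : specializes (j c) (jG c).
Proof. by exists c%:MP, 0%N; split; apply: expandsC. Qed.

Lemma specializesX i : specializes (x i) (t i).
Proof. by exists 'X_i, 0%N; split; apply: expandsX. Qed.

Lemma specializesD a b c e :
  specializes a c -> specializes b e -> specializes (a + b) (c + e).
Proof.
move=> [q [m [aq cq]]] [r [s [ar cr]]].
by exists (q * prod_vars K n ^+ s + r * prod_vars K n ^+ m), (m + s)%N; split; apply: expandsD.
Qed.

Lemma specializesM a b c e :
  specializes a c -> specializes b e -> specializes (a * b) (c * e).
Proof.
move=> [q [m [aq cq]]] [r [s [ar cr]]].
by exists (q * r), (m + s)%N; split; apply: expandsM.
Qed.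

Lemma specializes_total a : laurent_ring_on j predT x a -> exists c, specializes a c.
Proof.
move=> La; have [q [m aq]] := Laurent_expands (fun i => alg_indep_neq0 i ax) La.
exists (mmap jG t q / mmap jG t (prod_vars K n) ^+ m), q, m; split=> //.
by rewrite /expands divfK // expf_neq0.
Qed.

Lemma specializes_mon (y : 'I_n -> F) (z : 'I_n -> G) (v : 'I_n -> int) :
  (forall i, specializes (y i) (z i)) -> (forall i, 0 <= v i) ->
  specializes (mon y v) (mon z v).
Proof.
move=> yz v0; rewrite /mon; apply: (big_ind2 specializes).
- by rewrite -(rmorph1 j) -(rmorph1 jG); apply: specializesC.
- by move=> a b c e; apply: specializesM.
move=> i _; case: (v i) (v0 i) => // m _; elim: m => [|m IHm].
  by rewrite !expr0z -(rmorph1 j) -(rmorph1 jG); apply: specializesC.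
by rewrite !exprSz; apply: specializesM.
Qed.

Lemma specializes_Laurent a c : specializes a c -> laurent_ring_on jG predT t c.
Proof.
move=> [q [m [_ cq]]]; have rL := Laurent_subring jG predT t.
have -> : c = mmap jG t q * (\prod_i (t i)^-1) ^+ m.
  rewrite prodfV -(mmap_prod_vars jG) -cq -mulrA -exprMn.
  by rewrite mulfV // expr1n mulr1.
apply: (subringM rL).
  by apply: mmap_in => // *; [apply: Laurent_const|apply: Laurent_var].
by apply: (subringX rL); apply: (subring_prod rL) => i _; apply: Laurent_varV.
Qed.

End Specialization.

Section MutationPaths.
Variables (K F : fieldType) (j : {rmorphism K -> F}) (n : nat) (d : 'I_n -> rat).

Inductive lpath (S0 : lseed K F n) : lseed K F n -> Prop :=
| lpath0 : lpath S0 S0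
| lpath_step k S S' : lpath S0 S -> lmutation j k S S' -> lvalid j d S' -> lpath S0 S'.

End MutationPaths.

Section PrincipalFraming.
Variables (K F : fieldType) (j : {rmorphism K -> F}) (n : nat) (d : 'I_n -> rat).
Variable S0 : lseed K F n.
Hypothesis vS0 : lvalid j d S0.

Definition frame_field : fieldType := {fraction {mpoly K[n + n]}}.
Definition frame_const : {rmorphism K -> frame_field} :=
  (@tofrac {mpoly K[n + n]}) \o (@mpolyC (n + n) K).

Definition frame_var (i : 'I_(n + n)) : frame_field := tofrac 'X_i.

Lemma frame_var_indep : alg_indep frame_const frame_var.
Proof.
move=> q.
have -> : mmap frame_const frame_var q = tofrac q.
  apply: (@mpoly_hom_ext _ _ _ (mmap frame_const frame_var) (@tofrac {mpoly K[n + n]})).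
    by move=> c; rewrite /= mmapC.
  by move=> i; rewrite /= mmapX mmap1U.
by move/eqP; rewrite tofrac_eq0 => /eqP.
Qed.

Definition frame_sym (i : 'I_(n + n)) : rat :=
  match split i with inl i => d i | inr i => d i end.

(** Each vertex is attached to a new vertex by a single arrow. The identity
    blocks off the diagonal make the matrix invertible, whatever the matrix of
    S0 is. *)
Definition frame_mat (i l : 'I_(n + n)) : int :=
  match split i, split l with
  | inl i, inl l => lmat S0 i l
  | inl i, inr l => - (i == l)%:Z
  | inr i, inl l => (i == l)%:Z
  | inr _, inr _ => 0
  end.

Lemma frame_mat_sym : symmetrized_by frame_sym frame_mat.
Proof.
have [d0 E] := lvalid_mat vS0; split=> [i|i l].
  by rewrite /frame_sym; case: (split i).
rewrite /frame_sym /frame_mat; case: (split i) => i1; case: (split l) => l1 //.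
- by rewrite [in RHS]eq_sym; case: eqP => [->|_] /=; rewrite ?rmorphN ?mulr0 ?mulrN ?oppr0.
- by rewrite [in RHS]eq_sym; case: eqP => [->|_] /=; rewrite ?rmorphN ?mulr0 ?mulrN ?oppr0 ?opprK.
- by rewrite !mulr0 oppr0.
Qed.

Lemma frame_mat_kernel : trivial_kernel frame_mat.
Proof.
move=> v Hv.
have E i l : frame_mat (rshift n i) (lshift n l) = (i == l)%:Z.
  by rewrite /frame_mat !(unsplitK (inr _)) !(unsplitK (inl _)).
have E0 i l : frame_mat (rshift n i) (rshift n l) = 0.
  by rewrite /frame_mat !(unsplitK (inr _)).
have E1 i l : frame_mat (lshift n i) (rshift n l) = - (i == l)%:Z.
  by rewrite /frame_mat !(unsplitK (inr _)) !(unsplitK (inl _)).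
have vl i : v (lshift n i) = 0.
  have := Hv (rshift n i); rewrite big_split_ord /= [X in _ + X]big1 => [|l _]; last first.
    by rewrite E0 mul0r.
  rewrite (bigD1 i) //= big1 => [|l li]; first by rewrite E eqxx mul1r !addr0.
  by rewrite E eq_sym (negbTE li) mul0r.
have vr i : v (rshift n i) = 0.
  have := Hv (lshift n i); rewrite big_split_ord /= big1 => [|l _]; last first.
    by rewrite vl mulr0.
  rewrite (bigD1 i) //= big1 => [|l li].
    by rewrite E1 eqxx mulN1r addr0 add0r => /eqP; rewrite oppr_eq0 => /eqP.
  by rewrite E1 eq_sym (negbTE li) oppr0 mul0r.
by move=> l; rewrite -(splitK l); case: (split l).
Qed.

Definition frame_coef (f : 'I_n -> K) (g : 'I_n -> K) (i : 'I_(n + n)) : K :=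
  match split i with inl i => f i | inr i => g i end.

Lemma frame_coefl f g i : frame_coef f g (lshift n i) = f i.
Proof. by rewrite /frame_coef (unsplitK (inl i)). Qed.

Lemma frame_coefr f g i : frame_coef f g (rshift n i) = g i.
Proof. by rewrite /frame_coef (unsplitK (inr i)). Qed.

Definition framed : lseed K frame_field (n + n) :=
  LSeed frame_var (frame_coef (lplus S0) (fun => 1)) (frame_coef (lminus S0) (fun => 1))
    frame_mat.

Lemma framed_valid : lvalid frame_const frame_sym framed.
Proof.
split; [exact: frame_var_indep| | |exact: frame_mat_sym] => i /=;
rewrite /frame_coef; case: (split i) => i'; rewrite ?oner_neq0 //.
  exact: (lvalid_plus vS0).
exact: (lvalid_minus vS0).
Qed.

Definition frame_spec (y : 'I_n -> F) (i : 'I_(n + n)) : F :=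
  match split i with inl i => y i | inr _ => 1 end.

Let H := specializes frame_const j frame_var (frame_spec (lvar S0)).

Let t0 i : frame_spec (lvar S0) i != 0.
Proof.
by rewrite /frame_spec; case: (split i) => *; rewrite ?oner_neq0 //; apply: (lvar_neq0 vS0).
Qed.

(** What is preserved when the enlarged initial seed and S0 are mutated in the
    same directions: T restricts to S, and the variables of S are recovered by
    setting the new variables to 1. *)
Record frames (T : lseed K frame_field (n + n)) (S : lseed K F n) : Prop := Frames {
  frames_base : lvalid j d S;
  frames_valid : lvalid frame_const frame_sym T;
  frames_kernel : trivial_kernel (lmat T);
  frames_mat : forall i l, lmat T (lshift n i) (lshift n l) = lmat S i l;
  frames_plus : forall i, lplus T (lshift n i) = lplus S i;
  frames_minus : forall i, lminus T (lshift n i) = lminus S i;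
  frames_spec : forall i, H (lvar T i) (frame_spec (lvar S) i);
  frames_upper : forall a, upper frame_const T a -> upper frame_const framed a
}.

Lemma framed_frames : frames framed S0.
Proof.
split=> //=.
- exact: framed_valid.
- exact: frame_mat_kernel.
- by move=> i l; rewrite /frame_mat !(unsplitK (inl _)).
- by move=> i; rewrite frame_coefl.
- by move=> i; rewrite frame_coefl.
- by move=> i; apply: specializesX.
Qed.

Lemma upper_var (K' F' : fieldType) (j' : {rmorphism K' -> F'}) N d' (T : lseed K' F' N) :
  lvalid j' d' T -> trivial_kernel (lmat T) -> forall i, upper j' T (lvar T i).
Proof.
move=> vT kT i; split; first exact: Laurent_var.
move=> l; set v := _ / _; have [->|il] := eqVneq i l; last first.
  by rewrite -(upd_neq (lvar T) v il); apply: Laurent_var.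
have E0 := lexchange_neq0 vT l kT; have x0 := lvar_neq0 vT l.
have rL := Laurent_subring j' predT (upd (lvar T) l v).
have -> : lvar T l = lexchange j' T l * (upd (lvar T) l v l)^-1.
  by rewrite upd_same /v invfM invrK mulVKf.
apply: (subringM rL); last exact: Laurent_varV.
apply: (@lexchange_in _ _ _ _ T _ l rL) => [c|m bm].
  exact: Laurent_const.
rewrite -(upd_neq (lvar T) v (i := m) (k := l)); first exact: Laurent_var.
by apply: contraNneq bm => ->; rewrite (lmat_diag vT).
Qed.

(** The new variable of the mutated seed is a Laurent polynomial by the upper
    bound, so it can be specialized. Specializing the exchange relation
    identifies the result, since the exchanged variable of S is not 0. *)
Lemma frames_mutation k T S S' : frames T S -> lmutation j k S S' -> lvalid j d S' ->
  exists T', frames T' S'.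
Proof.
move=> fTS SS' vS'; have [vS vT kT bT pT mT HT UT] := fTS.
pose kk := lshift n k.
(* the coefficients at the new vertices only have to obey the mutation rule *)
pose ratio i := if 0 <= lmat T kk i
  then lplus T kk ^ lmat T kk i * (lplus T i / lminus T i)
  else lminus T kk ^ lmat T kk i * (lplus T i / lminus T i).
pose x' := upd (lvar T) kk (lexchange frame_const T kk / lvar T kk).
pose T' := LSeed x' (frame_coef (lplus S') (fun i => ratio (rshift n i)))
  (frame_coef (lminus S') (fun => 1)) (matrix_mutation kk (lmat T)).
have E0 := lexchange_neq0 vT kk kT.
have x0 := lvar_neq0 vT kk.
have bkk : lmat T kk kk = 0 := lmat_diag vT kk.
have EL : laurent_ring_on frame_const (predC1 kk) (lvar T) (lexchange frame_const T kk).
  by apply: lexchange_Laurent => i bi /=; apply: contraNneq bi => ->; rewrite bkk.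
have vT' : lvalid frame_const frame_sym T'.
  split=> /=.
  - apply: alg_indep_upd => //; first exact: lvalid_indep vT.
    by apply: Laurent_others_field EL; rewrite /= eqxx.
  - move=> i; rewrite /frame_coef; case: (split i) => i'; first exact: (lvalid_plus vS').
    by rewrite /ratio; case: ifP => _; rewrite !mulf_neq0 ?invr_eq0 ?expfz_neq0 //;
      first [apply: (lvalid_plus vT)|apply: (lvalid_minus vT)].
  - move=> i; rewrite /frame_coef; case: (split i) => i'; first exact: (lvalid_minus vS').
    exact: oner_neq0.
  - exact: symmetrized_mutation (lvalid_mat vT) kk.
have TT' : lmutation frame_const kk T T'.
  split=> /=.
  - by move=> i ik; rewrite /x' upd_neq.
  - by rewrite /x' upd_same mulrCA mulfV ?mulr1.
  - by [].
  - by rewrite !frame_coefl pT mT; apply: (lmut_coef_new SS').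
  - move=> i; rewrite -(splitK i); case: (split i) => i' /=.
      rewrite !frame_coefl /kk !pT !mT bT eq_lshift; apply: (lmut_coef_pos SS').
    by rewrite !frame_coefr divr1 /ratio => _ ->.
  - move=> i; rewrite -(splitK i); case: (split i) => i' /=.
      rewrite !frame_coefl /kk !pT !mT bT eq_lshift; apply: (lmut_coef_neg SS').
    rewrite !frame_coefr divr1 /ratio => _; case: ifP => // ge0 le0.
    have -> : lmat T kk (rshift n i') = 0 by apply/eqP; rewrite eq_le ge0 le0.
    by rewrite !expr0z.
have kT' : trivial_kernel (lmat T') by apply: trivial_kernel_mutation (lvalid_mat vT) _ kT.
have UT' a : upper frame_const T' a -> upper frame_const framed a.
  by move=> Ua; apply: UT; apply: (upper_mutation vT vT' TT').
exists T'; split=> //=.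
- move=> i l; rewrite (lmut_mat SS') !matrix_mutationE !eq_lshift !bT.
  by [].
- by move=> i; rewrite frame_coefl.
- by move=> i; rewrite frame_coefl.
have spec_other i : i != kk -> H (x' i) (frame_spec (lvar S') i).
  move=> ik; rewrite /x' upd_neq //; have := HT i; rewrite /frame_spec.
  move: ik; rewrite -{1}(splitK i); case: (split i) => i' //=.
  by rewrite eq_lshift => ik'; rewrite (lmut_other SS').
move=> i; have [->|/spec_other //] := eqVneq i kk.
have [La _] := UT' _ (upper_var vT' kT' kk).
have [y Hy] := specializes_total j frame_var_indep t0 La.
have HE : H (lexchange frame_const T kk) (lexchange j S k).
  have monE (u : 'I_(n + n) -> int) (v : 'I_n -> int) : (forall i, u (lshift n i) = v i) ->
      (forall i, 0 <= u i) -> H (mon (lvar T) u) (mon (lvar S) v).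
    move=> uv u0; have <- : mon (frame_spec (lvar S)) u = mon (lvar S) v.
      rewrite /mon big_split_ord /= [X in _ * X]big1 ?mulr1 => [|l _].
        by apply: eq_bigr => l _; rewrite uv /frame_spec (unsplitK (inl l)).
      by rewrite /frame_spec (unsplitK (inr l)) exp1rz.
    exact: specializes_mon.
  by rewrite /lexchange pT mT; apply: specializesD; apply: specializesM;
    (try exact: specializesC); apply: monE => l; rewrite ?bT ?zpos_ge0.
have := HT kk; rewrite {1}/frame_spec (unsplitK (inl k)) => Hk.
have := specializes_unique frame_var_indep t0 (specializesM Hk Hy).
rewrite -/(lvar T') (lmut_new TT') => /(_ _ HE); rewrite -(lmut_new SS').
move/(mulfI (lvar_neq0 vS k)) => Ey.
by rewrite /frame_spec (unsplitK (inl k)) -Ey.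
Qed.

Lemma lpath_frames S : lpath j d S0 S -> exists T, frames T S.
Proof.
elim=> [|k S1 S2 _ [T fT] SS vS2]; first by exists framed; apply: framed_frames.
exact: frames_mutation fT SS vS2.
Qed.

Theorem Laurent_phenomenon S i : lpath j d S0 S ->
  laurent_ring_on j predT (lvar S0) (lvar S i).
Proof.
move=> /lpath_frames[T fT]; have := frames_spec fT (lshift n i).
rewrite /frame_spec (unsplitK (inl i)) => /(specializes_Laurent t0).
apply: Laurent_min; first exact: Laurent_subring.
  exact: Laurent_const.
move=> l _; rewrite /frame_spec; case: (split l) => l'.
  by split; [apply: Laurent_var|apply: Laurent_varV].
by rewrite invr1 -(rmorph1 j); split; apply: Laurent_const.
Qed.

End PrincipalFraming.

(** * The invariant 2-form *)

Section InvariantForm.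
Variables (F : fieldType) (n : nat).
Implicit Types (b : 'I_n -> 'I_n -> int) (f : 'I_n -> int) (w : 'I_n -> F).

(** The 2-form sum b_il f_l dlog x_i /\ dlog x_l on two tangent vectors with
    logarithmic coordinates w and w'. *)
Definition log_form b f w w' : F :=
  \sum_i \sum_l (b i l * f l)%:~R * w i * w' l.

Definition wplus b k w : F := \sum_i (zpos (b i k))%:~R * w i.
Definition wminus b k w : F := \sum_i (zpos (- b i k))%:~R * w i.

Lemma log_form_split b f w w' k : b k k = 0 ->
  log_form b f w w' =
    \sum_(i | i != k) \sum_(l | l != k) (b i l * f l)%:~R * w i * w' l +
    (\sum_(i | i != k) (b i k * f k)%:~R * w i) * w' k +
    w k * (\sum_(l | l != k) (b k l * f l)%:~R * w' l).
Proof.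
move=> bkk; rewrite /log_form (bigD1 k) //= addrC; congr (_ + _).
  under eq_bigr => i ik do rewrite (bigD1 k) //= addrC.
  by rewrite big_split /= mulr_suml; congr (_ + _).
rewrite (bigD1 k) //= bkk !mul0r add0r mulr_sumr.
by apply: eq_bigr => i _; ring.
Qed.

(** The logarithmic coordinate at k changes from w k to al p + (1 - al) q - w k,
    where p and q are the coordinates of the two terms of the exchange
    polynomial; all contributions of al cancel because b f is skew-symmetric. *)
Lemma log_form_mutation b f k w w' v v' al :
  (forall i l, b i l * f l = - (b l i * f i)) -> (forall i, 0 < f i) ->
  b k k = 0 ->
  (forall i, i != k -> v i = w i) -> (forall i, i != k -> v' i = w' i) ->
  w k + v k = al * wplus b k w + (1 - al) * wminus b k w ->
  w' k + v' k = al * wplus b k w' + (1 - al) * wminus b k w' ->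
  log_form (matrix_mutation k b) f v v' = log_form b f w w'.
Proof.
move=> sb f0 bkk vw vw' Ek Ek'.
have b'kk : matrix_mutation k b k k = 0 by rewrite matrix_mutationE eqxx bkk.
rewrite !(log_form_split _ _ _ (k := k)) //.
have wD (u : 'I_n -> F) : \sum_(i | i != k) (b i k)%:~R * u i = wplus b k u - wminus b k u.
  rewrite /wplus /wminus -sumrB [RHS](bigD1 k) //= bkk subrr add0r.
  apply: eq_bigr => i _; rewrite -{1}(zposB (b i k)) rmorphB /=; ring.
have wM (u : 'I_n -> F) : \sum_(i | i != k) (zpos (- b i k))%:~R * u i = wminus b k u.
  by rewrite /wminus [RHS](bigD1 k) //= bkk /= mul0r add0r.
have colE (u : 'I_n -> F) : \sum_(i | i != k) (b i k * f k)%:~R * u i =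
    (f k)%:~R * (wplus b k u - wminus b k u).
  by rewrite -wD mulr_sumr; apply: eq_bigr => i _; rewrite rmorphM /=; ring.
have rowE (u : 'I_n -> F) : \sum_(l | l != k) (b k l * f l)%:~R * u l =
    - ((f k)%:~R * (wplus b k u - wminus b k u)).
  rewrite -wD mulr_sumr -sumrN; apply: eq_bigr => i _.
  by rewrite sb rmorphN rmorphM /=; ring.
have -> : \sum_(i | i != k) (matrix_mutation k b i k * f k)%:~R * v i =
    - ((f k)%:~R * (wplus b k w - wminus b k w)).
  rewrite -colE -sumrN; apply: eq_bigr => i ik.
  by rewrite matrix_mutationE eqxx orbT mulNr rmorphN mulNr vw.
have -> : \sum_(l | l != k) (matrix_mutation k b k l * f l)%:~R * v' l =
    (f k)%:~R * (wplus b k w' - wminus b k w').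
  rewrite -[RHS]opprK -rowE -sumrN; apply: eq_bigr => i ik.
  by rewrite matrix_mutationE eqxx mulNr rmorphN mulNr vw'.
rewrite colE rowE.
have zf l : f l * zpos (b k l) = f k * zpos (- b l k).
  have E := sb k l; have := f0 l; have := f0 k; rewrite /zpos => fk fl.
  have -> : (0 < - b l k) = (0 < b k l).
    by apply/idP/idP; nia.
  by case: ifP => _; rewrite ?mulr0 // mulrC E; ring.
have -> : \sum_(i | i != k) \sum_(l | l != k)
     (matrix_mutation k b i l * f l)%:~R * v i * v' l =
   \sum_(i | i != k) \sum_(l | l != k) (b i l * f l)%:~R * w i * w' l +
   (f k)%:~R * (wplus b k w * wminus b k w' - wminus b k w * wplus b k w').
  have -> : wplus b k w * wminus b k w' - wminus b k w * wplus b k w' =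
      (wplus b k w - wminus b k w) * wminus b k w' -
      wminus b k w * (wplus b k w' - wminus b k w') by ring.
  rewrite -!wD -(wM w) -(wM w') !mulr_suml -sumrB mulr_sumr -big_split /=.
  apply: eq_bigr => i ik; rewrite !mulr_sumr -sumrB mulr_sumr -big_split /=.
  apply: eq_bigr => l lk; rewrite vw // vw' //.
  have -> : matrix_mutation k b i l * f l = b i l * f l +
      f k * (b i k * zpos (- b l k) - zpos (- b i k) * b l k).
    rewrite matrix_mutationE (negbTE ik) (negbTE lk) /=.
    have -> : (b i l + b i k * zpos (b k l) + zpos (- b i k) * b k l) * f l =
      b i l * f l + b i k * (f l * zpos (b k l)) + zpos (- b i k) * (b k l * f l) by ring.
    by rewrite zf (sb k l); ring.
  by rewrite !(rmorphD, rmorphM, rmorphB) /=; ring.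
have -> : v k = al * wplus b k w + (1 - al) * wminus b k w - w k by rewrite -Ek; ring.
have -> : v' k = al * wplus b k w' + (1 - al) * wminus b k w' - w' k by rewrite -Ek'; ring.
ring.
Qed.

End InvariantForm.

Section LogDerivative.
Variables (K F : fieldType) (j : {rmorphism K -> F}) (n : nat) (x : 'I_n -> F).
Hypothesis ax : alg_indep j x.
Variable l : 'I_n.
Implicit Types (q r : {mpoly K[n]}).

(** The derivation x_l d/dx_l on Laurent polynomials. It fixes the product of
    all variables, so a denominator that is its m-th power contributes -m. *)
Definition log_deriv (a c : F) : Prop :=
  exists q m, expands j x a q m /\
    c * mmap j x (prod_vars K n) ^+ m = mmap j x ('X_l * q^`M(l) - q *+ m).

Let W := prod_vars K n.
Let w0 : mmap j x W != 0.
Proof.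
by rewrite /W mmap_prod_vars; apply/prodf_neq0 => i _; apply: alg_indep_neq0 i ax.
Qed.

Lemma mderiv_var i : ('X_i)^`M(l) = (i == l)%:R :> {mpoly K[n]}.
Proof.
rewrite mderivX mnm1E; case: eqP => [->|_]; last by rewrite scale0r.
have -> : (U_(l) - U_(l))%MM = 0%MM by apply/mnmP => m; rewrite mnmBE mnm0E subnn.
by rewrite scale1r mpolyX0.
Qed.

Lemma mderiv_prod_vars : 'X_l * W^`M(l) = W.
Proof.
rewrite /W /prod_vars (bigD1 l) //= mderivM mderiv_var eqxx mul1r.
set V := \prod_(i | _) _.
suff -> : V^`M(l) = 0 by rewrite mulr0 addr0.
rewrite /V; apply: (big_rec (fun p : {mpoly K[n]} => p^`M(l) = 0)); first exact: mderivC.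
by move=> i p il IH; rewrite mderivM mderiv_var (negbTE il) IH mul0r mulr0 addr0.
Qed.

Lemma mderiv_prod_varsX m : 'X_l * (W ^+ m)^`M(l) = W ^+ m *+ m.
Proof.
elim: m => [|m IHm]; first by rewrite expr0 mulr0n mderivC mulr0.
rewrite exprS mderivM mulrDr [X in _ + X]mulrCA IHm mulrA mderiv_prod_vars.
by rewrite mulrnAr -exprS -mulrS.
Qed.

Lemma mderiv_mul_prod_varsX q m :
  'X_l * (q * W ^+ m)^`M(l) = 'X_l * q^`M(l) * W ^+ m + q * W ^+ m *+ m.
Proof.
rewrite mderivM mulrDr; congr (_ + _); first by rewrite mulrA.
by rewrite mulrCA mderiv_prod_varsX mulrnAr.
Qed.

Lemma log_deriv_unique a c c' : log_deriv a c -> log_deriv a c' -> c = c'.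
Proof.
move=> [q [m [aq cq]]] [r [s [ar cr]]].
have E := expands_unique ax aq ar.
have E' : 'X_l * (q * W ^+ s)^`M(l) = 'X_l * (r * W ^+ m)^`M(l) by rewrite E.
rewrite !mderiv_mul_prod_varsX in E'.
apply: (mulIf (expf_neq0 (m + s) w0)); rewrite exprD mulrA cq.
have -> : c' * (mmap j x W ^+ m * mmap j x W ^+ s) =
   c' * mmap j x W ^+ s * mmap j x W ^+ m by ring.
rewrite cr -!rmorphXn -!rmorphM /=; congr (mmap _ _ _).
set A := 'X_l * q^`M(l) in E' *; set B := 'X_l * r^`M(l) in E' *.
rewrite !mulrBl !mulrnAl; apply/eqP; rewrite -subr_eq0; apply/eqP.
transitivity ((A * W ^+ s + q * W ^+ s *+ s) - (B * W ^+ m + r * W ^+ m *+ m)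
   - (q * W ^+ s - r * W ^+ m) *+ (m + s)); last by rewrite E' E !subrr mul0rn subrr.
by rewrite mulrnBl !mulrnDr; ring.
Qed.

Lemma log_deriv_total a : laurent_ring_on j predT x a -> exists c, log_deriv a c.
Proof.
move=> La; have [q [m aq]] := Laurent_expands (fun i => alg_indep_neq0 i ax) La.
exists (mmap j x ('X_l * q^`M(l) - q *+ m) / mmap j x W ^+ m), q, m; split=> //.
by rewrite divfK // expf_neq0.
Qed.

Lemma log_derivC c : log_deriv (j c) 0.
Proof.
exists c%:MP, 0%N; split; first exact: expandsC.
by rewrite mderivC mulr0 mulr0n subr0 rmorph0 mul0r.
Qed.

Lemma log_deriv_var i : log_deriv (x i) ((i == l)%:R * x i).
Proof.
exists 'X_i, 0%N; split; first exact: expandsX.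
rewrite mderiv_var mulr0n subr0 mulr1; case: eqP => [->|_].
  by rewrite mul1r mulr1 mmapX mmap1U.
by rewrite mul0r mulr0 rmorph0.
Qed.

Lemma log_derivD a b c e : log_deriv a c -> log_deriv b e -> log_deriv (a + b) (c + e).
Proof.
move=> [q [m [aq cq]]] [r [s [br er]]].
exists (q * W ^+ s + r * W ^+ m), (m + s)%N; split; first exact: expandsD.
rewrite exprD mulrDl.
have -> : c * (mmap j x W ^+ m * mmap j x W ^+ s) = c * mmap j x W ^+ m * mmap j x W ^+ s by ring.
have -> : e * (mmap j x W ^+ m * mmap j x W ^+ s) = e * mmap j x W ^+ s * mmap j x W ^+ m by ring.
rewrite cq er -!rmorphXn -!rmorphM -rmorphD /=; congr (mmap _ _ _).
rewrite mderivD mulrDr !mderiv_mul_prod_varsX mulrnDl !mulrnDr !mulrBl !mulrnAl.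
ring.
Qed.

Lemma log_derivM a b c e : log_deriv a c -> log_deriv b e ->
  log_deriv (a * b) (c * b + a * e).
Proof.
move=> [q [m [aq cq]]] [r [s [br er]]].
exists (q * r), (m + s)%N; split; first exact: expandsM.
rewrite exprD mulrDl.
have -> : c * b * (mmap j x W ^+ m * mmap j x W ^+ s) =
  (c * mmap j x W ^+ m) * (b * mmap j x W ^+ s) by ring.
have -> : a * e * (mmap j x W ^+ m * mmap j x W ^+ s) =
  (a * mmap j x W ^+ m) * (e * mmap j x W ^+ s) by ring.
rewrite cq er aq br -!rmorphM -rmorphD /=; congr (mmap _ _ _).
by rewrite mderivM mulrnDr; ring.
Qed.

Lemma log_deriv_mon (y w : 'I_n -> F) (v : 'I_n -> int) :
  (forall i, log_deriv (y i) (w i * y i)) -> (forall i, 0 <= v i) ->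
  log_deriv (mon y v) ((\sum_i (v i)%:~R * w i) * mon y v).
Proof.
move=> yw v0; rewrite /mon.
apply: (big_rec2 (fun c a => log_deriv a (c * a))).
  by rewrite mul0r -(rmorph1 j); apply: log_derivC.
move=> i c a _ ac; rewrite mulrDl.
suff H : log_deriv (y i ^ v i) ((v i)%:~R * w i * y i ^ v i).
  have := log_derivM H ac.
  by congr (log_deriv _ _); ring.
case: (v i) (v0 i) => // m _; elim: m => [|m IHm].
  by rewrite expr0z mulr0z !mul0r -(rmorph1 j); apply: log_derivC.
rewrite exprSz; have := log_derivM (yw i) IHm.
congr (log_deriv _ _); rewrite -[Posz m.+1]/(Posz (1 + m)) PoszD rmorphD /=; ring.
Qed.

End LogDerivative.

Section FormAlongPaths.
Variables (K F : fieldType) (j : {rmorphism K -> F}) (n : nat).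
Variables (d : 'I_n -> rat) (f : 'I_n -> int) (S0 : lseed K F n).
Hypothesis vS0 : lvalid j d S0.
Hypothesis f0 : forall i, 0 < f i.
Hypothesis fd : forall b : 'I_n -> 'I_n -> int, symmetrized_by d b ->
  forall i l, b i l * f l = - (b l i * f i).
Let ax := lvalid_indep vS0.

Definition log_derivs l (S : lseed K F n) (w : 'I_n -> F) : Prop :=
  forall i, log_deriv j (lvar S0) l (lvar S i) (w i * lvar S i).

Lemma lpath_valid S : lpath j d S0 S -> lvalid j d S.
Proof. by case. Qed.

Lemma log_derivs_exist l S : lpath j d S0 S -> exists w, log_derivs l S w.
Proof.
move=> pS; have vS := lpath_valid pS.
have H i : exists c, log_deriv j (lvar S0) l (lvar S i) (c * lvar S i).
  have [c Hc] := log_deriv_total ax l (Laurent_phenomenon vS0 i pS).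
  by exists (c / lvar S i); rewrite divfK // (lvar_neq0 vS).
by have [w Hw] := fin_all_exists H; exists w.
Qed.

Lemma log_derivs_mutation k l S S' w v :
  lvalid j d S -> lvalid j d S' -> lmutation j k S S' ->
  log_derivs l S w -> log_derivs l S' v ->
  (forall i, i != k -> v i = w i) /\
  w k + v k =
    (j (lplus S k) * mon (lvar S) (fun i => zpos (lmat S i k)) / lexchange j S k) *
      wplus (lmat S) k w +
    (1 - j (lplus S k) * mon (lvar S) (fun i => zpos (lmat S i k)) / lexchange j S k) *
      wminus (lmat S) k w.
Proof.
move=> vS vS' SS' Hw Hv; split=> [i ik|].
  apply: (mulIf (lvar_neq0 vS i)).
  by have := Hv i; rewrite (lmut_other SS') // => /(log_deriv_unique ax)/(_ (Hw i)).
have M0 : lexchange j S k != 0.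
  by rewrite -(lmut_new SS') mulf_neq0 ?(lvar_neq0 vS) ?(lvar_neq0 vS').
have HM := log_derivM (Hw k) (Hv k); rewrite (lmut_new SS') in HM.
have Hm (u : 'I_n -> int) c : (forall i, 0 <= u i) -> log_deriv j (lvar S0) l (j c * mon (lvar S) u)
    ((\sum_i (u i)%:~R * w i) * (j c * mon (lvar S) u)).
  move=> u0; have := log_derivM (log_derivC j (lvar S0) l c) (log_deriv_mon Hw u0).
  by congr (log_deriv _ _ _ _ _); ring.
have HE := log_derivD (Hm (fun i => zpos (lmat S i k)) (lplus S k) (fun i => zpos_ge0 _))
   (Hm (fun i => zpos (- lmat S i k)) (lminus S k) (fun i => zpos_ge0 _)).
have := log_deriv_unique ax HM HE.
rewrite -/(wplus (lmat S) k w) -/(wminus (lmat S) k w).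
set A := j (lplus S k) * _; set B := j (lminus S k) * _.
have EAB : lexchange j S k = A + B by [].
have -> : w k * lvar S k * lvar S' k + lvar S k * (v k * lvar S' k) =
  (w k + v k) * lexchange j S k by rewrite -(lmut_new SS'); ring.
move=> E; apply: (mulIf M0); rewrite E.
have -> : B = lexchange j S k - A by rewrite EAB; ring.
by field.
Qed.

Lemma log_form_path l l' S w w' v v' : lpath j d S0 S ->
  log_derivs l S0 w -> log_derivs l' S0 w' -> log_derivs l S v -> log_derivs l' S v' ->
  log_form (lmat S) f v v' = log_form (lmat S0) f w w'.
Proof.
move=> pS Hw Hw'; elim: pS v v' => [|k S1 S2 pS1 IH SS vS2] v v' Hv Hv'.
  have E u u' l1 : log_derivs l1 S0 u -> log_derivs l1 S0 u' -> forall i, u i = u' i.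
    move=> Hu Hu' i; apply: (mulIf (lvar_neq0 vS0 i)).
    by have := log_deriv_unique ax (Hu i) (Hu' i).
  apply: eq_bigr => i _; apply: eq_bigr => m _.
  by rewrite (E v w l) // (E v' w' l').
have vS1 := lpath_valid pS1.
have [u Hu] := log_derivs_exist l pS1; have [u' Hu'] := log_derivs_exist l' pS1.
have [uv Ek] := log_derivs_mutation vS1 vS2 SS Hu Hv.
have [uv' Ek'] := log_derivs_mutation vS1 vS2 SS Hu' Hv'.
rewrite -(IH _ _ Hu Hu').
have -> : log_form (lmat S2) f v v' = log_form (matrix_mutation k (lmat S1)) f v v'.
  by apply: eq_bigr => i _; apply: eq_bigr => m _; rewrite (lmut_mat SS).
apply: (log_form_mutation _ f0 _ uv uv' Ek Ek'); first exact: fd (lvalid_mat vS1).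
exact: lmat_diag vS1 k.
Qed.

(** In the logarithmic coordinates of its own cluster, the form has the entries
    of b f as coefficients. *)
Lemma cluster_determines_form S (s : 'I_n -> 'I_n) :
  injective s -> lpath j d S0 S -> (forall i, lvar S i = lvar S0 (s i)) ->
  forall i l, (lmat S i l * f l)%:~R = (lmat S0 (s i) (s l) * f (s l))%:~R :> F.
Proof.
move=> sI pS xS i l.
have H0 m : log_derivs m S0 (fun i => (i == m)%:R) by move=> i'; apply: log_deriv_var.
have HS m : log_derivs (s m) S (fun i => (i == m)%:R).
  move=> i'; rewrite xS -(inj_eq sI); exact: log_deriv_var.
have form b i1 l1 : log_form b f (fun i => (i == i1)%:R : F) (fun i => (i == l1)%:R) =
    (b i1 l1 * f l1)%:~R.
  rewrite /log_form (bigD1 i1) //= (bigD1 l1) //= !eqxx !mulr1 !big1 ?addr0 // => m.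
    by move=> /negbTE->; apply: big1 => m' _; rewrite mulr0 mul0r.
  by move=> /negbTE->; rewrite mulr0.
by rewrite -!form; apply: (log_form_path pS (H0 _) (H0 _) (HS _) (HS _)).
Qed.

End FormAlongPaths.

(** * Subtraction-free elements and their values in the semifield *)

Section SemifieldFacts.
Variable P : semifieldType.
Implicit Types g h p q : P.
Local Open Scope group_scope.

Lemma semifield_mulAC g h k : g * h * k = g * k * h :> P.
Proof. by rewrite -!mulgA (semifield_mulC h k). Qed.

Lemma semifield_mulCA g h k : g * (h * k) = h * (g * k) :> P.
Proof. by rewrite !mulgA (semifield_mulC g h). Qed.

Lemma semifield_mulDl g h k : oplus g h * k = oplus (g * k) (h * k) :> P.
Proof. by rewrite !(semifield_mulC _ k) semifield_mulDr. Qed.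

(** A common factor of two normalized pairs is g = g (p (+) q) = 1. *)
Lemma normalized_scale g p q p' q' : oplus p q = 1 -> oplus p' q' = 1 ->
  p' = g * p -> q' = g * q -> g = 1.
Proof. by move=> N N' E E'; rewrite -N' E E' -semifield_mulDr N mulg1. Qed.

Lemma normalized_ratio p q p' q' : oplus p q = 1 -> oplus p' q' = 1 ->
  p' / q' = p / q -> p' = p /\ q' = q.
Proof.
move=> N N' E; pose g := q' / q.
have Eq : q' = g * q by rewrite /g mulgVK.
have Ep : p' = g * p.
  by rewrite -(mulgVK q' p') E /g semifield_mulC mulgA semifield_mulAC.
have g1 := normalized_scale N N' Ep Eq.
by rewrite Ep Eq g1 !mul1g.
Qed.

End SemifieldFacts.

Section SubtractionFree.
Variables (P : semifieldType) (K F : fieldType) (u : P -> K) (j : {rmorphism K -> F}).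
Hypothesis hu : is_group_ring_fractions u.
Variables (n : nat) (x : 'I_n -> F).
Hypothesis ax : alg_indep j x.
Implicit Types (L : seq (P * 'X_{1..n})).

Lemma group_ring_unit g : u g != 0.
Proof.
apply/eqP => ug; have /eqP := group_ring_one hu.
by rewrite -(mulgV g) (group_ring_mul hu) ug mul0r eq_sym oner_eq0.
Qed.

(** The element of the group ring that is the sum of the members of s. *)
Definition multiplicities (s : seq P) : {fsfun P -> int with 0} :=
  [fsfun g in [fset h in s]%fset => (count_mem g s)%:Z | 0].

Lemma multiplicitiesE s g : multiplicities s g = (count_mem g s)%:Z.
Proof.
rewrite fsfun_fun inE /=; case: ifP => // gs.
by rewrite (count_memPn _) // gs.
Qed.

Lemma group_ring_eval_multiplicities s :
  group_ring_eval u (multiplicities s) = \sum_(g <- s) u g.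
Proof.
rewrite -(big_undup_iterop_count +%R s xpredT u) /group_ring_eval /=.
have -> : \sum_(g <- finsupp (multiplicities s)) (multiplicities s g)%:~R * u g =
    \sum_(g <- undup s) (multiplicities s g)%:~R * u g.
  apply: perm_big; apply: uniq_perm; [exact: fset_uniq|exact: undup_uniq|].
  move=> g; rewrite mem_finsupp multiplicitiesE mem_undup.
  by rewrite -has_pred1 has_count -lt0n.
apply: eq_bigr => g _; rewrite multiplicitiesE.
by rewrite -[RHS]/(u g *+ count_mem g s) -mulr_natl.
Qed.

Lemma group_elements_independent (s t : seq P) :
  \sum_(g <- s) u g = \sum_(g <- t) u g -> perm_eq s t.
Proof.
rewrite -!group_ring_eval_multiplicities => /(group_ring_inj hu) E.
apply/allP => g _ /=; apply/eqP.
by have := congr1 (fun c : {fsfun P -> int with 0} => c g) E; rewrite !multiplicitiesE => -[].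
Qed.

(** A list of pairs (g, m) stands for the sum of the terms g x^m. Lists record
    repeated terms, which count in P: there 1 (+) 1 has no reason to be 1. *)
Definition sfpoly L : {mpoly K[n]} := \sum_(t <- L) u t.1 *: 'X_[t.2].
Definition sfeval L : F := mmap j x (sfpoly L).
(** There is no zero in P, hence no value for the empty sum. *)
Definition tropical L : option P :=
  \big[oAC (@oplusA P) (@oplusC P) / None]_(t <- L) Some t.1.

Lemma sfpoly_inj L L' : sfpoly L = sfpoly L' -> perm_eq L L'.
Proof.
move=> E; apply/allP => [[g m]] _ /=; apply/eqP.
have cntE M : count_mem (g, m) M = count_mem g [seq t.1 | t <- M & t.2 == m].
  rewrite count_map count_filter; apply: eq_count => -[h k] /=.
  by rewrite xpair_eqE andbC.
have coefE M : (sfpoly M)@_m = \sum_(g <- [seq t.1 | t <- M & t.2 == m]) u g.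
  rewrite big_map big_filter [RHS]big_mkcond /sfpoly raddf_sum /=.
  apply: eq_bigr => t _; rewrite mcoeffZ mcoeffX.
  by case: eqP; rewrite ?mulr1 ?mulr0.
rewrite !cntE; apply/permP; apply: group_elements_independent.
by rewrite -!coefE E.
Qed.

Lemma sfeval_inj L L' : sfeval L = sfeval L' -> perm_eq L L'.
Proof.
move=> E; apply: sfpoly_inj; apply/eqP; rewrite -subr_eq0; apply/eqP; apply: ax.
by rewrite rmorphB /=; apply/eqP; rewrite subr_eq0; apply/eqP.
Qed.

Lemma tropical_perm L L' : perm_eq L L' -> tropical L = tropical L'.
Proof. exact: perm_big. Qed.

Lemma sfeval_neq0 L p : tropical L = Some p -> sfeval L != 0.
Proof.
move=> Lp; apply/eqP => L0.
have /sfeval_inj : sfeval L = sfeval [::] by rewrite L0 /sfeval /sfpoly big_nil rmorph0.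
by move/perm_nilP => E; rewrite E /tropical big_nil in Lp.
Qed.

Definition sfmul L L' : seq (P * 'X_{1..n}) :=
  [seq ((s.1 * t.1)%g, (s.2 + t.2)%MM) | s <- L, t <- L'].

Lemma sfeval_mul L L' : sfeval (sfmul L L') = sfeval L * sfeval L'.
Proof.
rewrite /sfeval -rmorphM /=; congr (mmap _ _ _).
rewrite /sfpoly mulr_suml /sfmul big_allpairs_dep; apply: eq_bigr => s _.
rewrite mulr_sumr; apply: eq_bigr => t _ /=.
by rewrite (group_ring_mul hu) -scalerAl -scalerAr scalerA mpolyXD.
Qed.

Lemma sfeval_cat L L' : sfeval (L ++ L') = sfeval L + sfeval L'.
Proof. by rewrite /sfeval -rmorphD /sfpoly big_cat. Qed.

Lemma tropical_cat L L' p q : tropical L = Some p -> tropical L' = Some q ->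
  tropical (L ++ L') = Some (oplus p q).
Proof. by rewrite /tropical big_cat /= => -> ->. Qed.

Lemma tropical_mul L L' p q : tropical L = Some p -> tropical L' = Some q ->
  tropical (sfmul L L') = Some (p * q)%g.
Proof.
move=> + Lq.
have row s : tropical [seq ((s.1 * t.1)%g, (s.2 + t.2)%MM) | t <- L'] = Some (s.1 * q)%g.
  have : forall M, tropical [seq ((s.1 * t.1)%g, (s.2 + t.2)%MM) | t <- M] =
      omap (fun h => (s.1 * h)%g) (tropical M).
    elim=> [|t M IHM]; first by rewrite /tropical !big_nil.
    rewrite /tropical /= !big_cons -!/(tropical _) IHM /=.
    by case: (tropical M) => //= h; rewrite !oACE /= semifield_mulDr.
  by move=> ->; rewrite Lq.
have : tropical (sfmul L L') = omap (fun h => (h * q)%g) (tropical L).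
  elim: L => [|s L IHL]; first by rewrite /tropical !big_nil.
  have -> : sfmul (s :: L) L' =
      [seq ((s.1 * t.1)%g, (s.2 + t.2)%MM) | t <- L'] ++ sfmul L L' by [].
  rewrite /tropical big_cat big_cons -!/(tropical _) row IHL.
  by case: (tropical L) => //= h; rewrite !oACE /= semifield_mulDl.
by move=> -> ->.
Qed.

(** The value in P of a quotient of sums of terms g x^m, when the variables are
    set to 1 and + is read as oplus. *)
Definition tropicalizes (a : F) (g : P) : Prop :=
  exists G H p q, [/\ tropical G = Some p, tropical H = Some q,
    a * sfeval H = sfeval G & (g * q)%g = p].

(** Algebraic independence and the independence of the elements of P over Z
    identify the lists of terms of two equal sums up to order. *)
Lemma tropicalizes_unique a g h : tropicalizes a g -> tropicalizes a h -> g = h.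
Proof.
move=> [G [H [p [q [Gp Hq aG gp]]]]] [G' [H' [p' [q' [Gp' Hq' aG' gp']]]]].
have E : sfeval (sfmul G H') = sfeval (sfmul G' H) by rewrite !sfeval_mul -aG -aG'; ring.
have := tropical_perm (sfeval_inj E).
rewrite (tropical_mul Gp Hq') (tropical_mul Gp' Hq) -gp -gp' => -[].
by rewrite semifield_mulAC => /mulIg/mulIg.
Qed.

Lemma tropicalizes_neq0 a g : tropicalizes a g -> a != 0.
Proof.
move=> [G [H [p [q [Gp _ aG _]]]]]; apply: contraTneq (sfeval_neq0 Gp).
by rewrite -aG => ->; rewrite mul0r eqxx.
Qed.

Lemma sfeval1 g m : sfeval [:: (g, m)] = j (u g) * mmap j x 'X_[m].
Proof. by rewrite /sfeval /sfpoly big_seq1 mmapZ. Qed.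

Lemma tropical1 g m : tropical [:: (g, m)] = Some g.
Proof. by rewrite /tropical big_seq1. Qed.

Lemma tropicalizes_const g : tropicalizes (j (u g)) g.
Proof.
exists [:: (g, 0%MM)], [:: (1%g, 0%MM)], g, 1%g; rewrite !tropical1 mulg1; split=> //.
by rewrite !sfeval1 (group_ring_one hu) rmorph1 mul1r.
Qed.

Lemma tropicalizes_var i : tropicalizes (x i) 1%g.
Proof.
exists [:: (1%g, U_(i)%MM)], [:: (1%g, 0%MM)], 1%g, 1%g; rewrite !tropical1 mulg1; split=> //.
by rewrite !sfeval1 (group_ring_one hu) rmorph1 !mul1r mpolyX0 rmorph1 mulr1 mmapX mmap1U.
Qed.

Lemma tropicalizesM a b g h : tropicalizes a g -> tropicalizes b h ->
  tropicalizes (a * b) (g * h)%g.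
Proof.
move=> [G [H [p [q [Gp Hq aG gp]]]]] [G' [H' [p' [q' [Gp' Hq' aG' gp']]]]].
exists (sfmul G G'), (sfmul H H'), (p * p')%g, (q * q')%g; split.
- exact: tropical_mul.
- exact: tropical_mul.
- by rewrite !sfeval_mul -aG -aG'; ring.
- by rewrite -gp -gp' -!mulgA (semifield_mulCA h).
Qed.

Lemma tropicalizesD a b g h : tropicalizes a g -> tropicalizes b h ->
  tropicalizes (a + b) (oplus g h).
Proof.
move=> [G [H [p [q [Gp Hq aG gp]]]]] [G' [H' [p' [q' [Gp' Hq' aG' gp']]]]].
exists (sfmul G H' ++ sfmul G' H), (sfmul H H'), (oplus (p * q') (p' * q))%g, (q * q')%g; split.
- by apply: tropical_cat; apply: tropical_mul.
- exact: tropical_mul.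
- by rewrite sfeval_cat !sfeval_mul -aG -aG'; ring.
- rewrite semifield_mulDl -gp -gp' !mulgA; congr (oplus _ _).
  by rewrite semifield_mulAC.
Qed.

Lemma tropicalizesV a g : tropicalizes a g -> tropicalizes a^-1 (g^-1)%g.
Proof.
move=> Ta; have a0 := tropicalizes_neq0 Ta.
have [G [H [p [q [Gp Hq aG gp]]]]] := Ta.
by exists H, G, q, p; split=> //; [rewrite -aG mulKf|rewrite -gp mulKg].
Qed.

Lemma tropicalizesX a g m : tropicalizes a g -> tropicalizes (a ^+ m) (g ^+ m)%g.
Proof.
move=> Ta; elim: m => [|m IHm].
  by rewrite expr0 expg0 -(rmorph1 j) -(group_ring_one hu); apply: tropicalizes_const.
by rewrite exprS expgS; apply: tropicalizesM.
Qed.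

Lemma tropicalizes1_mon (y : 'I_n -> F) (v : 'I_n -> int) :
  (forall i, tropicalizes (y i) 1%g) -> (forall i, 0 <= v i) ->
  tropicalizes (mon y v) 1%g.
Proof.
move=> Ty v0; rewrite /mon; apply: (big_ind (fun a => tropicalizes a 1%g)).
- by have := tropicalizes_const 1%g; rewrite (group_ring_one hu) rmorph1.
- by move=> a b Ta Tb; rewrite -[1%g]mulg1; apply: tropicalizesM.
by move=> i _; case: (v i) (v0 i) => // m _; rewrite -(expg1n P m); apply: tropicalizesX.
Qed.

(** 1 + a + ... + a^(m-1) is subtraction-free, hence not 0. *)
Lemma subtraction_free_root a g m : tropicalizes a g -> (0 < m)%N -> a ^+ m = 1 -> a = 1.
Proof.
move=> Ta m0 am; apply/eqP; rewrite -subr_eq0; apply/eqP.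
have : (a - 1) * (\sum_(i < m) a ^+ i) = 0 by rewrite -subrX1 am subrr.
move/eqP; rewrite mulf_eq0 => /orP[/eqP //|].
suff [h Th] : exists h, tropicalizes (\sum_(i < m) a ^+ i) h.
  by rewrite (negbTE (tropicalizes_neq0 Th)).
case: m m0 am => // m _ _; elim: m => [|m [h Th]].
  exists 1%g; rewrite big_ord_recr big_ord0 /= add0r.
  exact: tropicalizesX Ta.
exists (oplus h (g ^+ m.+1)%g); rewrite big_ord_recr /=.
by apply: tropicalizesD => //; apply: tropicalizesX.
Qed.

End SubtractionFree.

(** * Units and binomials in Laurent rings *)

Section UnitsAndBinomials.
Variables (F : fieldType).
Implicit Types (D E : F -> Prop).

(** The divisors of a power of x are monomials. *)
Lemma laurent_factor_monomial D (x a a' e : F) :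
  is_subring D -> transcendental D x -> x != 0 -> D e -> e != 0 ->
  laurent D x a -> laurent D x a' -> a * a' = e ->
  exists c (m : int), [/\ D c, c != 0 & a = c * x ^ m].
Proof.
move=> rD tx x0 De e0 [p [n [Dp ap]]] [q [m [Dq aq]]] E.
have Epq : p * q = e *: 'X^(n + m).
  apply: (transcendental_eq rD tx); [exact: coefs_inM|exact: coefs_inZXn|].
  by rewrite hornerM hornerZ hornerXn -ap -aq -E exprD; ring.
have : p %| ('X - 0%:P) ^+ (n + m).
  by rewrite subr0 -(dvdpZr _ _ e0) -Epq dvdp_mulIl.
case/dvdp_exp_XsubCP => s _; rewrite subr0 => /eqpP[[c1 c2] /= /andP[c10 c20] Ec].
have Ep : p = (c2 / c1) *: 'X^s.
  by apply: (scalerI c10); rewrite Ec scalerA mulrCA mulfV // mulr1.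
have Dc : D (c2 / c1) by have := Dp s; rewrite Ep coefZ coefXn eqxx mulr1.
exists (c2 / c1), (s%:Z - n%:Z); split=> //; first by rewrite mulf_neq0 ?invr_eq0.
have Exs : x ^ (s%:Z - n%:Z) * x ^+ n = x ^+ s.
  by rewrite (_ : x ^+ n = x ^ n%:Z) // -expfzDr // subrK.
by apply: (mulIf (expf_neq0 n x0)); rewrite ap Ep hornerZ hornerXn -[RHS]mulrA Exs.
Qed.

Lemma laurent_coefficient D E (y c : F) (m : int) :
  is_subring E -> (forall d, D d -> E d) -> is_subring D ->
  transcendental E y -> y != 0 -> E c ->
  laurent D y (c * y ^ m) -> D c.
Proof.
move=> rE DE rD ty y0 Ec L.
have [p [n [Dp cp]]] : laurent D y c.
  have rL := laurent_subring rD y0.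
  have -> : c = c * y ^ m * y ^ (- m) by rewrite -mulrA -expfzDr // subrr expr0z mulr1.
  apply: (subringM rL) => //; apply: (subringXz rL).
    exact: laurent_var.
  exact: laurent_varV.
suff <- : (c *: 'X^n)`_n = c.
  suff -> : c *: 'X^n = p by [].
  apply: (transcendental_eq rE ty); [exact: coefs_inZXn|exact: coefs_inS Dp|].
  by rewrite hornerZ hornerXn.
by rewrite coefZ coefXn eqxx mulr1.
Qed.

Lemma binomial_not_monomial E (x al be ga : F) k (m : int) :
  is_subring E -> transcendental E x -> x != 0 ->
  E al -> E be -> E ga -> al != 0 -> be != 0 -> (0 < k)%N ->
  al * x ^+ k + be = ga * x ^ m -> False.
Proof.
move=> rE tx x0 Eal Ebe Ega al0 be0 k0 H.
have Ebin : coefs_in E (al *: 'X^k + be%:P).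
  move=> i; rewrite coefD; apply: (subringD rE); last exact: coefs_inC.
  by apply: coefs_inZ => //; apply: coefs_inXn.
case: m H => m H.
  have Ep : al *: 'X^k + be%:P = ga *: 'X^m.
    apply: (transcendental_eq rE tx) => //; first exact: coefs_inZXn.
    by rewrite !(hornerZ, hornerD, hornerXn, hornerC) H.
  have C0 := congr1 (fun p : {poly F} => p`_0) Ep.
  have Ck := congr1 (fun p : {poly F} => p`_k) Ep.
  have k0' : (k == 0)%N = false by rewrite gtn_eqF.
  rewrite /= coefD !coefZ !coefXn coefC eqxx [0%N == k]eq_sym k0' mulr0 add0r in C0.
  rewrite /= coefD !coefZ !coefXn coefC eqxx k0' mulr1 addr0 in Ck.
  case: m {H Ep} C0 Ck => [_|m C0 _].
    by rewrite k0' mulr0 => /eqP; rewrite (negbTE al0).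
  by move/eqP: C0; rewrite mulr0 (negbTE be0).
have Ep : (al *: 'X^k + be%:P) * 'X^(m.+1) = ga%:P.
  apply: (transcendental_eq rE tx); [exact: coefs_inMXn|exact: coefs_inC|].
  rewrite hornerM !(hornerZ, hornerD, hornerXn, hornerC) H NegzE -exprnN.
  by rewrite divfK // expf_neq0.
have := congr1 (fun p : {poly F} => p`_(k + m.+1)) Ep.
rewrite coefMXn ltnNge leq_addl /= addnK coefD coefZ coefXn !coefC eqxx mulr1.
by rewrite (gtn_eqF k0) addnS /= addr0 => /eqP; rewrite (negbTE al0).
Qed.

Lemma binomials_proportional E (x al be al' be' : F) k k' (m : int) :
  is_subring E -> transcendental E x -> x != 0 ->
  E al -> E be -> E al' -> E be' -> al != 0 -> be != 0 -> al' != 0 -> be' != 0 ->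
  (0 < k)%N -> (0 < k')%N ->
  al' * x ^+ k' + be' = (al * x ^+ k + be) * x ^ m ->
  [/\ m = 0, k = k', al' = al & be' = be].
Proof.
move=> rE tx x0.
have bin a b s : E a -> E b -> coefs_in E (a *: 'X^s + b%:P).
  move=> Ea Eb i; rewrite coefD; apply: (subringD rE); last exact: coefs_inC.
  by apply: coefs_inZ => //; apply: coefs_inXn.
have main a b a' b' s s' n : E a -> E b -> E a' -> E b' -> a != 0 -> b' != 0 ->
    (0 < s)%N -> (0 < s')%N -> a' * x ^+ s' + b' = (a * x ^+ s + b) * x ^+ n ->
    [/\ n = 0%N, s = s', a' = a & b' = b].
  move=> Ea Eb Ea' Eb' a0 b'0 s0 s'0 H.
  have Ep : a' *: 'X^s' + b'%:P = (a *: 'X^s + b%:P) * 'X^n.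
    apply: (transcendental_eq rE tx); [exact: bin|by apply: coefs_inMXn => //; apply: bin|].
    by rewrite hornerM !(hornerZ, hornerD, hornerXn, hornerC) H.
  have C0 := congr1 (fun p : {poly F} => p`_0) Ep.
  have Cs := congr1 (fun p : {poly F} => p`_s) Ep.
  have Cs' := congr1 (fun p : {poly F} => p`_s') Ep.
  case: n {H} Ep C0 Cs Cs' => [|n] Ep.
    rewrite /= expr0 mulr1 !coefD !coefZ !coefXn !coefC !eqxx.
    rewrite ![0%N == _]eq_sym (gtn_eqF s0) (gtn_eqF s'0) !mulr0 !add0r !addr0 !mulr1 => -> .
    have [<-|ss'] := eqVneq s s'; first by rewrite !mulr1 => ->.
    by rewrite mulr0 => /esym/eqP; rewrite (negbTE a0).
  rewrite /= coefMXn /= coefD coefZ coefXn coefC eqxx eq_sym (gtn_eqF s'0) mulr0 add0r.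
  by move=> /eqP; rewrite (negbTE b'0).
move=> Eal Ebe Eal' Ebe' al0 be0 al'0 be'0 k0 k'0; case: m => n H.
  by have [-> -> -> ->] := main _ _ _ _ _ _ _ Eal Ebe Eal' Ebe' al0 be'0 k0 k'0 H.
have H' : al * x ^+ k + be = (al' * x ^+ k' + be') * x ^+ n.+1.
  by rewrite H NegzE -exprnN divfK // expf_neq0.
by have [] := main _ _ _ _ _ _ _ Eal' Ebe' Eal Ebe al'0 be0 k'0 k0 H'.
Qed.

End UnitsAndBinomials.

Section CompareExchangePolynomials.
Variables (K F : fieldType) (j : {rmorphism K -> F}) (n : nat) (x : 'I_n -> F).
Hypothesis ax : alg_indep j x.

(** Free of each variable separately. This is weaker than being constant, but
    it suffices to compare monomials. *)
Definition degree0 (c : F) : Prop := forall l, others_field j l x c.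

Definition binomial (A B : F) (v : 'I_n -> int) : F :=
  A * mon x (fun i => zpos (v i)) + B * mon x (fun i => zpos (- v i)).

Let x0 i : x i != 0. Proof. exact: alg_indep_neq0 i ax. Qed.

Lemma others_field_mon l v : v l = 0 -> others_field j l x (mon x v).
Proof.
move=> vl; apply: (@Laurent_others_field _ _ _ _ (predC1 l)); first by rewrite /= eqxx.
by apply: Laurent_mon => i vi /=; apply: contraNneq vi => ->; rewrite vl.
Qed.

Lemma binomial_in_var_pos l A B v : degree0 A -> degree0 B -> A != 0 -> B != 0 -> 0 < v l ->
  exists al be, [/\ others_field j l x al /\ others_field j l x be, al != 0, be != 0,
    al * x l ^+ `|v l|%N = A * mon x (fun i => zpos (v i)) &
    be = B * mon x (fun i => zpos (- v i))].
Proof.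
move=> dA dB A0 B0 vl; have rE := others_field_ring j l x.
exists (A * mon x (upd (fun i => zpos (v i)) l 0)), (B * mon x (fun i => zpos (- v i))).
split=> //.
- split; apply: (subringM rE) => //; apply: others_field_mon; first by rewrite upd_same.
  by rewrite zpos0 // oppr_le0 ltW.
- by rewrite mulf_neq0 //; apply: mon_neq0.
- by rewrite mulf_neq0 //; apply: mon_neq0.
rewrite -mulrA; congr (_ * _); rewrite (mon_split x l (fun i => zpos (v i))) mulrC.
have -> : x l ^ zpos (v l) = x l ^+ `|v l|%N by rewrite zposE ?ltW // -{1}(gtz0_abs vl).
by [].
Qed.

Lemma binomial_in_var l A B v : degree0 A -> degree0 B -> A != 0 -> B != 0 -> v l != 0 ->
  exists al be, [/\ others_field j l x al /\ others_field j l x be, al != 0, be != 0,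
    binomial A B v = al * x l ^+ `|v l|%N + be &
    if 0 < v l
    then al * x l ^+ `|v l|%N = A * mon x (fun i => zpos (v i)) /\
         be = B * mon x (fun i => zpos (- v i))
    else al * x l ^+ `|v l|%N = B * mon x (fun i => zpos (- v i)) /\
         be = A * mon x (fun i => zpos (v i))].
Proof.
move=> dA dB A0 B0; case: (ltrgtP (v l) 0) => // vl _.
  have Nvl : 0 < - v l by rewrite oppr_gt0.
  have [al [be [Eab al0 be0 Ea Eb]]] :=
    binomial_in_var_pos (v := fun i => - v i) dB dA B0 A0 Nvl.
  have Eb' : be = A * mon x (fun i => zpos (v i)).
    by rewrite Eb; congr (_ * _); apply: eq_mon => i; rewrite opprK.
  exists al, be; rewrite abszN in Ea; split=> //.
  by rewrite Ea Eb' /binomial addrC.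
have [al [be [Eab al0 be0 Ea Eb]]] := binomial_in_var_pos dA dB A0 B0 vl.
by exists al, be; split=> //; rewrite /binomial Ea Eb.
Qed.

Lemma binomial_others_field l A B v : degree0 A -> degree0 B -> v l = 0 ->
  others_field j l x (binomial A B v).
Proof.
move=> dA dB vl; have rE := others_field_ring j l x.
by apply: (subringD rE); apply: (subringM rE) => //; apply: others_field_mon; rewrite vl.
Qed.

Lemma degree0_mon_eq (a b : F) (v w : 'I_n -> int) :
  degree0 a -> degree0 b -> a != 0 -> a * mon x v = b * mon x w -> v =1 w /\ a = b.
Proof.
move=> da db a0 E.
have E1 : a * mon x (fun i => v i - w i) = b.
  by rewrite -(monD v (fun i => - w i)) // -monV mulrA E mulfK // mon_neq0.
have vw l : v l - w l = 0.
  have Em : others_field j l x (a * mon x (upd (fun i => v i - w i) l 0)).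
    by apply: (subringM (others_field_ring j l x)) => //; apply: others_field_mon; rewrite upd_same.
  apply: (others_field_power ax Em (db l)); first by rewrite mulf_neq0 // mon_neq0.
  by rewrite -mulrA [_ * x l ^ _]mulrC -(mon_split x l (fun i => v i - w i)).
have {}vw : v =1 w by move=> l; apply/eqP; rewrite -subr_eq0 vw.
split=> //; apply: (mulIf (mon_neq0 w x0)).
by rewrite -E; congr (_ * _); apply: eq_mon => i; rewrite vw.
Qed.

(** In each variable x l, a binomial times a monomial is a binomial or a
    monomial only in the obvious way; so the factor e has degree 0, and the
    absolute values of the exponents agree. Any l with v l != 0 tells how the
    two terms are matched, and this matching fixes all signs at once. *)
Lemma compare_binomials (i : 'I_n) (A B A' B' e : F) (v v' : 'I_n -> int) :
  let D := laurent_ring_on j (predC1 i) x in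
  degree0 A -> degree0 B -> degree0 A' -> degree0 B' ->
  A != 0 -> B != 0 -> A' != 0 -> B' != 0 ->
  binomial A B v != 0 -> v i = 0 -> v' i = 0 ->
  D e -> D e^-1 -> e != 0 -> binomial A' B' v' = e * binomial A B v ->
  (v =1 (fun => 0) /\ v' =1 (fun => 0)) \/
  degree0 e /\ ((v' =1 v /\ A' = e * A /\ B' = e * B) \/
                (v' =1 (fun l => - v l) /\ A' = e * B /\ B' = e * A)).
Proof.
move=> D dA dB dA' dB' A0 B0 A'0 B'0 bin0 vi v'i De DeV e0 E.
have loc l : l != i -> exists (c : F) (m : int), [/\ others_field j l x c, c != 0 &
    e = c * x l ^ m].
  move=> li; have rR := Laurent_subring j (predD1 (predC1 i) l) x.
  have lau a : D a -> laurent (laurent_ring_on j (predD1 (predC1 i) l) x) (x l) a.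
    exact: Laurent_laurent.
  have RE a : laurent_ring_on j (predD1 (predC1 i) l) x a -> others_field j l x a.
    by apply: Laurent_others_field; rewrite /= eqxx.
  have tR := transcendentalS RE (var_transcendental (k := l) ax).
  have [c [m [Rc c0 Ec]]] := laurent_factor_monomial rR tR (x0 l) (subring1 rR) (oner_neq0 F)
    (lau _ De) (lau _ DeV) (mulfV e0).
  by exists c, m; split=> //; apply: RE.
have E_l l : l != i -> others_field j l x e /\ `|v' l|%N = `|v l|%N.
  move=> li; have [c [m [Ec c0 Ee]]] := loc l li.
  have rE := others_field_ring j l x; have tx := var_transcendental (k := l) ax.
  have [vl|vl] := eqVneq (v l) 0; have [v'l|v'l] := eqVneq (v' l) 0.
  - have Eb := binomial_others_field dA dB vl; have Eb' := binomial_others_field dA' dB' v'l.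
    have m0 : m = 0.
      apply: (others_field_power ax (a := c * binomial A B v) _ Eb').
      - exact: (subringM rE).
      - by rewrite mulf_neq0.
      - by rewrite E Ee; ring.
    by rewrite Ee m0 expr0z mulr1 vl v'l.
  - have [al [be [[Eal Ebe] al0 be0 Eab _]]] := binomial_in_var dA' dB' A'0 B'0 v'l.
    case: (@binomial_not_monomial F _ (x l) al be (c * binomial A B v) `|v' l|%N m rE tx) => //.
    - by apply: (subringM rE) => //; apply: binomial_others_field.
    - by rewrite absz_gt0.
    - by rewrite -Eab E Ee; ring.
  - have [al [be [[Eal Ebe] al0 be0 Eab _]]] := binomial_in_var dA dB A0 B0 vl.
    have Eb' := binomial_others_field dA' dB' v'l.
    case: (@binomial_not_monomial F _ (x l) al be (c^-1 * binomial A' B' v')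
      `|v l|%N (- m) rE tx) => //.
    - by apply: (subringM rE) => //; apply: others_fieldV.
    - by rewrite absz_gt0.
    - rewrite -Eab E Ee -invr_expz; field.
      by rewrite c0 expfz_neq0.
  - have [al [be [[Eal Ebe] al0 be0 Eab _]]] := binomial_in_var dA dB A0 B0 vl.
    have [al' [be' [[Eal' Ebe'] al'0 be'0 Eab' _]]] := binomial_in_var dA' dB' A'0 B'0 v'l.
    have [] := @binomials_proportional F _ (x l) (c * al) (c * be) al' be'
      `|v l|%N `|v' l|%N m rE tx (x0 l) (subringM rE Ec Eal) (subringM rE Ec Ebe) Eal' Ebe'
      (mulf_neq0 c0 al0) (mulf_neq0 c0 be0) al'0 be'0.
    - by rewrite absz_gt0.
    - by rewrite absz_gt0.
    - by rewrite -Eab' E Eab Ee; ring.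
    by move=> m0 -> _ _; rewrite Ee m0 expr0z mulr1.
have de : degree0 e.
  move=> l; have [->|li] := eqVneq l i; last by have [] := E_l l li.
  by apply: (@Laurent_others_field _ _ _ _ (predC1 i)) De; rewrite /= eqxx.
have absv l : `|v' l|%N = `|v l|%N.
  by have [->|li] := eqVneq l i; [rewrite vi v'i|have [] := E_l l li].
have [/existsP[l vl]|] := boolP [exists l, v l != 0]; last first.
  rewrite negb_exists => /forallP v0; left.
  have {}v0 : v =1 (fun => 0) by move=> l; have := v0 l; rewrite negbK => /eqP.
  by split=> // l; apply/eqP; rewrite -absz_eq0 absv v0.
right; split=> //.
have rE := others_field_ring j l x; have tx := var_transcendental (k := l) ax.
have v'l : v' l != 0 by rewrite -absz_eq0 absv absz_eq0.
have [al [be [[Eal Ebe] al0 be0 Eab S]]] := binomial_in_var dA dB A0 B0 vl.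
have [al' [be' [[Eal' Ebe'] al'0 be'0 Eab' S']]] := binomial_in_var dA' dB' A'0 B'0 v'l.
have [] := @binomials_proportional F _ (x l) (e * al) (e * be) al' be'
  `|v l|%N `|v' l|%N 0 rE tx (x0 l) (subringM rE (de l) Eal) (subringM rE (de l) Ebe) Eal' Ebe'
  (mulf_neq0 e0 al0) (mulf_neq0 e0 be0) al'0 be'0.
- by rewrite absz_gt0.
- by rewrite absz_gt0.
- by rewrite -Eab' E Eab expr0z mulr1; ring.
move=> _ _ Ea Eb; rewrite absv in S'.
have deM c : degree0 c -> degree0 (e * c).
  by move=> dc l'; apply: (subringM (others_field_ring j l' x)).
have sgnE (w w' : 'I_n -> int) : (fun i' => zpos (w i')) =1 (fun i' => zpos (w' i')) ->
    (fun i' => zpos (- w i')) =1 (fun i' => zpos (- w' i')) -> w =1 w'.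
  by move=> Ep En i'; rewrite -(zposB (w i')) -(zposB (w' i')) Ep En.
have same (C C' : F) (w w' : 'I_n -> int) : degree0 C -> degree0 C' -> C != 0 ->
    C' * mon x w' = e * (C * mon x w) -> w' =1 w /\ C' = e * C.
  move=> dC dC' C0; rewrite mulrA => /esym/(degree0_mon_eq (deM _ dC) dC') [].
    exact: mulf_neq0.
  by move=> ww ->; split=> // i'; rewrite ww.
have top C C' w w' : al * x l ^+ `|v l|%N = C * mon x w ->
    al' * x l ^+ `|v l|%N = C' * mon x w' -> C' * mon x w' = e * (C * mon x w).
  by move=> <- <-; rewrite Ea mulrA.
have bot C C' w w' : be = C * mon x w -> be' = C' * mon x w' ->
    C' * mon x w' = e * (C * mon x w).
  by move=> <- <-.
move: S S'; case: ifP => s; case: ifP => s' [Sa Sb] [Sa' Sb'].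
- left; have [Ev EA] := same _ _ _ _ dA dA' A0 (top _ _ _ _ Sa Sa').
  have [Ev' EB] := same _ _ _ _ dB dB' B0 (bot _ _ _ _ Sb Sb').
  by split; [apply: sgnE|split].
- right; have [Ev EA] := same _ _ _ _ dA dB' A0 (top _ _ _ _ Sa Sa').
  have [Ev' EB] := same _ _ _ _ dB dA' B0 (bot _ _ _ _ Sb Sb').
  split; last by split.
  by apply: sgnE => i'; rewrite ?opprK; [apply: Ev'|apply: Ev].
- right; have [Ev EA] := same _ _ _ _ dB dA' B0 (top _ _ _ _ Sa Sa').
  have [Ev' EB] := same _ _ _ _ dA dB' A0 (bot _ _ _ _ Sb Sb').
  split; last by split.
  by apply: sgnE => i'; rewrite ?opprK; [apply: Ev|apply: Ev'].
- left; have [Ev EA] := same _ _ _ _ dB dB' B0 (top _ _ _ _ Sa Sa').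
  have [Ev' EB] := same _ _ _ _ dA dA' A0 (bot _ _ _ _ Sb Sb').
  by split; [apply: sgnE|split].
Qed.

End CompareExchangePolynomials.

(** * Seeds with coefficients in the semifield *)

(** The numbers 1 / d i, multiplied by a common denominator. *)
Lemma integral_symmetrizer n (d : 'I_n -> rat) : (forall i, 0 < d i) ->
  exists2 f : 'I_n -> int, forall i, 0 < f i &
  forall b : 'I_n -> 'I_n -> int, symmetrized_by d b ->
    forall i l, b i l * f l = - (b l i * f i).
Proof.
move=> d0; pose N : rat := \prod_i (numq (d i))%:~R.
have dE i : d i = (numq (d i))%:~R / (denq (d i))%:~R by rewrite divq_num_den.
have num0 i : 0 < numq (d i) by rewrite numq_gt0.
pose f i : int := denq (d i) * \prod_(l | l != i) numq (d l).
have f0 i : 0 < f i by rewrite mulr_gt0 ?denq_gt0 // prodr_gt0.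
have fE i : (f i)%:~R * d i = N.
  rewrite /N (bigD1 i) //= [in LHS]dE /f rmorphM rmorph_prod /=.
  have : (denq (d i))%:~R != 0 :> rat by rewrite intr_eq0 denq_neq0.
  by move=> D0; field.
clearbody f; exists f => // b [_ sb] i l.
have dn0 i' : d i' != 0 by rewrite gt_eqF.
apply: (@intr_inj rat); rewrite rmorphN !rmorphM /=.
apply: (mulfI (dn0 i)); apply: (mulfI (dn0 l)).
transitivity ((d i * (b i l)%:~R) * ((f l)%:~R * d l)); first by ring.
by rewrite fE sb -(fE i); ring.
Qed.

Section SemifieldSeeds.
Variables (P : semifieldType) (K F : fieldType) (u : P -> K) (j : {rmorphism K -> F}).
Hypothesis hu : is_group_ring_fractions u.
Variable n : nat.

Lemma group_ring_intr_eq0 (m : int) : (m%:~R == 0 :> F) = (m == 0).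
Proof.
apply/eqP/eqP => [|->] //; rewrite -(rmorph_int j) => /eqP; rewrite fmorph_eq0 => /eqP m0.
have : `|m|%:R = 0 :> K.
  case: m m0 => m; first by [].
  by rewrite NegzE rmorphN /= => /eqP; rewrite oppr_eq0 => /eqP.
move=> m0'; have : perm_eq (nseq `|m| (1%g : P)) [::].
  apply: (group_elements_independent hu).
  by rewrite big_nil big_nseq iter_addr_0 (group_ring_one hu).
by move/perm_nilP; case: m {m0 m0'} => [[|m]|m].
Qed.

Record pseed := PSeed {
  pvar : 'I_n -> F;
  pup : 'I_n -> P;
  pdn : 'I_n -> P;
  pmat : 'I_n -> 'I_n -> int
}.

Implicit Types (S T : pseed) (k i l : 'I_n).

Definition seed_of S : lseed K F n :=
  LSeed (pvar S) (fun i => u (pup S i)) (fun i => u (pdn S i)) (pmat S).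

Definition exchange_poly S k : F := lexchange j (seed_of S) k.

Record psound S : Prop := PSound {
  psound_indep : alg_indep j (pvar S);
  psound_normalized : forall i, oplus (pup S i) (pdn S i) = 1%g
}.

Record pmutation k S S' : Prop := PMutation {
  pmut_other : forall i, i != k -> pvar S' i = pvar S i;
  pmut_new : pvar S k * pvar S' k = exchange_poly S k;
  pmut_mat : forall i l, pmat S' i l = matrix_mutation k (pmat S) i l;
  pmut_coef_new : (pup S' k / pdn S' k = pdn S k / pup S k)%g;
  pmut_coef_pos : forall i, i != k -> 0 <= pmat S k i ->
    (pup S' i / pdn S' i = expgz (pup S k) (pmat S k i) * (pup S i / pdn S i))%g;
  pmut_coef_neg : forall i, i != k -> pmat S k i <= 0 ->
    (pup S' i / pdn S' i = expgz (pdn S k) (pmat S k i) * (pup S i / pdn S i))%g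
}.

Inductive ppath S0 : pseed -> Prop :=
| ppath0 : ppath S0 S0
| ppath_step k S S' : ppath S0 S -> pmutation k S S' -> psound S' -> ppath S0 S'.

Lemma group_elementV g : u (g^-1)%g = (u g)^-1.
Proof.
apply: (mulfI (group_ring_unit hu g)).
by rewrite -(group_ring_mul hu) mulgV (group_ring_one hu) mulfV // (group_ring_unit hu).
Qed.

Lemma group_element_div g h : u (g / h)%g = u g / u h.
Proof. by rewrite (group_ring_mul hu) group_elementV. Qed.

Lemma group_element_expgz g (m : int) : u (expgz g m) = u g ^ m.
Proof.
have X (s : nat) : u (g ^+ s)%g = u g ^+ s.
  elim: s => [|s IHs]; first by rewrite expg0 expr0 (group_ring_one hu).
  by rewrite expgS exprS (group_ring_mul hu) IHs.
by case: m => s; rewrite /= ?X // group_elementV X NegzE -exprnN.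
Qed.

Lemma group_element_inj g h : u g = u h -> g = h.
Proof.
move=> E; have : perm_eq [:: g] [:: h].
  by apply: (group_elements_independent hu); rewrite !big_seq1.
by move/perm_mem/(_ g); rewrite !inE eqxx => /esym/eqP.
Qed.

Lemma seed_of_valid d S : psound S -> symmetrized_by d (pmat S) ->
  lvalid j d (seed_of S).
Proof.
move=> [ax _] sb; split=> //= i; exact: (group_ring_unit hu).
Qed.

Lemma seed_of_mutation k S S' : pmutation k S S' ->
  lmutation j k (seed_of S) (seed_of S').
Proof.
move=> [other new mat cn cp cm]; split=> //=.
- rewrite -!(group_ring_mul hu); congr u.
  have -> : pup S' k = (pdn S k / pup S k * pdn S' k)%g by rewrite -cn mulgVK.
  by rewrite semifield_mulAC mulgVK semifield_mulC.
- by move=> i ik b0; rewrite -!group_element_div cp // (group_ring_mul hu) group_element_expgz.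
- by move=> i ik b0; rewrite -!group_element_div cm // (group_ring_mul hu) group_element_expgz.
Qed.

Lemma eq_symmetrized d (b b' : 'I_n -> 'I_n -> int) :
  (forall i l, b' i l = b i l) -> symmetrized_by d b -> symmetrized_by d b'.
Proof. by move=> bb [d0 sb]; split=> // i l; rewrite !bb sb. Qed.

Lemma ppath_lpath d S0 S : psound S0 -> symmetrized_by d (pmat S0) -> ppath S0 S ->
  lpath j d (seed_of S0) (seed_of S) /\ symmetrized_by d (pmat S).
Proof.
move=> v0 s0; elim=> [|k S1 S2 _ [p1 s1] m12 v2].
  by split=> //; apply: lpath0; apply: seed_of_valid.
have s2 : symmetrized_by d (pmat S2).
  by apply: eq_symmetrized (pmut_mat m12) _; apply: symmetrized_mutation.
split=> //; apply: lpath_step p1 (seed_of_mutation m12) _.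
exact: seed_of_valid.
Qed.

Lemma ppath_sound S0 S : psound S0 -> ppath S0 S -> psound S.
Proof. by move=> v0; case. Qed.

(** The value of an exchange polynomial is p+ (+) p-, which is 1. *)
Lemma ppath_tropicalizes S0 S i : psound S0 -> ppath S0 S ->
  tropicalizes u j (pvar S0) (pvar S i) 1%g.
Proof.
move=> v0 p; have ax := psound_indep v0; elim: p i => [|k S1 S2 p1 IH m12 v2] i.
  exact: tropicalizes_var.
have [->|ik] := eqVneq i k; last by rewrite (pmut_other m12).
have v1 := ppath_sound v0 p1; have x0 := alg_indep_neq0 k (psound_indep v1).
have -> : pvar S2 k = exchange_poly S1 k * (pvar S1 k)^-1.
  by rewrite -(pmut_new m12) mulrAC mulfV ?mul1r.
rewrite -[1%g]mulg1 -{2}(invg1 P); apply: (tropicalizesM hu); last first.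
  exact: (tropicalizesV hu ax).
rewrite -(psound_normalized v1 k) -[pup S1 k]mulg1 -[pdn S1 k]mulg1.
rewrite /exchange_poly /lexchange /=.
by apply: (tropicalizesD hu); apply: (tropicalizesM hu);
  (try exact: tropicalizes_const); apply: (tropicalizes1_mon hu) => // l; apply: zpos_ge0.
Qed.

Lemma isolated_exchange S i : (forall l, pmat S l i = 0) ->
  exchange_poly S i = j (u (pup S i)) + j (u (pdn S i)).
Proof.
move=> bi; rewrite /exchange_poly /lexchange /mon /= !big1 ?mulr1 // => l _.
  by rewrite bi oppr0 expr0z.
by rewrite bi expr0z.
Qed.

(** Mutations at other vertices do not involve the variable at an isolated
    vertex i, and those at i alternate between two variables, swapping the two
    coefficients. The first clause keeps the vertex isolated, which the
    induction needs. *)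
Lemma ppath_isolated S0 S i : psound S0 -> ppath S0 S ->
  (forall l, pmat S0 l i = 0) -> (forall l, pmat S0 i l = 0) ->
  [/\ forall l, pmat S l i = 0 /\ pmat S i l = 0,
      forall l, l != i -> others_field j i (pvar S0) (pvar S l) &
      (pvar S i = pvar S0 i /\ pup S i = pup S0 i /\ pdn S i = pdn S0 i) \/
      (pvar S i = exchange_poly S0 i / pvar S0 i /\
         pup S i = pdn S0 i /\ pdn S i = pup S0 i)].
Proof.
move=> v0 p col row; have ax := psound_indep v0.
have rE := others_field_ring j i (pvar S0).
elim: p => [|k S1 S2 p1 [z1 E1 alt1] m12 v2].
  by split=> //; [move=> l li; apply: others_field_var|left].
have v1 := ppath_sound v0 p1.
have x0 := alg_indep_neq0 i ax.
split.
- move=> l; rewrite !(pmut_mat m12) !matrix_mutationE.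
  have [zl1 zl2] := z1 l; have [zk1 zk2] := z1 k.
  by rewrite zl1 zl2 zk1 zk2 oppr0 (zpos0 (lexx 0)) !(mul0r, mulr0, addr0); do 2!case: ifP.
- move=> l li; have [lk|lk] := eqVneq l k; last first.
    by rewrite (pmut_other m12) //; apply: E1.
  rewrite lk in li * => {l lk}.
  have x1 := alg_indep_neq0 k (psound_indep v1).
  have -> : pvar S2 k = exchange_poly S1 k / pvar S1 k.
    by rewrite -(pmut_new m12) mulrAC mulfV ?mul1r.
  apply: others_field_div; last exact: E1.
  apply: lexchange_in => //; first by move=> c; apply: others_field_const.
  move=> l /= blk; apply: E1; apply: contraNneq blk => ->.
  by have [_ ->] := z1 k.
have eqS1 : exchange_poly S1 i = exchange_poly S0 i.
  rewrite !isolated_exchange //; last by move=> l; have [] := z1 l.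
  by case: alt1 => -[_ [-> ->]] //; rewrite addrC.
have [ik|ik] := eqVneq i k; last first.
  rewrite (pmut_other m12) //.
  have [bki _] := z1 k; have := pmut_coef_pos m12 ik; rewrite bki lexx /= expg0 mul1g.
  move/(_ isT)/(normalized_ratio (psound_normalized v1 i) (psound_normalized v2 i)) => [-> ->].
  exact: alt1.
have [pE qE] : pup S2 i = pdn S1 i /\ pdn S2 i = pup S1 i.
  have N := psound_normalized v1 i; rewrite oplusC in N.
  apply: (normalized_ratio N (psound_normalized v2 i)).
  by rewrite ik; apply: (pmut_coef_new m12).
have x1 := alg_indep_neq0 i (psound_indep v1).
have new : pvar S2 i = exchange_poly S0 i / pvar S1 i.
  have : pvar S1 i * pvar S2 i = exchange_poly S0 i.
    by rewrite -eqS1 ik (pmut_new m12).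
  by move=> <-; rewrite mulrAC mulfV // mul1r.
rewrite pE qE new; case: alt1 => -[xE [-> ->]]; [right|left]; rewrite xE //.
split=> //; rewrite xE in x1.
have M0 : exchange_poly S0 i != 0 by apply: contraNneq x1 => ->; rewrite mul0r.
by rewrite invfM invrK mulVKf.
Qed.

End SemifieldSeeds.

(** * Seeds with the same cluster *)

Section SeedFamilies.
Variables (P : semifieldType) (K F : fieldType) (u : P -> K) (j : {rmorphism K -> F}).
Hypothesis hu : is_group_ring_fractions u.
Variable n : nat.
Local Notation pseed := (pseed P F n).
Local Notation exchange_poly := (exchange_poly u j).
Local Notation Lau := (laurent_ring_on j).

Definition same_seed_up_to (s : 'I_n -> 'I_n) (T S : pseed) : Prop :=
  [/\ forall i, pvar T i = pvar S (s i),
      forall i, pup T i = pup S (s i) /\ pdn T i = pdn S (s i) &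
      forall i l, pmat T i l = pmat S (s i) (s l)].

(** The labelings of the seeds of a cluster algebra. A path of labeled
    mutations reaches a given labeling only up to a permutation s. *)
Record seed_family (Fam : pseed -> Prop) : Prop := SeedFamily {
  family_sound : forall S, Fam S -> psound j S;
  family_symmetrized : forall S, Fam S -> exists d, symmetrized_by d (pmat S);
  family_mutation : forall S, Fam S -> forall k,
    exists2 S', Fam S' & pmutation u j k S S';
  family_connected : forall S S', Fam S -> Fam S' -> exists T s,
    [/\ injective s, ppath u j S T & same_seed_up_to s T S']
}.

Variable Fam : pseed -> Prop.
Hypothesis fam : seed_family Fam.
Implicit Types (S T : pseed) (i k l : 'I_n).

Lemma injective_ord_onto (s : 'I_n -> 'I_n) : injective s -> forall i, exists l, s l = i.
Proof. by move=> /injF_bij[g _ gK] i; exists (g i). Qed.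

Lemma family_indep S : Fam S -> alg_indep j (pvar S).
Proof. by move=> /(family_sound fam)/psound_indep. Qed.

Lemma family_Laurent S S' i : Fam S -> Fam S' -> Lau predT (pvar S) (pvar S' i).
Proof.
move=> fS fS'; have [T [s [sI p [xE _ _]]]] := family_connected fam fS fS'.
have [l <-] := injective_ord_onto sI i; rewrite -xE.
have vS := family_sound fam fS; have [d sb] := family_symmetrized fam fS.
have [lp _] := ppath_lpath hu vS sb p.
exact: (Laurent_phenomenon (seed_of_valid hu vS sb) l lp).
Qed.

Lemma family_tropicalizes S S' i : Fam S -> Fam S' ->
  tropicalizes u j (pvar S) (pvar S' i) 1%g.
Proof.
move=> fS fS'; have [T [s [sI p [xE _ _]]]] := family_connected fam fS fS'.
have [l <-] := injective_ord_onto sI i; rewrite -xE.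
exact: (ppath_tropicalizes hu l (family_sound fam fS) p).
Qed.

Lemma family_diag S k : Fam S -> pmat S k k = 0.
Proof. by move=> /(family_symmetrized fam)[d sb]; apply: symmetrized_diag sb k. Qed.

Lemma family_eq0 S k l : Fam S -> pmat S k l = 0 -> pmat S l k = 0.
Proof.
by move=> /(family_symmetrized fam)[d sb] /eqP; rewrite (symmetrized_eq0 sb) => /eqP.
Qed.

Lemma family_isolated S S' i : Fam S -> Fam S' -> (forall l, pmat S l i = 0) ->
  exists i',
    (forall l, l != i' -> others_field j i (pvar S) (pvar S' l)) /\
    ((pvar S' i' = pvar S i /\ pup S' i' = pup S i /\ pdn S' i' = pdn S i) \/
      pvar S' i' = exchange_poly S i / pvar S i).
Proof.
move=> fS fS' bi; have [T [s [sI p [xE cE bE]]]] := family_connected fam fS fS'.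
have row l : pmat S i l = 0 by apply: (family_eq0 fS).
have [_ oth alt] := ppath_isolated (family_sound fam fS) p bi row.
exists (s i); split.
  move=> l; have [l' <-] := injective_ord_onto sI l; rewrite (inj_eq sI) -xE.
  exact: oth.
have [cE1 cE2] := cE i; rewrite -xE -cE1 -cE2.
by case: alt => [|[-> _]]; [left|right].
Qed.

Lemma family_sign S S' : Fam S -> Fam S' -> (forall i, pvar S' i = pvar S i) ->
  forall i l, (0 < pmat S' i l) = (0 < pmat S i l).
Proof.
move=> fS fS' xx i l; have [T [s [sI p [xE cE bE]]]] := family_connected fam fS fS'.
have vS := family_sound fam fS; have [d sb] := family_symmetrized fam fS.
have [lp _] := ppath_lpath hu vS sb p; have [d0 _] := sb.
have [f f0 fd] := integral_symmetrizer d0.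
have xT i' : lvar (seed_of u T) i' = lvar (seed_of u S) (s i') by rewrite /= xE xx.
have H := cluster_determines_form (seed_of_valid hu vS sb) f0 fd sI lp xT.
have [i' <-] := injective_ord_onto sI i; have [l' <-] := injective_ord_onto sI l.
have := H i' l'; rewrite /= bE => /eqP; rewrite -subr_eq0 -rmorphB.
rewrite /= (group_ring_intr_eq0 j hu) subr_eq0 => /eqP E.
by rewrite -(pmulr_lgt0 _ (f0 l')) E pmulr_lgt0.
Qed.

Lemma family_exchange_neq0 S k : Fam S -> exchange_poly S k != 0.
Proof.
move=> fS; have [S' fS' m] := family_mutation fam fS k.
rewrite -(pmut_new m) mulf_neq0 //.
  exact: alg_indep_neq0 k (family_indep fS).
exact: alg_indep_neq0 k (family_indep fS').
Qed.

Lemma exchange_poly_Laurent S (A : pred 'I_n) k : (forall i, pmat S i k != 0 -> A i) ->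
  Lau A (pvar S) (exchange_poly S k).
Proof. by move=> bA; apply: (@lexchange_Laurent _ _ j _ (seed_of u S)). Qed.

Lemma exchange_poly_others S k : Fam S -> Lau (predC1 k) (pvar S) (exchange_poly S k).
Proof.
move=> fS; apply: exchange_poly_Laurent => i bi /=.
by apply: contraNneq bi => ->; rewrite (family_diag k fS).
Qed.

Lemma Lau_others S k a : Lau (predC1 k) (pvar S) a -> others_field j k (pvar S) a.
Proof. by apply: Laurent_others_field; rewrite /= eqxx. Qed.

Lemma family_var_not_others S i : Fam S -> ~ others_field j i (pvar S) (pvar S i).
Proof.
move=> fS Ei; have ax := family_indep fS.
have := others_field_power (m := 1) ax (subring1 (others_field_ring j i (pvar S))) Ei (oner_neq0 _).
by rewrite mul1r expr1z => /(_ erefl).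
Qed.

(** The other variables of S' are free of the variable at i, so that variable
    must still be in its slot; it is not the exchanged one, since its square is
    not free of it. *)
Lemma family_isolated_coef S S' i : Fam S -> Fam S' -> pvar S' i = pvar S i ->
  (forall l, pmat S l i = 0) ->
  (forall l, l != i -> others_field j i (pvar S) (pvar S' l)) /\
  pup S' i = pup S i /\ pdn S' i = pdn S i.
Proof.
move=> fS fS' xi z; have ax := family_indep fS.
have [i' [oth alt]] := family_isolated fS fS' z.
have [ii'|ii'] := eqVneq i i'; last first.
  by case: (family_var_not_others fS (i := i)); rewrite -xi; apply: oth.
rewrite -ii' in alt oth; split=> //; case: alt => [[_ //]|].
rewrite xi => Ex; have x0 := alg_indep_neq0 i ax.
have Exx : 1 * pvar S i ^ 2 = exchange_poly S i.
  by rewrite mul1r -[pvar S i ^ 2]/(pvar S i * pvar S i) {2}Ex mulrCA mulfV ?mulr1.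
by have := others_field_power (m := 2) ax (subring1 (others_field_ring j i (pvar S)))
  (Lau_others (exchange_poly_others i fS)) (oner_neq0 _) Exx.
Qed.

Lemma exchange_poly_binomial S k :
  exchange_poly S k =
    binomial (pvar S) (j (u (pup S k))) (j (u (pdn S k))) (fun i => pmat S i k).
Proof. by []. Qed.

Lemma coef_degree0 (x : 'I_n -> F) g : degree0 j x (j (u g)).
Proof. by move=> l; apply: others_field_const. Qed.

Lemma coef_neq0 g : j (u g) != 0.
Proof. by rewrite fmorph_eq0 (group_ring_unit hu). Qed.

Lemma mutated_Laurent S S' i k : Fam S -> Fam S' ->
  Lau predT (upd (pvar S) k (exchange_poly S k / pvar S k)) (pvar S' i).
Proof.
move=> fS fS'; have [S1 fS1 m] := family_mutation fam fS k.
have := family_Laurent i fS1 fS'; apply: Laurent_ext => l _; rewrite /upd.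
case: eqP => [->|/eqP lk]; last by rewrite (pmut_other m).
by rewrite -(pmut_new m) mulrAC mulfV ?mul1r // (alg_indep_neq0 k (family_indep fS)).
Qed.

(** The variable obtained by mutation at k is transcendental over the field of
    the other variables. *)
Lemma mutated_coefficient S k c (m : int) : Fam S ->
  others_field j k (pvar S) c ->
  Lau predT (upd (pvar S) k (exchange_poly S k / pvar S k))
    (c * (exchange_poly S k / pvar S k) ^ m) ->
  Lau (predC1 k) (pvar S) c.
Proof.
move=> fS Ec L; have ax := family_indep fS; have x0 := alg_indep_neq0 k ax.
set y := exchange_poly S k / pvar S k in L.
have M0 := family_exchange_neq0 k fS; have y0 : y != 0 by rewrite mulf_neq0 ?invr_eq0.
have ty : transcendental (others_field j k (pvar S)) y.
  apply: transcendental_flip => //.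
  - exact: others_field_ring.
  - by apply/Lau_others/exchange_poly_others.
  - exact: var_transcendental.
apply: (laurent_coefficient (others_field_ring j k (pvar S)) _
  (Laurent_subring j (predC1 k) (pvar S)) ty y0 Ec (m := m)).
  by move=> d; apply: Lau_others.
have y1 : upd (pvar S) k y k = y by rewrite upd_same.
rewrite -[X in laurent _ X]y1.
have : laurent (Lau (predD1 predT k) (upd (pvar S) k y)) (upd (pvar S) k y k) (c * y ^ m).
  by apply: Laurent_laurent => //; rewrite y1.
apply: laurentS => d /Laurent_upd; rewrite /= eqxx => /(_ isT).
by apply: LaurentS => l /=; rewrite andbT.
Qed.

(** The variable obtained from S' by mutation at i is a Laurent polynomial in
    the cluster obtained from S by mutation at i. Hence the exchange polynomial
    of S divides that of S', and conversely. *)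
Lemma compare_columns S S' i (a : 'I_n -> F) : Fam S -> Fam S' ->
  (forall l, degree0 j (pvar S) (a l)) -> (forall l, a l != 0) ->
  (forall l, pvar S' l = a l * pvar S l) -> a i = 1 ->
  Lau (predC1 i) (pvar S) (exchange_poly S' i) ->
  Lau (predC1 i) (pvar S') (exchange_poly S i) ->
  (forall c, Lau (predC1 i) (pvar S') c -> Lau (predC1 i) (pvar S) c) ->
  let A := j (u (pup S i)) in let B := j (u (pdn S i)) in
  let A' := j (u (pup S' i)) * mon a (fun l => zpos (pmat S' l i)) in
  let B' := j (u (pdn S' i)) * mon a (fun l => zpos (- pmat S' l i)) in
  (forall l, pmat S l i = 0) /\ (forall l, pmat S' l i = 0) \/
  exists e, degree0 j (pvar S) e /\
   (((forall l, pmat S' l i = pmat S l i) /\ A' = e * A /\ B' = e * B) \/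
   ((forall l, pmat S' l i = - pmat S l i) /\ A' = e * B /\ B' = e * A)).
Proof.
move=> fS fS' da a0 xE ai LN LM LL A B A' B'.
have ax := family_indep fS; have ax' := family_indep fS'.
have M0 := family_exchange_neq0 i fS; have N0 := family_exchange_neq0 i fS'.
have xi' : pvar S' i = pvar S i by rewrite xE ai mul1r.
have x0 := alg_indep_neq0 i ax.
have rL := Laurent_subring j (predC1 i) (pvar S).
pose e := exchange_poly S' i / exchange_poly S i.
have e0 : e != 0 by rewrite mulf_neq0 ?invr_eq0.
have De : Lau (predC1 i) (pvar S) e.
  apply: (mutated_coefficient (m := 1) fS).
    apply: others_field_div; apply: Lau_others => //.
    exact: exchange_poly_others.
  have -> : e * (exchange_poly S i / pvar S i) ^ 1 = exchange_poly S' i / pvar S' i.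
    by rewrite expr1z xi' /e mulrA divfK.
  have [S1 fS1 m1] := family_mutation fam fS' i.
  have := mutated_Laurent i i fS fS1.
  suff -> : pvar S1 i = exchange_poly S' i / pvar S' i by [].
  by rewrite -(pmut_new m1) mulrAC mulfV ?mul1r // xi'.
have DeV : Lau (predC1 i) (pvar S) e^-1.
  apply: LL; apply: (mutated_coefficient (m := 1) fS').
    rewrite invfM invrK mulrC.
    by apply: others_field_div; apply: Lau_others => //; apply: exchange_poly_others.
  have -> : e^-1 * (exchange_poly S' i / pvar S' i) ^ 1 = exchange_poly S i / pvar S i.
    by rewrite expr1z xi' /e invfM invrK; field; rewrite N0 x0.
  have [S1 fS1 m1] := family_mutation fam fS i.
  have := mutated_Laurent i i fS' fS1.
  suff -> : pvar S1 i = exchange_poly S i / pvar S i by [].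
  by rewrite -(pmut_new m1) mulrAC mulfV ?mul1r.
have monE v : mon (pvar S') v = mon a v * mon (pvar S) v.
  by rewrite /mon -big_split; apply: eq_bigr => l _; rewrite /= xE expfzMl.
have dmon v : degree0 j (pvar S) (mon a v).
  move=> l; have rE := others_field_ring j l (pvar S).
  by apply: (subring_prod rE) => l' _; apply: subringXz => //; [apply: da|apply/others_fieldV/da].
have dM c c' : degree0 j (pvar S) c -> degree0 j (pvar S) c' -> degree0 j (pvar S) (c * c').
  by move=> dc dc' l; apply: (subringM (others_field_ring j l (pvar S))).
have E : binomial (pvar S) A' B' (fun l => pmat S' l i) =
    e * binomial (pvar S) A B (fun l => pmat S l i).
  rewrite -exchange_poly_binomial /e divfK // exchange_poly_binomial /binomial !monE.
  by rewrite /A' /B'; ring.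
have vi : (fun l => pmat S l i) i = 0 := family_diag i fS.
have v'i : (fun l => pmat S' l i) i = 0 := family_diag i fS'.
have [|] := compare_binomials (v := fun l => pmat S l i) (v' := fun l => pmat S' l i)
   ax (coef_degree0 _ _) (coef_degree0 _ _)
   (dM _ _ (coef_degree0 _ _) (dmon _)) (dM _ _ (coef_degree0 _ _) (dmon _))
   (coef_neq0 _) (coef_neq0 _) (mulf_neq0 (coef_neq0 _) (mon_neq0 _ a0))
   (mulf_neq0 (coef_neq0 _) (mon_neq0 _ a0)) M0 vi v'i De DeV e0 E.
  by left.
by move=> [de H]; right; exists e.
Qed.

(** The columns agree up to sign by comparison, and with the same sign by the
    invariant form. The factor between the normalized coefficients is 1. *)
Lemma family_cluster_determines_seed S S' : Fam S -> Fam S' ->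
  (forall i, pvar S' i = pvar S i) ->
  forall i, [/\ pup S' i = pup S i, pdn S' i = pdn S i &
    forall l, pmat S' l i = pmat S l i].
Proof.
move=> fS fS' xx i; have ax := family_indep fS.
have LL c : Lau (predC1 i) (pvar S') c -> Lau (predC1 i) (pvar S) c.
  by apply: Laurent_ext => l _.
have LL' c : Lau (predC1 i) (pvar S) c -> Lau (predC1 i) (pvar S') c.
  by apply: Laurent_ext => l _.
have one0 (l : 'I_n) : (1 : F) != 0 by apply: oner_neq0.
have done1 (l : 'I_n) : degree0 j (pvar S) 1.
  by move=> l'; apply: subring1 (others_field_ring j l' (pvar S)).
have mon1 v : mon (fun _ : 'I_n => 1 : F) v = 1.
  by rewrite /mon big1 // => l _; rewrite exp1rz.
have xx1 l : pvar S' l = 1 * pvar S l by rewrite mul1r.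
have [||[z z']|[e [de]]] := compare_columns fS fS' done1 one0 xx1 erefl _ _ LL.
- by apply/LL/exchange_poly_others.
- by apply/LL'/exchange_poly_others.
- have [_ [-> ->]] := family_isolated_coef fS fS' (xx i) z.
  by split=> // l; rewrite z z'.
rewrite !mon1 !mulr1 => -[[bE [E1 E2]]|[bE [E1 E2]]].
  suff [g pg qg] : exists2 g, pup S' i = (g * pup S i)%g & pdn S' i = (g * pdn S i)%g.
    have g1 := normalized_scale (psound_normalized (family_sound fam fS) i)
      (psound_normalized (family_sound fam fS') i) pg qg.
    by rewrite pg qg g1 !mul1g.
  exists (pup S' i / pup S i)%g; first by rewrite mulgVK.
  apply: (group_element_inj hu); apply: (fmorph_inj j).
  rewrite E2 (group_ring_mul hu) (group_element_div hu) !rmorphM fmorphV E1.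
  by rewrite mulfK ?coef_neq0.
have [/existsP[l bl]|] := boolP [exists l, pmat S l i != 0]; last first.
  rewrite negb_exists => /forallP z.
  have {}z l : pmat S l i = 0 by have := z l; rewrite negbK => /eqP.
  have [_ [-> ->]] := family_isolated_coef fS fS' (xx i) z.
  by split=> // l; rewrite bE z oppr0.
have sg := family_sign fS fS' xx l i; have sg' := family_sign fS' fS (fun l => esym (xx l)) i l.
have [d sb] := family_symmetrized fam fS; have [d' sb'] := family_symmetrized fam fS'.
have := symmetrized_gt0 sb i l; have := symmetrized_gt0 sb' i l.
rewrite -sg' !bE in sg *.
by move: bl sg; rewrite neq_lt => /orP[]; lia.
Qed.

End SeedFamilies.

(** * Clusters that differ in one variable *)

Section AdjacentClusters.
Variables (P : semifieldType) (K F : fieldType) (u : P -> K) (j : {rmorphism K -> F}).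
Hypothesis hu : is_group_ring_fractions u.
Variable n : nat.
Local Notation pseed := (pseed P F n).
Local Notation exchange_poly := (exchange_poly u j).
Local Notation Lau := (laurent_ring_on j).
Variable Fam : pseed -> Prop.
Hypothesis fam : seed_family u j Fam.
Implicit Types (S T : pseed) (i k l : 'I_n).

Lemma Laurent_off_two_var S i k a : Fam S -> i != k ->
  Lau (predC1 k) (pvar S) a -> laurent (Lau (off_two i k) (pvar S)) (pvar S i) a.
Proof.
move=> fS ik /(Laurent_laurent (alg_indep_neq0 i (family_indep fam fS))).
by apply: laurentS => d; apply: LaurentS.
Qed.

Lemma off_two_transcendental S i k : Fam S ->
  transcendental (Lau (off_two i k) (pvar S)) (pvar S i).
Proof.
move=> fS; apply: (transcendentalS _ (var_transcendental (k := i) (family_indep fam fS))).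
by move=> d; apply: Laurent_others_field; rewrite /off_two /= eqxx.
Qed.

Lemma unit_in_var S i k d : Fam S -> i != k -> Lau (predC1 k) (pvar S) d ->
  Lau (predC1 k) (pvar S) d^-1 -> d != 0 ->
  exists c (m : int), [/\ Lau (off_two i k) (pvar S) c, Lau (off_two i k) (pvar S) c^-1, c != 0 &
    d = c * pvar S i ^ m].
Proof.
move=> fS ik Ld LdV d0.
have rR := Laurent_subring j (off_two i k) (pvar S).
have x0 := alg_indep_neq0 i (family_indep fam fS).
have tx := off_two_transcendental (i := i) (k := k) fS.
have La := Laurent_off_two_var fS ik Ld; have LaV := Laurent_off_two_var fS ik LdV.
have [c [m [Rc c0 Ec]]] :=
  laurent_factor_monomial rR tx x0 (subring1 rR) (oner_neq0 F) La LaV (mulfV d0).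
have [c' [m' [Rc' c'0 Ec']]] :=
  laurent_factor_monomial rR tx x0 (subring1 rR) (oner_neq0 F) LaV La (mulVf d0).
exists c, m; split=> //.
have E : (c * c') * pvar S i ^ (m + m') = 1.
  by rewrite expfzDr // mulrACA -Ec -Ec' mulfV.
have RE a : Lau (off_two i k) (pvar S) a -> others_field j i (pvar S) a.
  by apply: Laurent_others_field; rewrite /off_two /= eqxx.
have mm : m + m' = 0.
  apply: (others_field_power (family_indep fam fS) _ _ _ E); last exact: mulf_neq0.
    by apply: RE; apply: (subringM rR).
  exact: subring1 (others_field_ring j i (pvar S)).
rewrite mm expr0z mulr1 in E.
suff -> : c^-1 = c' by [].
by apply: (mulfI c0); rewrite E mulfV.
Qed.

Lemma isolated_dec S i : {forall l, pmat S l i = 0} + {exists l, pmat S l i != 0}.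
Proof.
case: (boolP [exists l, pmat S l i != 0]) => [H|]; first by right; apply/existsP.
rewrite negb_exists => /forallP H; left => l.
by have := H l; rewrite negbK => /eqP.
Qed.

(** If x l occurs in a binomial, its two terms have different degrees in x l,
    whereas units are homogeneous. *)
Lemma exchange_poly_nonunit S i : Fam S -> (exists l, pmat S l i != 0) ->
  Lau (predC1 i) (pvar S) (exchange_poly S i)^-1 -> False.
Proof.
move=> fS [l bl] LV; have ax := family_indep fam fS.
have li : l != i by apply: contraNneq bl => ->; rewrite (family_diag fam i fS).
have LM := exchange_poly_others fam i fS.
have M0 := family_exchange_neq0 fam i fS.
have [c [m [Rc _ c0 E]]] := unit_in_var fS li LM LV M0.
have [al [be [[Eal Ebe] al0 be0 Eab _]]] := binomial_in_var ax
  (coef_degree0 u j (pvar S) (pup S i)) (coef_degree0 u j (pvar S) (pdn S i))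
  (coef_neq0 j hu _) (coef_neq0 j hu _) (v := fun l => pmat S l i) bl.
apply: (binomial_not_monomial (others_field_ring j l (pvar S))
  (var_transcendental (k := l) ax) (alg_indep_neq0 l ax) Eal Ebe _ al0 be0 _
  (k := `|pmat S l i|%N) (m := m) (ga := c)).
- by apply: Laurent_others_field Rc; rewrite /off_two /= eqxx.
- by rewrite absz_gt0; apply: bl.
by rewrite -Eab -E.
Qed.

Definition adjacent_at k S S' : Prop := forall i, i != k -> pvar S' i = pvar S i.

Lemma adjacent_sym k S S' : adjacent_at k S S' -> adjacent_at k S' S.
Proof. by move=> a i /a->. Qed.

Lemma adjacent_Laurent (A : pred 'I_n) k S S' a : adjacent_at k S S' -> ~~ A k ->
  Lau A (pvar S') a -> Lau A (pvar S) a.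
Proof.
move=> aSS Ak; apply: Laurent_ext => i Ai; apply: aSS.
by apply: contraTneq Ai => ->.
Qed.

Lemma off_twoS i k a (x : 'I_n -> F) : Lau (off_two i k) x a -> Lau (predC1 i) x a.
Proof. by apply: LaurentS => l /andP[]. Qed.

(** If m < 0, then substituting M / y for x i, where M is the exchange
    polynomial of i, produces the denominator M^-m, which a Laurent polynomial
    in the mutated cluster cannot have because M is not a unit. If i is
    isolated, the variable at k of S' is free of x i. *)
Lemma exchange_factor_degree_ge0 k i S S' c (m : int) : Fam S -> Fam S' ->
  adjacent_at k S S' -> i != k -> c != 0 ->
  Lau (off_two i k) (pvar S) c -> Lau (off_two i k) (pvar S) c^-1 ->
  pvar S' k = c * pvar S i ^ m * pvar S k -> 0 <= m.
Proof.
move=> fS fS' aSS ik c0 Rc RcV E; have ax := family_indep fam fS.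
have ki : k != i by rewrite eq_sym.
have rE := others_field_ring j i (pvar S).
have Exk : others_field j i (pvar S) (pvar S k) by apply: others_field_var.
have Ec : others_field j i (pvar S) c by apply: Laurent_others_field Rc; rewrite /off_two /= eqxx.
have xk0 := alg_indep_neq0 k ax; have xi0 := alg_indep_neq0 i ax.
case: (isolated_dec S i) => [z|nz].
  have [oth _] := family_isolated_coef fam fS fS' (aSS i ik) z.
  suff -> : m = 0 by [].
  apply: (others_field_power ax (a := c * pvar S k) _ (oth k ki)).
  - exact: (subringM rE).
  - exact: mulf_neq0.
  by rewrite E; ring.
rewrite leNgt; apply/negP => m0.
have M0 := family_exchange_neq0 fam i fS.
have rL := Laurent_subring j (predC1 i) (pvar S).
have LM := exchange_poly_others fam i fS.
have LMm : Lau (predC1 i) (pvar S) (c * pvar S k * exchange_poly S i ^ m).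
  apply: (mutated_coefficient (m := - m) fam fS).
    apply: (subringM rE); first exact: (subringM rE).
    by apply: subringXz => //; [apply/Lau_others|apply/others_fieldV/Lau_others].
  suff -> : c * pvar S k * exchange_poly S i ^ m *
      (exchange_poly S i / pvar S i) ^ (- m) = pvar S' k.
    exact: (mutated_Laurent hu fam k i fS fS').
  rewrite E expfzMl exprz_inv opprK; set M := exchange_poly S i.
  have EM : M ^ m * M ^ (- m) = 1 by rewrite -expfzDr // subrr expr0z.
  by rewrite -[RHS]mulr1 -EM; ring.
apply: (exchange_poly_nonunit fS nz).
have -> : (exchange_poly S i)^-1 =
    c^-1 * (pvar S k)^-1 * (c * pvar S k * exchange_poly S i ^ m) * exchange_poly S i ^ (- m - 1).
  have -> : c^-1 * (pvar S k)^-1 * (c * pvar S k * exchange_poly S i ^ m) = exchange_poly S i ^ m.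
    by field; apply/andP.
  rewrite -expfzDr //; have -> : m + (- m - 1) = - 1 by ring.
  by [].
apply: (subringM rL).
  apply: (subringM rL) LMm; apply: (subringM rL); first exact: off_twoS RcV.
  by apply: Laurent_varV.
have : 0 <= - m - 1 by lia.
by case: (- m - 1) => // s _; apply: (subringX rL).
Qed.

(** The factor d has degree 0 in each variable. In the column of a direction i
    connected to k, one term of the exchange polynomial of S' contains a power
    of d and the other does not, so the comparison with S expresses this power
    by coefficients. Thus it is an element of P, and its value in P is 1. *)
Lemma exchange_factor_trivial k S S' d : Fam S -> Fam S' -> adjacent_at k S S' ->
  (exists i, pmat S i k != 0) ->
  Lau (predC1 k) (pvar S) d -> Lau (predC1 k) (pvar S) d^-1 -> d != 0 ->
  pvar S' k = d * pvar S k -> pvar S' k = pvar S k.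
Proof.
move=> fS fS' aSS [i bik] Ld LdV d0 E; have ax := family_indep fam fS.
(* S and S' play symmetric roles, which bounds the degree from both sides *)
have deg0 l : l != k -> Lau (off_two l k) (pvar S) d /\ Lau (off_two l k) (pvar S) d^-1.
  move=> lk; have [c [m [Rc RcV c0 Ed]]] := unit_in_var fS lk Ld LdV d0.
  suff m0 : m = 0 by rewrite Ed m0 expr0z mulr1.
  have xl0 := alg_indep_neq0 l ax.
  apply/eqP; rewrite eq_le; apply/andP; split; last first.
    by apply: (exchange_factor_degree_ge0 fS fS' aSS lk c0 Rc RcV); rewrite E Ed.
  rewrite -oppr_ge0; have aSS' := adjacent_sym aSS.
  have up a : Lau (off_two l k) (pvar S) a -> Lau (off_two l k) (pvar S') a.
    by apply: (adjacent_Laurent aSS'); rewrite /off_two /= eqxx andbF.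
  apply: (exchange_factor_degree_ge0 fS' fS aSS' lk (c := c^-1)).
  - by rewrite invr_eq0.
  - exact: up.
  - by rewrite invrK; apply: up.
  by rewrite E Ed aSS // -invr_expz; field; rewrite c0 expfz_neq0.
have dd : degree0 j (pvar S) d.
  move=> l; have [->|lk] := eqVneq l k; first exact: Lau_others.
  by have [H _] := deg0 l lk; apply: Laurent_others_field H; rewrite /off_two /= eqxx.
have bki : pmat S k i != 0.
  by apply: contraNneq bik => /(family_eq0 fam fS) ->.
have ik : i != k by apply: contraNneq bik => ->; rewrite (family_diag fam k fS).
have ki : k != i by rewrite eq_sym.
have [Rd RdV] := deg0 i ik.
have xE l : pvar S' l = upd (fun => 1) k d l * pvar S l.
  by rewrite /upd; case: eqP => [->|/eqP lk] //; rewrite mul1r aSS.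
have rL := Laurent_subring j (predC1 i) (pvar S).
have rL' := Laurent_subring j (predC1 i) (pvar S').
have up a : Lau (off_two i k) (pvar S) a -> Lau (off_two i k) (pvar S') a.
  by apply: (adjacent_Laurent (adjacent_sym aSS)); rewrite /off_two /= eqxx andbF.
have LL c : Lau (predC1 i) (pvar S') c -> Lau (predC1 i) (pvar S) c.
  move: c; apply: Laurent_min => //; first by move=> c; apply: Laurent_const.
  move=> l li; rewrite xE /upd; case: eqP => [->|_]; last first.
    by rewrite mul1r; split; [apply: Laurent_var|apply: Laurent_varV].
  rewrite invfM; split; apply: (subringM rL).
  - exact: off_twoS Rd.
  - exact: Laurent_var.
  - exact: off_twoS RdV.
  - exact: Laurent_varV.
have LL' c : Lau (predC1 i) (pvar S) c -> Lau (predC1 i) (pvar S') c.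
  move: c; apply: Laurent_min => //; first by move=> c; apply: Laurent_const.
  move=> l li; have [->|lk] := eqVneq l k; last first.
    by rewrite -aSS //; split; [apply: Laurent_var|apply: Laurent_varV].
  have -> : pvar S k = d^-1 * pvar S' k by rewrite E mulKf.
  rewrite invfM invrK; split; apply: (subringM rL').
  - exact/off_twoS/up.
  - exact: Laurent_var.
  - exact/off_twoS/up.
  - exact: Laurent_varV.
have da l : degree0 j (pvar S) (upd (fun => 1) k d l).
  rewrite /upd; case: eqP => // _ l'; exact: subring1 (others_field_ring j l' (pvar S)).
have a0 l : upd (fun => 1) k d l != 0.
  by rewrite /upd; case: (l == k); rewrite ?oner_neq0.
have ai : upd (fun => 1) k d i = 1 by rewrite upd_neq.
have ex_power (v : 'I_n -> int) : mon (upd (fun => 1) k d) v = d ^ v k.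
  rewrite mon_upd /mon big1 ?mulr1 // => l _; exact: exp1rz.
have root g c : (0 < c)%N -> d ^+ c = j (u g) -> pvar S' k = pvar S k.
  move=> c0 Edc; have Tz := family_tropicalizes hu fam k fS fS'.
  have Tx := family_tropicalizes hu fam k fS fS.
  have Td : tropicalizes u j (pvar S) d 1%g.
    have -> : d = pvar S' k * (pvar S k)^-1 by rewrite E mulfK // (alg_indep_neq0 k ax).
    rewrite -[1%g]mulg1 -{2}(invg1 P); apply: (tropicalizesM hu) => //.
    exact: (tropicalizesV hu ax).
  have := tropicalizesX hu c Td; rewrite Edc expg1n => Tg.
  have g1 : g = 1%g := tropicalizes_unique hu ax (tropicalizes_const j hu (pvar S) g) Tg.
  rewrite g1 (group_ring_one hu) rmorph1 in Edc.
  by rewrite E (subtraction_free_root hu ax Td c0 Edc) mul1r.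
have solve (g1 g2 g3 g4 : P) e c : (0 < c)%N ->
    j (u g1) * d ^+ c = e * j (u g2) -> j (u g3) = e * j (u g4) -> pvar S' k = pvar S k.
  move=> c0 E1 E2; apply: (root (g3 * g2 / (g4 * g1))%g c c0).
  have Ee : e = j (u g3) / j (u g4) by rewrite E2 mulfK // (coef_neq0 j hu).
  rewrite (group_element_div hu) !(group_ring_mul hu) fmorph_div !rmorphM.
  apply: (mulfI (coef_neq0 j hu g1)); rewrite E1 Ee; field.
  by rewrite !(coef_neq0 j hu).
have c0 : (0 < `|pmat S k i|)%N by rewrite absz_gt0.
have [||[z _]|[e [de]]] := compare_columns hu fam fS fS' da a0 xE ai _ _ LL.
- exact: LL (exchange_poly_others fam i fS').
- exact: LL' (exchange_poly_others fam i fS).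
- by rewrite z eqxx in bki.
rewrite !ex_power => -[[bE [E1 E2]]|[bE [E1 E2]]]; rewrite !bE in E1 E2.
  have [b0|b0] : 0 < pmat S k i \/ pmat S k i < 0 by move: bki; rewrite neq_lt => /orP[]; auto.
    rewrite (zposE (ltW b0)) -(gtz0_abs b0) in E1; rewrite zpos0 ?expr0z ?mulr1 in E2; last by lia.
    exact: solve c0 E1 E2.
  rewrite zpos0 ?expr0z ?mulr1 in E1; last by lia.
  rewrite zposE -?(ltz0_abs b0) in E2; last by lia.
  exact: solve c0 E2 E1.
have [b0|b0] : 0 < pmat S k i \/ pmat S k i < 0 by move: bki; rewrite neq_lt => /orP[]; auto.
  rewrite zpos0 ?expr0z ?mulr1 in E1; last by lia.
  rewrite opprK (zposE (ltW b0)) -(gtz0_abs b0) in E2.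
  exact: solve c0 E2 E1.
rewrite opprK zpos0 ?expr0z ?mulr1 in E2; last by lia.
rewrite zposE -?(ltz0_abs b0) in E1; last by lia.
exact: solve c0 E1 E2.
Qed.

(** The variable at k of S' and the variable exchanged with it are Laurent
    polynomials in x k whose product is free of x k. *)
Lemma exchange_variable_monomial k S S' : Fam S -> Fam S' -> adjacent_at k S S' ->
  exists c (m : int), [/\ Lau (predC1 k) (pvar S) c, c != 0 &
    pvar S' k = c * pvar S k ^ m].
Proof.
move=> fS fS' aSS; have ax := family_indep fam fS.
have [T fT mT] := family_mutation fam fS' k.
have rR := Laurent_subring j (predC1 k) (pvar S).
have lau U : Fam U -> laurent (Lau (predC1 k) (pvar S)) (pvar S k) (pvar U k).
  move=> fU; have := Laurent_laurent (alg_indep_neq0 k ax) (family_Laurent hu fam k fS fU).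
  by apply: laurentS => c; apply: LaurentS => l /=; rewrite andbT.
have tx : transcendental (Lau (predC1 k) (pvar S)) (pvar S k).
  by apply: (transcendentalS _ (var_transcendental (k := k) ax)) => c; apply: Lau_others.
have N0 := family_exchange_neq0 fam k fS'.
have LN : Lau (predC1 k) (pvar S) (exchange_poly S' k).
  apply: (adjacent_Laurent aSS); first by rewrite /off_two /= eqxx.
  exact: (exchange_poly_others fam k fS').
have [c [m [Rc c0 Ec]]] := laurent_factor_monomial rR tx (alg_indep_neq0 k ax) LN N0
  (lau _ fS') (lau _ fT) (pmut_new mT).
by exists c, m.
Qed.

(** The relation is symmetric in S and S', so the two exponents are inverse to
    each other. *)
Lemma exchange_variable_unit k S S' : Fam S -> Fam S' -> adjacent_at k S S' ->
  exists c c' (m : int), [/\ Lau (predC1 k) (pvar S) c, Lau (predC1 k) (pvar S) c',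
    c != 0, pvar S' k = c * pvar S k ^ m & (m = 1 /\ c * c' = 1) \/ m = - 1].
Proof.
move=> fS fS' aSS; have ax := family_indep fam fS.
have x0 := alg_indep_neq0 k ax; have rE := others_field_ring j k (pvar S).
have [c [m [Rc c0 E]]] := exchange_variable_monomial fS fS' aSS.
have [c' [m' [Rc' c'0 E']]] := exchange_variable_monomial fS' fS (adjacent_sym aSS).
have {}Rc' : Lau (predC1 k) (pvar S) c'.
  by apply: (adjacent_Laurent aSS) Rc'; rewrite /off_two /= eqxx.
exists c, c', m; split=> //.
have EE : c' * c ^ m' * pvar S k ^ (m * m' - 1) = 1.
  have Ex : pvar S k ^ (m * m' - 1) * pvar S k = pvar S k ^ (m * m').
    by rewrite -{2}[pvar S k]expr1z -expfzDr // subrK.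
  apply: (mulIf x0); rewrite -[LHS]mulrA Ex mul1r.
  by rewrite [RHS]E' E expfzMl -exprz_exp mulrA.
have mm : m * m' - 1 = 0.
  apply: (others_field_power ax _ _ _ EE).
  - apply: (subringM rE); first exact: Lau_others.
    by apply: subringXz => //; [apply: Lau_others|apply/others_fieldV/Lau_others].
  - exact: subring1 rE.
  - by rewrite mulf_neq0 // expfz_neq0.
have [m1|m1] : m = 1 \/ m = - 1.
  have : `|m|%N = 1%N.
    apply/eqP; rewrite -dvdn1; apply/dvdnP; exists `|m'|%N.
    by rewrite mulnC -abszM; have -> : m * m' = 1 by apply/eqP; rewrite -subr_eq0 mm.
  by lia.
- left; split=> //; rewrite mm expr0z mulr1 in EE.
  have m'1 : m' = 1 by move/eqP: mm; rewrite m1 mul1r subr_eq0 => /eqP.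
  by rewrite mulrC -EE m'1 expr1z.
by right.
Qed.

(** If the exponent is 1, the two variables at k are equal, which is excluded.
    If it is -1, the same argument applies to the mutation of S at k. *)
Lemma adjacent_cluster_unique k S S' : Fam S -> Fam S' -> adjacent_at k S S' ->
  pvar S' k != pvar S k -> pvar S' k = exchange_poly S k / pvar S k.
Proof.
move=> fS fS' aSS zx; have ax := family_indep fam fS.
have x0 := alg_indep_neq0 k ax; have M0 := family_exchange_neq0 fam k fS.
case: (isolated_dec S k) => [z|nz].
  have [i' [oth alt]] := family_isolated fam fS fS' z.
  have [Ei'|ki'] := eqVneq k i'.
    by rewrite -Ei' in alt; case: alt => [[xk _]|//]; rewrite xk eqxx in zx.
  have i'k : i' != k by rewrite eq_sym.
  case: (family_var_not_others fam fS (i := k)).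
  have Exi' : others_field j k (pvar S) (pvar S' i').
    by rewrite aSS //; apply: others_field_var.
  case: alt => [[<- _] //|E]; rewrite E in Exi'.
  have -> : pvar S k = exchange_poly S k / (exchange_poly S k / pvar S k).
    by rewrite invfM invrK mulVKf.
  by apply: others_field_div => //; apply/Lau_others/(exchange_poly_others fam k fS).
have [c [c' [m [Rc Rc' c0 E]]]] := exchange_variable_unit fS fS' aSS.
case=> [[m1 cc]|m1].
  have cV : c^-1 = c' by apply: (mulfI c0); rewrite cc mulfV.
  case/eqP: zx; apply: (exchange_factor_trivial fS fS' aSS nz Rc _ c0).
    by rewrite cV.
  by rewrite E m1 expr1z.
(* for m = - 1, compare with the variable obtained by mutation instead *)
have [T fT mT] := family_mutation fam fS k.
have yE : pvar T k = exchange_poly S k / pvar S k.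
  by rewrite -(pmut_new mT) mulrAC mulfV ?mul1r.
have aST : adjacent_at k S T by move=> i ik; apply: (pmut_other mT).
have aTS' : adjacent_at k T S' by move=> i ik; rewrite aSS // aST.
have axT := family_indep fam fT.
have [c1 [c1' [m' [Rc1 Rc1' c10 E1]]]] := exchange_variable_unit fT fS' aTS'.
have TS a : Lau (predC1 k) (pvar T) a -> Lau (predC1 k) (pvar S) a.
  by apply: (adjacent_Laurent aST); rewrite /off_two /= eqxx.
have ST a : Lau (predC1 k) (pvar S) a -> Lau (predC1 k) (pvar T) a.
  by apply: (adjacent_Laurent (adjacent_sym aST)); rewrite /off_two /= eqxx.
have m'1 : m' = 1.
  have H : c1^-1 * (c / exchange_poly S k) * pvar T k ^ (1 - m') = 1.
    have y0 := alg_indep_neq0 k axT.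
    have : c1 * pvar T k ^ m' = c / exchange_poly S k * pvar T k.
      rewrite -E1 E m1 yE; have -> : pvar S k ^ (- 1) = (pvar S k)^-1 by [].
      by field; rewrite x0 M0.
    move=> H; rewrite expfzDr // expr1z mulrA -[c1^-1 * _ * _]mulrA -H mulKf //.
    by rewrite -expfzDr // subrr expr0z.
  apply/esym/eqP; rewrite -subr_eq0; apply/eqP.
  have rE := others_field_ring j k (pvar T).
  apply: (others_field_power axT _ _ _ H).
  - apply: (subringM rE); first by apply/others_fieldV/Lau_others.
    by apply: others_field_div; apply/Lau_others/ST => //; apply: (exchange_poly_others fam k fS).
  - exact: subring1 rE.
  - by rewrite !mulf_neq0 ?invr_eq0.
case=> [[_ cc]|m'N]; last by rewrite m'1 in m'N.
have cV : c1^-1 = c1' by apply: (mulfI c10); rewrite cc mulfV.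
rewrite -yE; apply: (exchange_factor_trivial fT fS' aTS' _ Rc1 _ c10).
- case: nz => i bik; exists i.
  by rewrite (pmut_mat mT) matrix_mutationE eqxx orbT oppr_eq0.
- by rewrite cV.
by rewrite E1 m'1 expr1z.
Qed.

End AdjacentClusters.

(** * The seeds of a cluster algebra *)

Lemma alg_indep_reindex (K F : fieldType) (j : {rmorphism K -> F}) n (x y : 'I_n -> F)
    (s r : 'I_n -> 'I_n) :
  cancel s r -> (forall i, y i = x (s i)) -> alg_indep j x -> alg_indep j y.
Proof.
move=> sr yx ax q qy.
pose ren (s' : 'I_n -> 'I_n) := mmap (@mpolyC n K) (fun i => 'X_(s' i) : {mpoly K[n]}).
have E1 : mmap j x (ren s q) = mmap j y q.
  pose f := mmap j x \o mmap (@mpolyC n K) (fun i => 'X_(s i) : {mpoly K[n]}).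
  apply: (@mpoly_hom_ext _ _ _ f (mmap j y)) => [c|i] /=.
    by rewrite !mmapC.
  by rewrite !mmapX !mmap1U mmapX mmap1U yx.
have E2 : ren r (ren s q) = q.
  apply: (@mpoly_hom_ext _ _ _ (mmap (@mpolyC n K) (fun i => 'X_(r i)) \o
     mmap (@mpolyC n K) (fun i => 'X_(s i))) idfun) => [c|i] /=.
    by rewrite !mmapC.
  by rewrite !mmapX !mmap1U mmapX mmap1U sr.
rewrite -E2 (ax (ren s q)) ?rmorph0 //; first exact: (rmorph0 (mmap (@mpolyC n K) _)).
by rewrite E1.
Qed.

Section LabeledTriples.
Variables (P : semifieldType) (n : nat) (F : ambientField P n).

Definition base_map : {rmorphism fracZP F -> F} :=
  (ambient_iso F : {rmorphism _ -> _}) \o (@tofrac {mpoly (fracZP F)[n]}) \o (@mpolyC n (fracZP F)).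

Let u := @fracZP_coef P n F.
Let hu : is_group_ring_fractions u := fracZP_coefP F.
Local Notation pseed := (pseed P F n).

Record labels (s : triple F) (t : 'I_n -> cluster s) (S : pseed) : Prop := Labels {
  labels_bij : bijective t;
  labels_var : forall i, pvar S i = val (t i);
  labels_up : forall i, pup S i = pplus (t i);
  labels_dn : forall i, pdn S i = pminus (t i);
  labels_mat : forall i l, pmat S i l = bmat (t i) (t l)
}.

Definition labeled_by (s : triple F) (t : 'I_n -> cluster s) : pseed :=
  PSeed (fun i => val (t i)) (fun i => pplus (t i)) (fun i => pminus (t i))
    (fun i l => bmat (t i) (t l)).

Lemma labels_of s (t : 'I_n -> cluster s) : bijective t -> labels t (labeled_by t).
Proof. by []. Qed.

Lemma cluster_card (s : triple F) : is_seed s -> #|` cluster s| = n.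
Proof. by case=> -[t tb _] _ _; rewrite cardfE -(bij_eq_card tb) card_ord. Qed.

Lemma labels_sound s (t : 'I_n -> cluster s) S : is_seed s -> labels t S ->
  psound base_map S.
Proof.
move=> [[t0 [g0 t0K g0K] [ax _]] N _] [[g tK gK] xE pE qE _]; split; last first.
  by move=> i; rewrite pE qE N.
apply: (@alg_indep_reindex _ _ _ _ (fun i => val (t0 i)) _ (g0 \o t) (g \o t0)).
- by move=> i /=; rewrite g0K tK.
- by move=> i /=; rewrite g0K xE.
exact: ax.
Qed.

Lemma labeling_exists (s : triple F) (x : 'I_n -> F) : is_seed s ->
  (forall i, x i \in cluster s) -> (forall y, y \in cluster s -> exists i, y = x i) ->
  exists2 t : 'I_n -> cluster s, bijective t & forall i, val (t i) = x i.
Proof.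
move=> ss xs sx; pose t i : cluster s := [` xs i]%fset.
exists t => //.
have H (y : cluster s) : exists i, t i = y.
  by have [i yi] := sx _ (valP y); exists i; apply: val_inj; rewrite /= yi.
have [g gK] := fin_all_exists H.
have gI : injective g by apply: can_inj gK.
have gb : bijective g.
  by apply: inj_card_bij gI _; rewrite card_ord -cardfE (cluster_card ss).
by apply: (bij_can_bij gb) => y; apply: gK.
Qed.

Lemma exchange_rhs_labels s (t : 'I_n -> cluster s) S k : labels t S ->
  exchange_rhs (t k) = exchange_poly u base_map S k.
Proof.
move=> [tb xE pE qE bE]; rewrite /exchange_rhs /exchange_poly /lexchange /=.
have prodE (f : int -> int) (p : pred int) : (forall m, p m -> f m = `|m|%N) ->
    (forall m, ~~ p m -> f m = 0) ->
    \prod_(x : cluster s | p (bmat x (t k))) val x ^+ `|bmat x (t k)|%N =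
    mon (pvar S) (fun i => f (pmat S i k)).
  move=> fp fn; rewrite big_mkcond (reindex t) /=; last exact: onW_bij.
  apply: eq_bigr => i _; rewrite xE bE; by case: ifP => [/fp->|/negbT/fn->].
congr (_ * _ + _ * _).
- by rewrite pE.
- apply: (prodE zpos (fun m => 0 < m)) => m; rewrite /zpos; first by move=> m0; rewrite m0 gtz0_abs.
  by move=> /negbTE->.
- by rewrite qE.
- apply: (prodE (fun m => zpos (- m)) (fun m => m < 0)) => m; rewrite /zpos oppr_gt0.
    by move=> m0; rewrite m0 ltz0_abs.
  by move=> /negbTE->.
Qed.

(** The mutated cluster is labeled by giving the new variable the label of the
    old one. *)
Lemma labels_mutation s (t : 'I_n -> cluster s) S k s' : labels t S ->
  is_mutation (t k) s' ->
  exists (t' : 'I_n -> cluster s') S', [/\ labels t' S', pmutation u base_map k S S' &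
    cluster s' = (pvar S' k |` (cluster s `\ pvar S k))%fset].
Proof.
move=> L [ss' [zbar M]]; have [tb xE pE qE bE] := L.
have tI := bij_inj tb.
pose x' := upd (pvar S) k zbar.
have x's i : x' i \in cluster s'.
  rewrite (mutation_cluster M) /x'; have [->|ik] := eqVneq i k.
    by rewrite upd_same !inE eqxx.
  by rewrite upd_neq // !inE xE (inj_eq val_inj) (inj_eq tI) ik (valP (t i)) orbT.
have sx' y : y \in cluster s' -> exists i, y = x' i.
  rewrite (mutation_cluster M) !inE => /orP[/eqP->|/andP[yk ys]].
    by exists k; rewrite /x' upd_same.
  have [g tK gK] := tb; exists (g [` ys]%fset); rewrite /x' upd_neq ?xE ?gK //.
  by apply: contraNneq yk => E; rewrite -E gK.
have [t' t'b t'E] := labeling_exists ss' x's sx'.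
have L' := labels_of t'b.
exists t', (labeled_by t'); split=> //; last first.
  by rewrite (mutation_cluster M) /= t'E /x' upd_same xE.
have rel i : val (t' i) = relabel (t k) zbar (t i).
  by rewrite t'E /x' /upd /relabel (inj_eq tI) xE.
split=> /=.
- by move=> i ik; rewrite t'E /x' upd_neq.
- by rewrite t'E /x' upd_same xE (mutation_exchange M) (exchange_rhs_labels k L).
- move=> i l; rewrite (mutation_matrix M (rel i) (rel l)).
  by rewrite /matrix_mutation !(inj_eq tI) !bE.
- rewrite pE qE; apply: (mutation_coef_new M).
  by rewrite t'E /x' upd_same.
- move=> i ik; rewrite bE pE pE qE; apply: (mutation_coef_pos M).
    by rewrite (inj_eq tI).
  by rewrite t'E /x' upd_neq.
- move=> i ik; rewrite bE qE pE qE; apply: (mutation_coef_neg M).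
    by rewrite (inj_eq tI).
  by rewrite t'E /x' upd_neq.
Qed.

Lemma ppath_trans (S1 S2 S3 : pseed) : ppath u base_map S1 S2 -> ppath u base_map S2 S3 ->
  ppath u base_map S1 S3.
Proof. by move=> p12; elim=> // k S S' _ IH m v; apply: ppath_step IH m v. Qed.

Lemma labels_path s s' :
  clos_refl_trans (triple F) (fun s1 s2 => exists z : cluster s1, is_mutation z s2) s s' ->
  forall (t : 'I_n -> cluster s) S, labels t S ->
  exists (t' : 'I_n -> cluster s') S', labels t' S' /\ ppath u base_map S S'.
Proof.
elim=> {s s'} [s s' [z m]|s|s1 s2 s3 _ IH1 _ IH2] t S L.
- have [[g tK gK] _ _ _ _] := L; rewrite -(gK z) in m.
  have [t' [S' [L' mSS' _]]] := labels_mutation L m.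
  exists t', S'; split=> //; apply: ppath_step (ppath0 _ _ _) mSS' _.
  by apply: labels_sound L'; case: m.
- by exists t, S; split=> //; apply: ppath0.
have [t2 [S2 [L2 p2]]] := IH1 t S L; have [t3 [S3 [L3 p3]]] := IH2 t2 S2 L2.
by exists t3, S3; split=> //; apply: ppath_trans p2 p3.
Qed.

Lemma labels_same s (t t' : 'I_n -> cluster s) S S' : labels t S -> labels t' S' ->
  exists2 r, injective r & same_seed_up_to r S S'.
Proof.
move=> [[g tK gK] xE pE qE bE] [[g' tK' gK'] xE' pE' qE' bE'].
exists (g' \o t); first by apply: can_inj (g \o t') _ => i /=; rewrite gK' tK.
by split=> [i|i|i l] /=; rewrite ?xE ?xE' ?pE ?pE' ?qE ?qE' ?bE ?bE' !gK'.
Qed.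

Section Algebra.
Variables (A : clusterAlgebra F) (B0 : 'M[int]_n) (p0 : 'I_n -> P * P) (d0 : 'I_n -> rat).
Hypothesis hA : has_initial_seed A B0 p0.
Hypothesis hd : symmetrized_by d0 B0.

Definition algebra_seed (S : pseed) : Prop :=
  exists s (t : 'I_n -> cluster s), seeds A s /\ labels t S.

Lemma algebra_seed_family : seed_family u base_map algebra_seed.
Proof.
have sound S : algebra_seed S -> psound base_map S.
  by move=> [s [t [As L]]]; apply: labels_sound L; apply: seeds_are_seeds As.
have conn S S' : algebra_seed S -> algebra_seed S' -> exists T r,
    [/\ injective r, ppath u base_map S T & same_seed_up_to r T S'].
  move=> [s [t [As L]]] [s' [t' [As' L']]].
  have [t2 [T [LT p]]] := labels_path (seeds_connected As As') L.
  by have [r rI E] := labels_same LT L'; exists T, r.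
have [s0 As0 [e [eb _ eB]]] := hA.
have L0 := labels_of eb.
have fS0 : algebra_seed (labeled_by e) by exists s0, e.
have sb0 : symmetrized_by d0 (pmat (labeled_by e)).
  by apply: eq_symmetrized hd => i l; rewrite /= eB.
split=> //.
- move=> S /(conn _ _ fS0)[T [r [rI p [_ _ bE]]]].
  have [_ [dp dE]] := ppath_lpath hu (sound _ fS0) sb0 p.
  have [g rK gK] := injF_bij rI.
  exists (d0 \o g); split=> [i|i l] /=; first exact: dp.
  by have := dE (g i) (g l); rewrite !bE !gK.
- move=> S [s [t [As L]]] k; have [s' m As'] := seeds_mutation As (t k).
  have [t' [S' [L' mSS' _]]] := labels_mutation L m.
  by exists S' => //; exists s', t'.
Qed.

Let fam := algebra_seed_family.

Lemma algebra_cluster_determines_seed s s' : seeds A s -> seeds A s' ->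
  cluster s = cluster s' -> s = s'.
Proof.
move=> As As' E; have [[t tb _] _ _] := seeds_are_seeds As.
have [g tK gK] := tb.
have [t' t'b t'E] : exists2 t' : 'I_n -> cluster s',
    bijective t' & forall i, val (t' i) = val (t i).
  apply: labeling_exists; first exact: seeds_are_seeds As'.
    by move=> i; rewrite -E; apply: valP.
  by move=> y; rewrite -E => ys; exists (g [` ys]%fset); rewrite gK.
have fS : algebra_seed (labeled_by t) by exists s, t.
have fS' : algebra_seed (labeled_by t') by exists s', t'.
have D := family_cluster_determines_seed hu fam fS fS' t'E.
case: s s' E As As' t tb g tK gK t' t'b t'E fS fS' D => c p b [c' p' b'] /= E.
case: _ / E p' b' => p' b' _ _ t _ g tK gK t' _ t'E _ _ D.
have tt i : t' i = t i by apply: val_inj; apply: t'E.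
have -> : p = p'.
  apply/ffunP => x; have [/= pE qE _] := D (g x); move: pE qE.
  rewrite /pplus /pminus /= tt gK.
  by case: (p' x) (p x) => [a1 a2] [b1 b2] /= -> ->.
have -> : b = b'.
  apply/ffunP => -[x y]; have [/= _ _ /(_ (g x))] := D (g y).
  by rewrite /bmat /= !tt !gK.
by [].
Qed.

(** A cluster that meets X in X minus x has n elements, hence just one element
    outside this intersection. *)
Lemma algebra_adjacent_cluster X x : is_cluster A X -> x \in X ->
  exists! X' : {fset F}, is_cluster A X' /\ (X `&` X' = X `\ x)%fset.
Proof.
move=> [s As <-] xs; have ss := seeds_are_seeds As; have [[t tb _] _ _] := ss.
have [g tK gK] := tb; pose k := g [` xs]%fset; pose S := labeled_by t.
have xk : x = pvar S k by rewrite /= gK.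
have L := labels_of tb; have fS : algebra_seed S by exists s, t.
have [s' m As'] := seeds_mutation As (t k).
have [t' [S' [L' mSS' Es']]] := labels_mutation L m.
have fS' : algebra_seed S' by exists s', t'.
have ax := family_indep fam fS.
have x0 := alg_indep_neq0 k ax.
have new : pvar S' k = exchange_poly u base_map S k / pvar S k.
  by rewrite -(pmut_new mSS') mulrAC mulfV ?mul1r.
have new_neq : pvar S' k != pvar S k.
  apply/eqP => E; have := pmut_new mSS'; rewrite E => EM.
  have Exx : 1 * pvar S k ^ 2 = exchange_poly u base_map S k by rewrite mul1r -EM.
  by have := others_field_power (m := 2) ax (subring1 (others_field_ring base_map k (pvar S)))
    (Lau_others (exchange_poly_others fam k fS)) (oner_neq0 _) Exx.
exists (cluster s'); split.
  split; first by exists s'.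
  apply/fsetP => y; rewrite Es' -xk !inE; case: (eqVneq y x) => [->|yx] /=.
    have -> : (x == pvar S' k) = false.
      by apply: contraNF new_neq => /eqP<-; apply/eqP.
    by rewrite andbF.
  case ys : (y \in cluster s); rewrite /= ?andbF //.
  by rewrite orbT.
move=> X'' [[s'' As'' <-] EX].
have ss'' := seeds_are_seeds As''.
have c := cluster_card ss; have c'' := cluster_card ss''.
have sub : (cluster s `\ x `<=` cluster s'')%fset by rewrite -EX fsubsetIr.
have cD : #|` (cluster s `\ x)%fset| = n.-1.
  by have := cardfsD1 x (cluster s); rewrite xs c; lia.
have n0 : (0 < n)%N by apply: leq_ltn_trans (ltn_ord k).
have [y ys'' yX] : exists2 y, y \in cluster s'' & y \notin (cluster s `\ x)%fset.
  have [/fsubset_leq_card|/fsubsetPn[y]] := boolP (cluster s'' `<=` cluster s `\ x)%fset.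
    by rewrite c'' cD; lia.
  by exists y.
have Ey : cluster s'' = (y |` (cluster s `\ x))%fset.
  apply/esym/eqP; rewrite eqEfcard c'' cardfsU1 yX cD; apply/andP; split; last by lia.
  by rewrite fsubUset fsub1set ys''.
have yx : y != x.
  apply: contraNneq yX => yx; rewrite -EX inE ys'' yx xs //.
pose x'' := upd (pvar S) k y.
have x''s i : x'' i \in cluster s''.
  rewrite Ey /x''; have [->|ik] := eqVneq i k; first by rewrite upd_same !inE eqxx.
  by rewrite upd_neq // !inE xk /= (inj_eq val_inj) (inj_eq (bij_inj tb)) ik (valP (t i)) orbT.
have sx'' y' : y' \in cluster s'' -> exists i, y' = x'' i.
  rewrite Ey !inE => /orP[/eqP->|/andP[yk ys]]; first by exists k; rewrite /x'' upd_same.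
  exists (g [` ys]%fset); rewrite /x'' upd_neq /= ?gK //.
  by apply: contraNneq yk => E; rewrite xk -E /= gK.
have [t'' t''b t''E] := labeling_exists ss'' x''s sx''.
have fS'' : algebra_seed (labeled_by t'') by exists s'', t''.
have adj : adjacent_at k S (labeled_by t'').
  by move=> i ik; rewrite /= t''E /x'' upd_neq.
have yk : pvar (labeled_by t'') k = y by rewrite /= t''E /x'' upd_same.
have := adjacent_cluster_unique hu fam fS fS'' adj; rewrite yk -xk => /(_ yx) Eyn.
by rewrite Ey Es' -xk new Eyn xk.
Qed.

End Algebra.
End LabeledTriples.

(** Opposite entries of B0 have opposite signs, so symmetrizing their absolute
    values skew-symmetrizes B0. *)
Lemma cartan_symmetrized n (B0 : 'M[int]_n) : sign_skew_symmetric B0 ->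
  cartan_finite_type (cartan_counterpart B0) ->
  exists d : 'I_n -> rat, symmetrized_by d B0.
Proof.
move=> skew [_ _ _ [d d0 [sym _]]]; exists (fun i => d 0 i); split=> // i l.
have B00 m : B0 m m = 0.
  by case: (skew m m) => [[]//|]; rewrite -expr2; have := sqr_ge0 (B0 m m); lia.
have [->|il] := eqVneq i l; first by rewrite B00 mulr0 oppr0.
have := congr1 (fun M : 'M[rat]_n => M i l) sym.
rewrite !mxE (bigD1 l) //= big1 => [|m ml]; last first.
  by rewrite !mxE eq_sym (negbTE ml) mulr0n mul0r.
rewrite (bigD1 i) //= [in RHS]big1 => [|m mi]; last first.
  by rewrite !mxE eq_sym (negbTE mi) mulr0n mul0r.
rewrite !mxE !eqxx !mulr1n !addr0 (negbTE il) eq_sym (negbTE il).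
rewrite !rmorphN !mulrN => /oppr_inj.
have sg := skew i l.
have [[-> ->]|prod0] := sg; first by rewrite !mulr0 oppr0.
case: (ltrgtP (B0 i l) 0) prod0 => b1; last by rewrite b1 mul0r ltxx.
  rewrite (nmulr_rlt0 _ b1) => b2.
  rewrite (ltr0_norm b1) (gtr0_norm b2) rmorphN mulrN => ->.
  by rewrite opprK.
rewrite (pmulr_rlt0 _ b1) => b2.
by rewrite (gtr0_norm b1) (ltr0_norm b2) rmorphN mulrN => <-.
Qed.

Local Open Scope fset_scope.
Local Open Scope ring_scope.

Theorem theorem1p12 (P : semifieldType) (n : nat) (F : ambientField P n)
  (A : clusterAlgebra F) (B0 : 'M[int]_n) (p0 : 'I_n -> P * P)
  (hB0_skew : sign_skew_symmetric B0)
  (hB0_cartan : cartan_finite_type (cartan_counterpart B0))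
  (hB0_sign : forall i j k : 'I_n, 0 <= B0 i j * B0 i k)
  (hp0 : forall i : 'I_n, oplus (p0 i).1 (p0 i).2 = 1%g)
  (hA : has_initial_seed A B0 p0)
  (hfin : finite_type A) :
  (forall s s' : triple F, seeds A s -> seeds A s' ->
     cluster s = cluster s' -> s = s') /\
  (forall X : {fset F}, is_cluster A X -> forall x : F, x \in X ->
     exists! X' : {fset F}, is_cluster A X' /\ X `&` X' = X `\ x).
Proof.
have [d hd] := cartan_symmetrized hB0_skew hB0_cartan.
split=> [s s' As As'|X cX x xX].
- exact: (algebra_cluster_determines_seed hA hd).
- exact: (algebra_adjacent_cluster hA hd).
Qed.
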